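(* Suppose $\mathbf{X}:M\to\mathbb{E}^3$ is a smooth minimal immersion of degree five, with entropy differentials $(P_\ell)_{\ell\geqslant 2}$, whose Hopf differential vanishes to order $n\in\mathbb{N}$ (so $n\geqslant 1$) at some umbilic point. Then the Hopf differential vanishes to order $n$ at every umbilic point and the immersion $\mathbf{X}$ satisfies $$P_5+24\,\frac{(n+2)^2}{(3n+4)n}\,P_3P_2=0.$$
   Context: Surfaces are smooth and connected; $\mathbb{E}^3$ is Euclidean $3$-space. Let $\mathbf{X}:M\to\mathbb{E}^3$ be a minimal immersion of an oriented surface, with induced metric $g=d\mathbf{X}\cdot d\mathbf{X}$, Gauss curvature $K\leqslant 0$, orientation-compatible Gauss map $\mathbf{N}=(\mathbf{N}^1,\mathbf{N}^2,\mathbf{N}^3):M\to S^2$ and second fundamental form $A=-d\mathbf{N}\cdot d\mathbf{X}$. ''Non-flat'' means $K\not\equiv 0$. $M$ carries the complex structure determined by $g$ and the orientation. The Hopf differential $Q$ is the holomorphic quadratic differential on $M$ with $\mathrm{Re}(Q)=A$. The umbilic points are the points where $K=0$, equivalently the zeros of $Q$; $M'$ denotes the complement of the set of umbilic points. The stereographically projected Gauss map $G=(\mathbf{N}^1+i\mathbf{N}^2)/(1-\mathbf{N}^3):M\to\hat{\mathbb{C}}=\mathbb{C}\cup\{\infty\}$ is meromorphic, and locally injective on $M'$. On $M'$ the metric $g_0=\sqrt{-K}\,g$ is flat. Entropy differentials. Let $L$ be the canonical bundle of $M$, and let $\nabla$ be the Levi-Civita connection of $g_0$. In a local holomorphic coordinate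 $z$ on $M'$ write $\nabla_{\partial_z}\partial_z=\gamma\,\partial_z$. For a section $\sigma=s\,dz^\ell$ of $L^\ell$ let $\sigma'=(\partial_z s-\ell\gamma s)\,dz^{\ell+1}$, a section of $L^{\ell+1}$ (independent of the coordinate). For a locally injective meromorphic function $f$ set $$\mathrm{S}^\nabla_2(f)=\frac{f'''}{f'}-\frac32\left(\frac{f''}{f'}\right)^2=\left(\{f,z\}+\tfrac12\gamma^2-\partial_z\gamma\right)dz^2,\qquad \{f,z\}=\frac{\partial_z^3f}{\partial_z f}-\frac32\left(\frac{\partial_z^2 f}{\partial_z f}\right)^2,$$ where at poles of $f$ one uses $\{f,z\}=\{1/f,z\}$, and $\mathrm{S}^\nabla_{\ell+1}(f)=(\mathrm{S}^\nabla_\ell(f))'$ for $\ell\geqslant 2$. The entropy differentials of $\mathbf{X}$ are $P_\ell=\mathrm{S}^\nabla_\ell(G)$, $\ell\geqslant 2$, on $M'$; they extend to meromorphic differentials of degree $\ell$ on $M$. Degree. A non-flat minimal immersion has degree $n$ if $P_n$ vanishes identically or if $P_n=\psi_n(P_2,\ldots,P_{n-1})$ for some polynomial $\psi_n:\mathbb{C}^{n-2}\to\mathbb{C}$ that is weighted-homogeneous of degree $n$ with weights $(2,3,\ldots,n-1)$, i.e. $\psi_n$ is not identically zero and $\psi_n(\lambda^2z_1,\lambda^3z_2,\ldots,\lambda^{n-1}z_{n-2})=\lambda^n\psi_n(z_1,\ldots,z_{n-2})$ for all $\lambda\neq 0$; ''the degree'' always denotes the smallest such integer $n$. In particular the notion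 of degree presupposes that the immersion is non-flat. *)

(* Defs.v *)
From HB Require Import structures.
From mathcomp Require Import all_boot all_order all_algebra.
From mathcomp Require Import complex.
From mathcomp Require mpoly.
From mathcomp Require Import all_classical all_reals all_analysis.

Set Implicit Arguments.
Unset Strict Implicit.
Unset Printing Implicit Defensive.

Import Order.TTheory GRing.Theory Num.Theory.
Import numFieldNormedType.Exports.

Local Open Scope classical_set_scope.
Local Open Scope ring_scope.
Local Open Scope complex_scope.

Definition pd (R : realType) (V : normedModType R) (i : 'I_2)
    (f : 'rV[R]_2 -> V) : 'rV[R]_2 -> V :=
  'D_(delta_mx 0 i) f.

(* For [D] open, [f] is of class C^k on [D] iff all its iterated partial
   derivatives of order at most [k] exist and are continuous on [D]. *)
Fixpoint class_C (R : realType) (V : normedModType R) (D : set 'rV[R]_2)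
    (k : nat) (f : 'rV[R]_2 -> V) : Prop :=
  (forall x, D x -> {for x, continuous f}) /\
  (if k is k'.+1 then
     forall i : 'I_2, (forall x, D x -> derivable f x (delta_mx 0 i)) /\
                      class_C D k' (pd i f)
   else True).

Definition smooth_on (R : realType) (V : normedModType R) (D : set 'rV[R]_2)
    (f : 'rV[R]_2 -> V) : Prop :=
  forall k, class_C D k f.

Definition partials (R : realType) (n : nat) (f : 'rV[R]_2 -> 'rV[R]_n.+1)
    (x : 'rV[R]_2) : 'M[R]_(2, n.+1) :=
  \matrix_(i < 2) pd i f x.

Definition re_part (R : realType) (f : 'rV[R]_2 -> R[i]) : 'rV[R]_2 -> R^o :=
  fun x => complex.Re (f x).
Definition im_part (R : realType) (f : 'rV[R]_2 -> R[i]) : 'rV[R]_2 -> R^o :=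
  fun x => complex.Im (f x).

Definition cpd (R : realType) (i : 'I_2) (f : 'rV[R]_2 -> R[i])
    (x : 'rV[R]_2) : R[i] :=
  pd i (re_part f) x +i* pd i (im_part f) x.

(* A point [x] of the plane has complex coordinate [z = x_0 + 'i x_1]: the
   components of the vector field [d/dz = (d/dx_0 - 'i d/dx_1) / 2] and of
   the form [dz = dx_0 + 'i dx_1]. *)
Definition ddz_comp (R : realType) (i : 'I_2) : R[i] := 2^-1 * (- 'i%C) ^+ i.
Definition dz_comp (R : realType) (i : 'I_2) : R[i] := 'i%C ^+ i.

Definition ddz (R : realType) (f : 'rV[R]_2 -> R[i]) (x : 'rV[R]_2) : R[i] :=
  \sum_(i < 2) ddz_comp R i * cpd i f x.

Definition ddzbar (R : realType) (f : 'rV[R]_2 -> R[i]) (x : 'rV[R]_2) : R[i] :=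
  \sum_(i < 2) 2^-1 * 'i%C ^+ i * cpd i f x.

Definition holomorphic_on (R : realType) (D : set 'rV[R]_2)
    (f : 'rV[R]_2 -> R[i]) : Prop :=
  [/\ smooth_on D (re_part f), smooth_on D (im_part f) &
      forall x, D x -> ddzbar f x = 0].

(* [None] is the point at infinity. *)
Definition riemann_sphere (R : realType) : Type := option R[i].

Definition sphere_inv (R : realType) (w : riemann_sphere R) : riemann_sphere R :=
  match w with
  | None => Some 0
  | Some w => if w == 0 then None else Some w^-1
  end.

Definition finite_part (R : realType) (w : riemann_sphere R) : R[i] := odflt 0 w.

Definition schwarzian_fin (R : realType) (f : 'rV[R]_2 -> R[i])
    (x : 'rV[R]_2) : R[i] :=
  ddz (ddz (ddz f)) x / ddz f x - 3 / 2 * (ddz (ddz f) x / ddz f x) ^+ 2.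

Definition schwarzian (R : realType) (f : 'rV[R]_2 -> riemann_sphere R)
    (x : 'rV[R]_2) : R[i] :=
  if f x is Some _ then schwarzian_fin (fun y => finite_part (f y)) x
  else schwarzian_fin (fun y => finite_part (sphere_inv (f y))) x.

(* [ch_inv] is relevant only on [ch_im], and [ch_map] only on [ch_dom]. *)
Record chart (R : realType) (M : topologicalType) := Chart {
  ch_dom : set M;
  ch_im : set 'rV[R]_2;
  ch_map :> M -> 'rV[R]_2;
  ch_inv : 'rV[R]_2 -> M;
  ch_dom_open : open ch_dom;
  ch_im_open : open ch_im;
  ch_map_im : forall p, ch_dom p -> ch_im (ch_map p);
  ch_inv_dom : forall x, ch_im x -> ch_dom (ch_inv x);
  ch_mapK : forall p, ch_dom p -> ch_inv (ch_map p) = p;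
  ch_invK : forall x, ch_im x -> ch_map (ch_inv x) = x;
  ch_map_continuous : forall p, ch_dom p -> {for p, continuous ch_map};
  ch_inv_continuous : forall x, ch_im x -> {for x, continuous ch_inv}
}.

Definition overlap (R : realType) (M : topologicalType) (c d : chart R M) :
    set 'rV[R]_2 :=
  ch_im c `&` ch_inv c @^-1` ch_dom d.

Definition transition (R : realType) (M : topologicalType) (c d : chart R M) :
    'rV[R]_2 -> 'rV[R]_2 :=
  fun x => ch_map d (ch_inv c x).

Definition oriented_transition (R : realType) (M : topologicalType)
    (c d : chart R M) : Prop :=
  smooth_on (overlap c d) (transition c d) /\
  forall x, overlap c d x -> 0 < \det (partials (transition c d) x).

Definition oriented_atlas (R : realType) (M : topologicalType)
    (A : set (chart R M)) : Prop :=
  (forall p : M, exists2 c, A c & ch_dom c p) /\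
  (forall c d, A c -> A d -> oriented_transition c d).

(* The charts of the maximal oriented atlas containing [A]. *)
Definition oriented_chart (R : realType) (M : topologicalType)
    (A : set (chart R M)) (c : chart R M) : Prop :=
  forall d, A d -> oriented_transition c d /\ oriented_transition d c.

Definition oriented_surface (R : realType) (M : topologicalType)
    (A : set (chart R M)) : Prop :=
  [/\ hausdorff_space M, @second_countable M, connected [set: M] &
      oriented_atlas A].

Definition dot (R : realType) (u v : 'rV[R]_3) : R := (u *m v^T) 0 0.

(* The indices are integers modulo 3. *)
Definition cross (R : realType) (u v : 'rV[R]_3) : 'rV[R]_3 :=
  \row_(k < 3) (u 0 (k + 1) * v 0 (k + 2) - u 0 (k + 2) * v 0 (k + 1)).

Definition local_rep (R : realType) (M : topologicalType) (X : M -> 'rV[R]_3)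
    (c : chart R M) : 'rV[R]_2 -> 'rV[R]_3 :=
  fun x => X (ch_inv c x).

Definition first_form (R : realType) (M : topologicalType) (X : M -> 'rV[R]_3)
    (c : chart R M) (x : 'rV[R]_2) : 'M[R]_2 :=
  \matrix_(i, j) dot (pd i (local_rep X c) x) (pd j (local_rep X c) x).

Definition gauss_map (R : realType) (M : topologicalType) (X : M -> 'rV[R]_3)
    (c : chart R M) (x : 'rV[R]_2) : 'rV[R]_3 :=
  let w := cross (pd 0 (local_rep X c) x) (pd 1 (local_rep X c) x) in
  (Num.sqrt (dot w w))^-1 *: w.

Definition second_form (R : realType) (M : topologicalType) (X : M -> 'rV[R]_3)
    (c : chart R M) (x : 'rV[R]_2) : 'M[R]_2 :=
  \matrix_(i, j) (- dot (pd i (gauss_map X c) x) (pd j (local_rep X c) x)).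

Definition mean_curvature (R : realType) (M : topologicalType)
    (X : M -> 'rV[R]_3) (c : chart R M) (x : 'rV[R]_2) : R :=
  2^-1 * \tr (invmx (first_form X c x) *m second_form X c x).

Definition gauss_curvature (R : realType) (M : topologicalType)
    (X : M -> 'rV[R]_3) (c : chart R M) (x : 'rV[R]_2) : R :=
  \det (second_form X c x) / \det (first_form X c x).

Definition minimal_immersion (R : realType) (M : topologicalType)
    (A : set (chart R M)) (X : M -> 'rV[R]_3) : Prop :=
  forall c, A c ->
    smooth_on (ch_im c) (local_rep X c) /\
    forall x, ch_im c x ->
      row_free (partials (local_rep X c) x) /\ mean_curvature X c x = 0.

(* The vanishing of the Gauss curvature at [p] does not depend on the chart. *)
Definition umbilic (R : realType) (M : topologicalType) (A : set (chart R M))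
    (X : M -> 'rV[R]_3) (p : M) : Prop :=
  exists2 c, oriented_chart A c & ch_dom c p /\ gauss_curvature X c (c p) = 0.

Definition non_flat (R : realType) (M : topologicalType) (A : set (chart R M))
    (X : M -> 'rV[R]_3) : Prop :=
  exists p, ~ umbilic A X p.

(* The local holomorphic coordinates of the complex structure determined by the
   induced metric and the orientation are the positively oriented isothermal
   charts. *)
Definition holomorphic_chart (R : realType) (M : topologicalType)
    (A : set (chart R M)) (X : M -> 'rV[R]_3) (c : chart R M) : Prop :=
  oriented_chart A c /\
  forall x, ch_im c x ->
    first_form X c x 0 0 = first_form X c x 1 1 /\ first_form X c x 0 1 = 0.

(* [q dz^2] is the Hopf differential in the holomorphic coordinate [c]. *)
Definition hopf_coefficient (R : realType) (M : topologicalType)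
    (X : M -> 'rV[R]_3) (c : chart R M) (q : 'rV[R]_2 -> R[i]) : Prop :=
  holomorphic_on (ch_im c) q /\
  forall x, ch_im c x -> forall v : 'rV[R]_2,
    complex.Re (q x * (v 0 0 +i* v 0 1) ^+ 2)
    = (v *m second_form X c x *m v^T) 0 0.

Definition hopf_order (R : realType) (M : topologicalType)
    (A : set (chart R M)) (X : M -> 'rV[R]_3) (p : M) (n : nat) : Prop :=
  exists c q, [/\ holomorphic_chart A X c, ch_dom c p, hopf_coefficient X c q,
    (forall k, (k < n)%N -> iter k (@ddz R) q (c p) = 0) &
    iter n (@ddz R) q (c p) != 0].

Definition christoffel (R : realType) (g : 'rV[R]_2 -> 'M[R]_2)
    (k i j : 'I_2) (x : 'rV[R]_2) : R :=
  2^-1 * \sum_(l < 2) invmx (g x) k l *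
    (pd i (fun y => g y j l : R^o) x + pd j (fun y => g y i l : R^o) x
     - pd l (fun y => g y i j : R^o) x).

(* The value of [dz] on the covariant derivative of [d/dz] along [d/dz], for the
   complex-bilinear extension of the Levi-Civita connection of [g]. *)
Definition connection_coef (R : realType) (g : 'rV[R]_2 -> 'M[R]_2)
    (x : 'rV[R]_2) : R[i] :=
  \sum_(k < 2) dz_comp R k *
    \sum_(i < 2) \sum_(j < 2)
      ddz_comp R i * ddz_comp R j * (christoffel g k i j x)%:C.

(* The coefficient of the differential of degree [k + 2], i.e. of
   S_{k+2}^nabla(f) with [gamma] the connection coefficient. *)
Fixpoint nabla_schwarzian (R : realType) (gamma : 'rV[R]_2 -> R[i])
    (f : 'rV[R]_2 -> riemann_sphere R) (k : nat) (x : 'rV[R]_2) : R[i] :=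
  match k with
  | 0 => schwarzian f x + 2^-1 * gamma x ^+ 2 - ddz gamma x
  | k'.+1 => ddz (nabla_schwarzian gamma f k') x
             - (k' + 2)%:R * gamma x * nabla_schwarzian gamma f k' x
  end.

Definition flat_metric (R : realType) (M : topologicalType) (X : M -> 'rV[R]_3)
    (c : chart R M) (x : 'rV[R]_2) : 'M[R]_2 :=
  Num.sqrt (- gauss_curvature X c x) *: first_form X c x.

Definition stereo_gauss_map (R : realType) (M : topologicalType)
    (X : M -> 'rV[R]_3) (c : chart R M) (x : 'rV[R]_2) : riemann_sphere R :=
  let N := gauss_map X c x in
  if N 0 2 == 1 then None
  else Some ((N 0 0 +i* N 0 1) / (1 - N 0 2)%:C).

(* For [l >= 2], the coefficient of [dz^l] in the [l]-th entropy differential in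
   the holomorphic coordinate [c]; meaningful away from the umbilic points. *)
Definition entropy (R : realType) (M : topologicalType) (X : M -> 'rV[R]_3)
    (c : chart R M) (l : nat) : 'rV[R]_2 -> R[i] :=
  nabla_schwarzian (connection_coef (flat_metric X c)) (stereo_gauss_map X c)
    (l - 2).

(* An identity between differentials on the complement of the umbilic points,
   written in terms of their coefficients. *)
Definition holds_off_umbilics (R : realType) (M : topologicalType)
    (A : set (chart R M)) (X : M -> 'rV[R]_3)
    (E : chart R M -> 'rV[R]_2 -> Prop) : Prop :=
  forall c, holomorphic_chart A X c -> forall x, ch_im c x ->
    ~ umbilic A X (ch_inv c x) -> E c x.

(* A polynomial of degree [n] in variables of weights [2, 3, ..., n - 1]. *)
Definition weighted_homogeneous (R : realType) (n : nat)
    (psi : mpoly.mpoly (n - 2) R[i]) : Prop :=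
  (exists v : 'I_(n - 2) -> R[i], mpoly.meval v psi != 0) /\
  forall (lambda : R[i]) (v : 'I_(n - 2) -> R[i]), lambda != 0 ->
    mpoly.meval (fun i => lambda ^+ (i + 2) * v i) psi
    = lambda ^+ n * mpoly.meval v psi.

Definition degree_relation (R : realType) (M : topologicalType)
    (A : set (chart R M)) (X : M -> 'rV[R]_3) (n : nat) : Prop :=
  holds_off_umbilics A X (fun c x => entropy X c n x = 0) \/
  exists2 psi : mpoly.mpoly (n - 2) R[i], weighted_homogeneous psi &
    holds_off_umbilics A X (fun c x =>
      entropy X c n x
      = mpoly.meval (fun i : 'I_(n - 2) => entropy X c (i + 2) x) psi).

Definition has_degree (R : realType) (M : topologicalType)
    (A : set (chart R M)) (X : M -> 'rV[R]_3) (n : nat) : Prop :=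
  [/\ non_flat A X, (2 <= n)%N, degree_relation A X n &
      forall m, (2 <= m < n)%N -> ~ degree_relation A X m].

(* Main.v *)
Require Import Defs.
From HB Require Import structures.
From mathcomp Require Import all_boot all_order all_algebra.
From mathcomp Require Import complex ring lra zify.
From mathcomp Require mpoly.
From mathcomp Require Import all_classical all_reals all_analysis.

Set Implicit Arguments.
Unset Strict Implicit.
Unset Printing Implicit Defensive.

Import Order.TTheory GRing.Theory Num.Theory.
Import numFieldNormedType.Exports.

Local Open Scope classical_set_scope.
Local Open Scope ring_scope.
Local Open Scope complex_scope.

(* Let [q dz^2] be the Hopf differential in a local holomorphic coordinate.  The
   flat metric is [|q| |dz|^2], so its connection coefficient is [q' / (2 q)], and
   the Gauss map satisfies [G' = q W] with [W] smooth and nowhere zero.  At a zero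
   of order [m] of [q] this determines the leading terms of the entropy
   differentials: [P_2 ~ c z^-2] with [c = -m (3 m + 4) / 8], and then, by
   differentiating, [P_3 ~ - (m + 2) c z^-3] and [P_5 ~ 3 (m + 2)^2 c_3 z^-5] with
   [c_3 = - (m + 2) c].  A weighted homogeneous polynomial of degree five in
   weights 2, 3, 4 is [a z_1 z_2], so the degree relation reads [P_5 = a P_2 P_3]
   with a global constant [a]; comparing leading terms gives
   [a = -24 (m + 2)^2 / (m (3 m + 4))], an injective function of [m].  Every
   umbilic point has a finite order: otherwise [q] would vanish near it by the
   maximum principle, hence everywhere by connectedness. *)

(** * Functions of class C^k on the plane *)

(** The surface is given only by a smooth oriented atlas, and [holomorphic_on] means smooth with the
    Cauchy-Riemann equation, so two facts have to be built up. Isothermal coordinates exist at every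
    point: on a minimal surface a coordinate function is harmonic, and where its differential is
    nonzero it forms such coordinates together with its conjugate; this rests on the Poincare lemma
    and the inverse function theorem. Power series are replaced by two weaker facts: the leading
    Taylor term, obtained from mean value estimates, and the vanishing near [p] of a function all of
    whose derivatives vanish at [p]. The entropy differentials live off the umbilic points, so their
    leading terms are limits on punctured neighbourhoods. A limit cannot be differentiated, hence an
    expansion [F ~ c z^-k] is carried together with the expansions of all derivatives of [F]. A pole
    of the Gauss map at the umbilic point is avoided by projecting from the other pole of the
    sphere, which replaces [G] by [1/G] and leaves the Schwarzian unchanged. *)

Section class_C_basics.
Context {R : realType}.
Local Notation pt := 'rV[R]_2.
Implicit Types (D U : set pt).

Lemma near_open D (P : pt -> Prop) x :
  open D -> D x -> (forall y, D y -> P y) -> \near x, P x.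
Proof. by move=> oD Dx DP; apply: filterS (open_nbhs_nbhs (conj oD Dx)). Qed.

Lemma near_continuous (V : topologicalType) (f g : pt -> V) x :
  (\near x, f x = g x) -> {for x, continuous f} -> {for x, continuous g}.
Proof.
move=> fg cf; rewrite /prop_for /continuous_at -(nbhs_singleton fg).
by apply: cvg_trans cf; apply: (near_eq_cvg (F := nbhs x)).
Qed.

Lemma pd_eq_on (V : normedModType R) D (f g : pt -> V) i x :
  open D -> D x -> (forall y, D y -> f y = g y) -> pd i f x = pd i g x.
Proof. by move=> oD Dx fg; apply: near_eq_derive; apply: near_open oD Dx fg. Qed.

Lemma class_C_eq (V : normedModType R) D k (f g : pt -> V) :
  open D -> (forall y, D y -> f y = g y) -> class_C D k f -> class_C D k g.
Proof.
move=> oD; elim: k f g => [|k IH] f g fg /= [cf df]; split.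
- by move=> x Dx; apply: near_continuous (cf x Dx); exact: near_open oD Dx fg.
- done.
- by move=> x Dx; apply: near_continuous (cf x Dx); exact: near_open oD Dx fg.
- move=> i; have [dfi Cfi] := df i; split.
    move=> x Dx; apply: near_eq_derivable (dfi x Dx).
    by apply: near_open oD Dx fg.
  by apply: IH Cfi => y Dy; apply: pd_eq_on oD Dy fg.
Qed.

Lemma class_CS (V : normedModType R) D k (f : pt -> V) :
  class_C D k.+1 f -> class_C D k f.
Proof.
elim: k f => [|k IH] f /= [cf df]; split => // i.
by have [dfi Cfi] := df i; split => //; apply: IH.
Qed.

Lemma class_C_sub (V : normedModType R) D U k (f : pt -> V) :
  U `<=` D -> class_C D k f -> class_C U k f.
Proof.
move=> UD; elim: k f => [|k IH] f /= [cf df]; split=> //.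
- by move=> x Ux; exact/cf/UD.
- by move=> x Ux; exact/cf/UD.
- by move=> i; have [dfi Cfi] := df i; split => [x Ux|]; [exact/dfi/UD|exact: IH].
Qed.

(** [class_C U] constrains derivatives taken in the ambient plane at the points of [U], so it is a
    pointwise condition and can be glued from pieces. *)
Lemma class_C_local (V : normedModType R) D k (f : pt -> V) :
  (forall x, D x -> exists U, U x /\ class_C U k f) -> class_C D k f.
Proof.
elim: k f => [|k IH] f /= H; split=> //.
- by move=> x Dx; have [U [Ux [cf _]]] := H x Dx; exact: cf.
- by move=> x Dx; have [U [Ux [cf _]]] := H x Dx; exact: cf.
- move=> i; split=> [x Dx|].
    by have [U [Ux [_ /(_ i)[dfi _]]]] := H x Dx; exact: dfi.
  apply: IH => x Dx; have [U [Ux [_ /(_ i)[_ Cf]]]] := H x Dx; by exists U.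
Qed.

Lemma smooth_on_eq (V : normedModType R) D (f g : pt -> V) :
  open D -> (forall y, D y -> f y = g y) -> smooth_on D f -> smooth_on D g.
Proof. by move=> oD fg sf k; apply: class_C_eq oD fg (sf k). Qed.

Lemma smooth_on_sub (V : normedModType R) D U (f : pt -> V) :
  U `<=` D -> smooth_on D f -> smooth_on U f.
Proof. by move=> UD sf k; apply: class_C_sub UD (sf k). Qed.

Lemma smooth_on_local (V : normedModType R) D (f : pt -> V) :
  (forall x, D x -> exists U, U x /\ smooth_on U f) -> smooth_on D f.
Proof.
move=> H k; apply: class_C_local => x Dx.
by have [U [Ux sf]] := H x Dx; exists U; split.
Qed.

Lemma smooth_on_pd (V : normedModType R) D (f : pt -> V) i :
  smooth_on D f -> smooth_on D (pd i f).
Proof. by move=> sf k; have [_ /(_ i)[]] := sf k.+1. Qed.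

Lemma smooth_on_continuous (V : normedModType R) D (f : pt -> V) x :
  smooth_on D f -> D x -> {for x, continuous f}.
Proof. by move=> /(_ 0%N)[cf _]; exact: cf. Qed.

Lemma smooth_on_derivable (V : normedModType R) D (f : pt -> V) i x :
  smooth_on D f -> D x -> derivable f x (delta_mx 0 i).
Proof. by move=> /(_ 1%N)[_ /(_ i)[df _]]; exact: df. Qed.

Lemma class_C_cst (V : normedModType R) D k (a : V) : class_C D k (cst a).
Proof.
elim: k a => [|k IH] a /=; split=> //; try by move=> x _; exact: cst_continuous.
move=> i; split=> [x _|]; first exact: derivable_cst.
suff -> : pd i (cst a) = cst 0 by exact: IH.
by apply/funext => x; rewrite /pd derive_cst.
Qed.

Lemma class_CD D k (f g : pt -> R^o) : open D ->
  class_C D k f -> class_C D k g -> class_C D k (fun x => f x + g x).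
Proof.
move=> oD; elim: k f g => [|k IH] f g /= [cf df] [cg dg]; split=> //.
- by move=> x Dx; exact: (continuousD (cf x Dx) (cg x Dx)).
- by move=> x Dx; exact: (continuousD (cf x Dx) (cg x Dx)).
- move=> i; have [dfi Cf] := df i; have [dgi Cg] := dg i; split.
    by move=> x Dx; apply: derivableD; [exact: dfi|exact: dgi].
  apply: (@class_C_eq _ _ _ (fun x => pd i f x + pd i g x)) => //.
    by move=> x Dx; rewrite /pd deriveD//; [exact: dfi|exact: dgi].
  exact: IH.
Qed.

Lemma class_CN D k (f : pt -> R^o) : open D ->
  class_C D k f -> class_C D k (fun x => - f x).
Proof.
move=> oD; elim: k f => [|k IH] f /= [cf df]; split; [|exact: I| |].
- by move=> x Dx; exact: (continuousN (cf x Dx)).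
- by move=> x Dx; exact: (continuousN (cf x Dx)).
- move=> i; have [dfi Cf] := df i; split.
    by move=> x Dx; apply: derivableN; exact: dfi.
  apply: (@class_C_eq _ _ _ (fun x => - pd i f x)) => //.
    by move=> x Dx; rewrite /pd deriveN//; exact: dfi.
  exact: IH.
Qed.

Lemma class_CM D k (f g : pt -> R^o) : open D ->
  class_C D k f -> class_C D k g -> class_C D k (fun x => f x * g x : R^o).
Proof.
move=> oD; elim: k f g => [|k IH] f g Cf Cg; split=> //.
- by move=> x Dx; exact: (continuousM (Cf.1 x Dx) (Cg.1 x Dx)).
- by move=> x Dx; exact: (continuousM (Cf.1 x Dx) (Cg.1 x Dx)).
- move=> i; have [dfi Cfi] := Cf.2 i; have [dgi Cgi] := Cg.2 i; split.
    by move=> x Dx; apply: derivableM; [exact: dfi|exact: dgi].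
  apply: (@class_C_eq _ _ _ (fun x => f x * pd i g x + g x * pd i f x)) => //.
    by move=> x Dx; rewrite /pd deriveM//; [exact: dfi|exact: dgi].
  by apply: class_CD => //; apply: IH => //; exact: class_CS.
Qed.

(** The derivative of [1/f] is a product containing [1/f] again, at one degree of regularity
    less. *)
Lemma class_CV D k (f : pt -> R^o) : open D -> (forall x, D x -> f x != 0) ->
  class_C D k f -> class_C D k (fun x => (f x)^-1 : R^o).
Proof.
move=> oD f0; elim: k => [|k IH] Cf; split=> //.
- by move=> x Dx; exact: (continuousV (f0 x Dx) (Cf.1 x Dx)).
- by move=> x Dx; exact: (continuousV (f0 x Dx) (Cf.1 x Dx)).
- move=> i; have [dfi Cfi] := Cf.2 i; split.
    by move=> x Dx; apply: derivableV; [exact: f0|exact: dfi].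
  apply: (@class_C_eq _ _ _ (fun x => - ((f x)^-1 * (f x)^-1 * pd i f x))) => //.
    move=> x Dx; rewrite /pd deriveV//; [|exact: f0|exact: dfi].
    by rewrite expr2 invfM scaleNr.
  apply: class_CN => //; apply: class_CM => //; apply: class_CM => //;
    by apply: IH; exact: class_CS.
Qed.

Definition coordf (i : 'I_2) (x : pt) : R^o := x 0 i.

Lemma coordf_continuous i : continuous (coordf i).
Proof. move=> x; apply: coord_continuous. Qed.

Lemma is_derive_coordf i (x v : pt) : is_derive x v (coordf i) (v 0 i).
Proof.
have d := @derivable_id _ pt x v.
apply: DeriveDef; first by have /derivable_mxP/(_ 0 i) := d.
by have /matrixP/(_ 0 i) := derive_mx d; rewrite derive_id mxE => ->.
Qed.

Lemma pd_coordf i j x : pd i (coordf j) x = (i == j)%:R.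
Proof. by rewrite /pd (@derive_val _ _ _ _ _ _ _ (is_derive_coordf _ _ _)) mxE eqxx/= eq_sym. Qed.

Lemma class_C_coordf D k i : class_C D k (coordf i).
Proof.
case: k => [|k]; split=> //; try by move=> x _; exact: coordf_continuous.
move=> j; split=> [x _|]; first by have [] := is_derive_coordf i x (delta_mx 0 j).
suff -> : pd j (coordf i) = cst ((j == i)%:R) by exact: class_C_cst.
by apply/funext => x; rewrite pd_coordf.
Qed.

Lemma smooth_on_cst (V : normedModType R) D (a : V) : smooth_on D (fun _ => a).
Proof. move=> k; exact: class_C_cst. Qed.

Lemma smooth_onD D (f g : pt -> R^o) : open D ->
  smooth_on D f -> smooth_on D g -> smooth_on D (fun x => f x + g x).
Proof. by move=> oD sf sg k; exact: class_CD. Qed.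

Lemma smooth_onN D (f : pt -> R^o) : open D ->
  smooth_on D f -> smooth_on D (fun x => - f x).
Proof. by move=> oD sf k; exact: class_CN. Qed.

Lemma smooth_onB D (f g : pt -> R^o) : open D ->
  smooth_on D f -> smooth_on D g -> smooth_on D (fun x => f x - g x).
Proof. by move=> oD sf sg; apply: smooth_onD => //; exact: smooth_onN. Qed.

Lemma smooth_onM D (f g : pt -> R^o) : open D ->
  smooth_on D f -> smooth_on D g -> smooth_on D (fun x => f x * g x : R^o).
Proof. by move=> oD sf sg k; exact: class_CM. Qed.

Lemma smooth_onV D (f : pt -> R^o) : open D -> (forall x, D x -> f x != 0) ->
  smooth_on D f -> smooth_on D (fun x => (f x)^-1 : R^o).
Proof. by move=> oD f0 sf k; exact: class_CV. Qed.

Lemma smooth_on_coordf D i : smooth_on D (coordf i).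
Proof. by move=> k; exact: class_C_coordf. Qed.

Lemma pd_cst (V : normedModType R) i (a : V) (x : pt) : pd i (fun _ => a) x = 0.
Proof. exact: derive_cst. Qed.

Lemma pdD D (f g : pt -> R^o) i x : D x -> smooth_on D f -> smooth_on D g ->
  pd i (fun x => f x + g x) x = pd i f x + pd i g x.
Proof.
move=> Dx sf sg; rewrite [LHS]deriveD//; exact: smooth_on_derivable.
Qed.

Lemma pdN D (f : pt -> R^o) i x : D x -> smooth_on D f ->
  pd i (fun x => - f x) x = - pd i f x.
Proof. move=> Dx sf; rewrite [LHS]deriveN//; exact: smooth_on_derivable. Qed.

Lemma pdB D (f g : pt -> R^o) i x : D x -> smooth_on D f -> smooth_on D g ->
  pd i (fun x => f x - g x) x = pd i f x - pd i g x.
Proof.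
move=> Dx sf sg; rewrite [LHS]deriveB//; exact: smooth_on_derivable.
Qed.

Lemma pdM D (f g : pt -> R^o) i x : D x -> smooth_on D f -> smooth_on D g ->
  pd i (fun x => f x * g x : R^o) x = pd i f x * g x + f x * pd i g x.
Proof.
move=> Dx sf sg.
have df : derivable f x (delta_mx 0 i) by exact: smooth_on_derivable sf Dx.
have dg : derivable g x (delta_mx 0 i) by exact: smooth_on_derivable sg Dx.
by rewrite [LHS](deriveM df dg) addrC; congr (_ + _); rewrite mulrC.
Qed.

End class_C_basics.

(** * Mean value theorems along coordinate directions *)

Section mean_value.
Context {R : realType}.
Local Notation pt := 'rV[R]_2.
Implicit Types (D U : set pt) (x y z : pt).

(** Each coordinate has its own parameter [s]: this is the rectangle spanned by [x] and [y], not the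
    segment, because [mean_value] moves along one axis at a time. *)
Definition in_box x y z := forall j : 'I_2,
  exists2 s : R, 0 <= s <= 1 & z 0 j = x 0 j + s * (y 0 j - x 0 j).

Lemma in_box_refl x y : in_box x y x.
Proof. by move=> j; exists 0; rewrite ?lexx ?ler01// mul0r addr0. Qed.

Lemma ball_rVE n (x y : 'rV[R]_n) e : 0 < e ->
  ball x e y <-> forall j, `|x 0 j - y 0 j| < e.
Proof.
move=> e0; split=> [[_ H] j|H]; first exact: H.
by split=> // i j; rewrite ord1; exact: H.
Qed.

Lemma ball_in_box a e x y z :
  ball a e x -> ball a e y -> in_box x y z -> ball a e z.
Proof.
move=> ax ay b; have [e0 _] := ax; apply/ball_rVE => // j.
have := (ball_rVE _ _ e0).1 ax j; have := (ball_rVE _ _ e0).1 ay j.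
have [s /andP[s0 s1] ->] := b j; rewrite !ltr_norml => /andP[h1 h2] /andP[h3 h4].
have P (u v : R) : 0 < u -> 0 < v -> 0 < (1 - s) * u + s * v.
  move=> u0 v0; have [->|s_neq0] := eqVneq s 0; first lra.
  have : 0 < s by rewrite lt_def s_neq0.
  by move=> sp; rewrite ltr_wpDl ?mulr_ge0 ?mulr_gt0 ?subr_ge0// ltW.
have := P (e - (a 0 j - x 0 j)) (e - (a 0 j - y 0 j)).
have := P (e + (a 0 j - x 0 j)) (e + (a 0 j - y 0 j)).
by move=> H1 H2; apply/andP; split; lra.
Qed.

Lemma in_box_norm x y z j : in_box x y z -> `|z 0 j - x 0 j| <= `|y 0 j - x 0 j|.
Proof.
move=> /(_ j)[s /andP[s0 s1] ->]; rewrite addrC addKr normrM ger0_norm//.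
by rewrite ler_piMl.
Qed.

Lemma in_box_cvg T (F : set_system T) {FF : Filter F} (g xi : T -> pt) y :
  g t @[t --> F] --> y -> (forall t, in_box y (g t) (xi t)) ->
  xi t @[t --> F] --> y.
Proof.
move=> /cvg_ballP gy b; apply/cvg_ballP => e e0.
apply: filterS (gy e e0) => t yg.
exact: ball_in_box (ballxx _ e0) yg (b t).
Qed.

Lemma is_derive_line (V : normedModType R) (f : pt -> V) x v (t : R) :
  derivable f (t *: v + x) v ->
  is_derive t 1 (fun s : R => f (s *: v + x)) ('D_v f (t *: v + x)).
Proof.
move=> df.
have E : (fun h : R => h^-1 *: (f ((h *: 1 + t) *: v + x) - f (t *: v + x)))
  = (fun h => h^-1 *: (f (h *: v + (t *: v + x)) - f (t *: v + x))).
  by apply/funext => h; rewrite [h *: 1]mulr1 scalerDl addrA.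
by apply: DeriveDef; rewrite /derivable /derive E.
Qed.

(** The increment [h] may have either sign. The strict bounds on [s] serve the second derivative
    test, where [s * h] must not vanish. *)
Lemma mean_value_line_strict (f : pt -> R^o) x i (h : R) :
  (forall s : R, 0 <= s <= 1 -> derivable f ((s * h) *: delta_mx 0 i + x) (delta_mx 0 i)) ->
  exists2 s : R, 0 < s < 1 &
    f (h *: delta_mx 0 i + x) - f x = pd i f ((s * h) *: delta_mx 0 i + x) * h.
Proof.
move=> df; have [->|h0] := eqVneq h 0.
  exists 2^-1; last by rewrite mulr0 scale0r add0r subrr.
  by rewrite invr_gt0 ltr0n/= invf_lt1// ltr1n.
set g : R -> R^o := fun s : R => f (s *: delta_mx 0 i + x).
have dg c : 0 <= c / h <= 1 -> is_derive c 1 g (pd i f (c *: delta_mx 0 i + x)).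
  by move=> /df; rewrite (divfK h0) => dfc; exact: (@is_derive_line _ f x (delta_mx 0 i) c dfc).
have g0 : g 0 = f x by rewrite /g scale0r add0r.
have K a b : a < b -> (forall c, c \in `[a, b] -> 0 <= c / h <= 1) ->
    exists2 c, c \in `]a, b[ & g b - g a = pd i f (c *: delta_mx 0 i + x) * (b - a).
  move=> ab H.
  apply: (@MVT R g (fun c => pd i f (c *: delta_mx 0 i + x)) a b) => //.
    by move=> c /subset_itv_oo_cc cab; apply/dg/H.
  apply: derivable_within_continuous => c cab.
  by have [] := dg c (H c cab).
have [hp|hn] := ltP 0 h.
  have [//|c|c c0h] := K 0 h.
    rewrite in_itv/= => /andP[c0 ch].
    by rewrite ler_pdivrMr// mul1r ch divr_ge0// ltW.
  rewrite g0 subr0 /g => ->; exists (c / h); last by rewrite divfK.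
  move: c0h; rewrite in_itv/= => /andP[c0 ch].
  by rewrite ltr_pdivrMr// mul1r ch divr_gt0.
have {}hn : h < 0 by rewrite lt_neqAle h0.
have HH c : c \in `[h, 0] -> 0 <= c / h <= 1.
  rewrite in_itv/= => /andP[hc c0].
  by rewrite ler_ndivrMr// mul1r hc andbT -mulrNN mulr_ge0 ?oppr_ge0 ?invr_le0 ?(ltW hn).
have [c c0h] := K h 0 hn HH.
rewrite g0 sub0r mulrN => /eqP; rewrite -eqr_oppLR opprB => /eqP E.
exists (c / h).
  move: c0h; rewrite in_itv/= => /andP[hc c0].
  by rewrite ltr_ndivrMr// mul1r hc andbT -mulrNN mulr_gt0 ?oppr_gt0 ?invr_lt0.
by rewrite divfK// -E.
Qed.

Lemma mean_value_line (f : pt -> R^o) x i (h : R) :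
  (forall s : R, 0 <= s <= 1 -> derivable f ((s * h) *: delta_mx 0 i + x) (delta_mx 0 i)) ->
  exists2 s : R, 0 <= s <= 1 &
    f (h *: delta_mx 0 i + x) - f x = pd i f ((s * h) *: delta_mx 0 i + x) * h.
Proof.
move=> df; have [s /andP[s0 s1] E] := mean_value_line_strict df.
by exists s; rewrite ?(ltW s0) ?(ltW s1).
Qed.

Lemma ord2P (j : 'I_2) : j = 0 \/ j = 1.
Proof. by case: j => -[|[|//]] p; [left|right]; apply: val_inj. Qed.

Lemma rV2E (x y : pt) : x 0 0 = y 0 0 -> x 0 1 = y 0 1 -> x = y.
Proof. by move=> h0 h1; apply/rowP => j; case: (ord2P j) => ->. Qed.

(** The path goes from [x] to the corner [w] along axis 0 and from there to [y] along axis 1, so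
    each partial derivative is taken at its own point [xi j]. *)
Lemma mean_value (f : pt -> R^o) x y :
  (forall z i, in_box x y z -> derivable f z (delta_mx 0 i)) ->
  exists2 xi : 'I_2 -> pt, forall j, in_box x y (xi j) &
    f y - f x = \sum_j pd j f (xi j) * (y 0 j - x 0 j).
Proof.
move=> df.
set a := y 0 0 - x 0 0; set b := y 0 1 - x 0 1.
set w : pt := a *: delta_mx 0 0 + x.
have B1 s : 0 <= s <= 1 -> in_box x y ((s * a) *: delta_mx 0 0 + x).
  move=> s01 j; have [->|->] := ord2P j.
  - by exists s => //; rewrite !mxE /= mulr1 addrC.
  - by exists 0; rewrite ?lexx ?ler01// !mxE /= mulr0 mul0r add0r addr0.
have B2 s : 0 <= s <= 1 -> in_box x y ((s * b) *: delta_mx 0 1 + w).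
  move=> s01 j; have [->|->] := ord2P j.
  - by exists 1; rewrite ?lexx ?ler01// !mxE /= mulr0 mulr1 mul1r add0r addrC.
  - by exists s => //; rewrite !mxE /= mulr1 mulr0 add0r addrC.
have [s s01 E1] := @mean_value_line f x 0 a (fun s s01 => df _ _ (B1 s s01)).
have [t t01 E2] := @mean_value_line f w 1 b (fun s s01 => df _ _ (B2 s s01)).
exists (fun j => if j == 0 then (s * a) *: delta_mx 0 0 + x else (t * b) *: delta_mx 0 1 + w).
  by move=> j; case: ifP => _; [exact: B1|exact: B2].
rewrite big_ord_recl big_ord1 /=.
have -> : lift ord0 ord0 = 1 :> 'I_2 by apply: val_inj.
rewrite -/a -/b -E1 -E2 -/w.
have -> : b *: delta_mx 0 1 + w = y.
  by apply: rV2E; rewrite !mxE/= ?mulr0 ?mulr1 ?add0r /a /b ?subrK.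
by rewrite [RHS]addrC subrKA.
Qed.

End mean_value.

(** * Chain rule, square roots and symmetry of second derivatives *)

Section chain_rule.
Context {R : realType}.
Local Notation pt := 'rV[R]_2.
Implicit Types (D U E : set pt) (x y z : pt).

Lemma cvg_rV n T (F : set_system T) {FF : Filter F} (g : T -> 'rV[R]_n) (y : 'rV[R]_n) :
  (forall j, (g t 0 j : R^o) @[t --> F] --> (y 0 j : R^o)) -> g t @[t --> F] --> y.
Proof.
move=> gy; apply/cvg_ballP => e e0.
have H : \forall t \near F, forall j, ball (y 0 j : R^o) e (g t 0 j : R^o).
  by apply: filter_forall => j; move/cvg_ballP : (gy j); exact.
by apply: filterS H => t H; apply/ball_rVE.
Qed.

Lemma sum_ord2 (V : nmodType) (F : 'I_2 -> V) : \sum_j F j = F 0 + F 1.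
Proof. by rewrite big_ord_recl big_ord1; congr (_ + F _); apply: val_inj. Qed.

(** Makes the intermediate points functions of a parameter [t], ready for a passage to the limit.
    Where [B] fails they take the default value [x], which keeps [in_box] true for all [t], as
    [in_box_cvg] requires. *)
Lemma in_box_choice T (B : T -> Prop) (f : pt -> R^o) (g : T -> pt) x :
  (forall t, B t -> forall z i, in_box x (g t) z -> derivable f z (delta_mx 0 i)) ->
  exists2 xi : 'I_2 -> T -> pt, forall j t, in_box x (g t) (xi j t) &
    forall t, B t -> f (g t) - f x = \sum_j pd j f (xi j t) * (g t 0 j - x 0 j).
Proof.
move=> df.
have H t : exists xi : 'I_2 -> pt, (forall j, in_box x (g t) (xi j)) /\
    (B t -> f (g t) - f x = \sum_j pd j f (xi j) * (g t 0 j - x 0 j)).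
  have [/df dft|nB] := pselect (B t).
    by have [xi b E] := mean_value dft; exists xi.
  by exists (fun _ => x); split=> // j; exact: in_box_refl.
have [xi Hxi] := choice H.
by exists (fun j t => xi t j) => [j t|t Bt]; have [] := Hxi t; auto.
Qed.

Lemma derivable_line_cvg (V W : normedModType R) (g : V -> W) (x v : V) :
  derivable g x v -> g (h *: v + x) @[h --> (0 : R)] --> g x.
Proof.
move=> /derivable1P/derivable1_diffP/differentiable_continuous.
by rewrite /prop_for /continuous_at scale0r add0r.
Qed.

(** Continuity of the partial derivatives of [f] does the work of total differentiability: the
    difference quotient is the sum of the [pd j f (xi j h)] times the difference quotients of the
    coordinates of [g]. *)
Lemma is_derive_comp2 (V : normedModType R) E (f : pt -> R^o) (g : V -> pt) (x v : V) :
  open E -> E (g x) -> class_C E 1 f -> derivable g x v ->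
  is_derive x v (fun t => f (g t)) (\sum_j pd j f (g x) * ('D_v g x) 0 j).
Proof.
move=> oE Egx Cf dg.
have /nbhs_ballP[e /= e0 eE] := open_nbhs_nbhs (conj oE Egx).
set ga := fun h : R => g (h *: v + x).
have ga_cvg : ga h @[h --> 0^'] --> g x.
  exact: cvg_within_filter (derivable_line_cvg dg).
have [|xi bxi Exi] := @in_box_choice R (fun h => ball (g x) e (ga h)) f ga (g x).
  move=> h Bh z i b; apply: (Cf.2 i).1; apply: eE.
  exact: ball_in_box (ballxx _ e0) Bh b.
have xi_cvg j : pd j f (xi j h) @[h --> 0^'] --> (pd j f (g x) : R^o).
  have c1 : xi j h @[h --> 0^'] --> g x by apply: in_box_cvg ga_cvg (bxi j).
  have c2 : {for g x, continuous (pd j f)} by apply: (Cf.2 j).2.1.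
  exact: (cvg_comp _ _ c1 c2).
have Q_cvg j : (h^-1 * (ga h 0 j - g x 0 j) : R^o) @[h --> 0^'] --> ('D_v g x 0 j : R^o).
  have := (derivable_mxP _ _ _).1 dg 0 j.
  rewrite derive_mx// mxE => /cvgP.
  by apply: cvg_trans.
have C : (h^-1 *: (f (ga h) - f (g x)) : R^o) @[h --> 0^'] -->
    (\sum_j pd j f (g x) * ('D_v g x) 0 j : R^o).
  have : (\sum_j pd j f (xi j h) * (h^-1 * (ga h 0 j - g x 0 j)) : R^o) @[h --> 0^'] -->
    (\sum_j pd j f (g x) * ('D_v g x) 0 j : R^o).
    rewrite sum_ord2; under eq_fun do rewrite sum_ord2.
    by apply: cvgD; apply: cvgM.
  apply: cvg_trans; apply: near_eq_cvg.
  have : \forall h \near 0^', ball (g x) e (ga h) by move/cvg_ballP: ga_cvg; exact.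
  apply: filterS => h Bh; rewrite Exi// scaler_sumr; apply: eq_bigr => j _.
  by rewrite /GRing.scale/=; ring.
by apply: DeriveDef; [apply: cvgP C|apply: cvg_lim C].
Qed.

Lemma class_C_leq (V : normedModType R) D k l (f : pt -> V) :
  (k <= l)%N -> class_C D l f -> class_C D k f.
Proof.
move=> /subnK <-; elim: (l - k)%N => [//|m IH].
by rewrite addSn => /class_CS /IH.
Qed.

Lemma continuous_rV n (g : pt -> 'rV[R]_n) x :
  (forall j, {for x, continuous (fun x => g x 0 j : R^o)}) -> {for x, continuous g}.
Proof. by move=> H; apply: (@cvg_rV _ _ (nbhs x) _ g (g x)) => j; exact: H. Qed.

Lemma class_C_rV n D k (g : pt -> 'rV[R]_n.+1) : open D ->
  class_C D k g <-> forall j, class_C D k (fun x => g x 0 j : R^o).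
Proof.
move=> oD; elim: k g => [|k IH] g.
  split=> [[cg _] j|H].
    split=> // x Dx; have := cvg_comp _ _ (cg x Dx) (@coord_continuous R 1 n.+1 0 j (g x)).
    exact.
  by split=> // x Dx; apply: continuous_rV => j; apply: (H j).1.
split=> [[cg dg] j|H].
  split=> [x Dx|i].
    have := cvg_comp _ _ (cg x Dx) (@coord_continuous R 1 n.+1 0 j (g x)).
    exact.
  have [dgi /IH/(_ j) Cgi] := dg i; split.
    by move=> x Dx; have /derivable_mxP/(_ 0 j) := dgi x Dx.
  apply: class_C_eq oD _ Cgi => x Dx.
  by rewrite /pd (derive_mx (dgi x Dx)) mxE.
split=> [x Dx|i]; first by apply: continuous_rV => j; apply: (H j).1.
have dg x : D x -> derivable g x (delta_mx 0 i).
  by move=> Dx; apply/derivable_mxP => a j; rewrite ord1; exact: ((H j).2 i).1.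
split=> //; apply/IH => j.
apply: class_C_eq oD _ ((H j).2 i).2 => x Dx.
by rewrite /pd (derive_mx (dg x Dx)) mxE.
Qed.

Lemma smooth_on_rV n D (g : pt -> 'rV[R]_n.+1) : open D ->
  smooth_on D g <-> forall j, smooth_on D (fun x => g x 0 j : R^o).
Proof.
move=> oD; split=> [H j k|H k]; first exact: (class_C_rV _ _ oD).1 (H k) j.
by apply/class_C_rV => // j; exact: H.
Qed.

Lemma pd_rV n D (g : pt -> 'rV[R]_n.+1) i x j : D x -> smooth_on D g ->
  (pd i g x) 0 j = pd i (fun x => g x 0 j : R^o) x.
Proof.
move=> Dx sg; rewrite /pd (derive_mx (smooth_on_derivable sg Dx)) mxE.
by [].
Qed.

Lemma class_C_comp D E k (f : pt -> R^o) (g : pt -> pt) : open D -> open E ->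
  (forall x, D x -> E (g x)) -> class_C E k f -> class_C D k g ->
  class_C D k (fun x => f (g x)).
Proof.
move=> oD oE DE; elim: k f => [|k IH] f Cf Cg.
  by split=> // x Dx; exact: (cvg_comp _ _ (Cg.1 x Dx) (Cf.1 _ (DE x Dx))).
split=> [x Dx|i].
  exact: (cvg_comp _ _ (Cg.1 x Dx) (Cf.1 _ (DE x Dx))).
have dfg x : D x -> is_derive x (delta_mx 0 i) (fun t => f (g t))
    (\sum_j pd j f (g x) * (pd i g x) 0 j).
  move=> Dx; apply: (is_derive_comp2 oE (DE x Dx)); last exact: (Cg.2 i).1.
  exact: class_C_leq Cf.
split=> [x Dx|]; first by have [] := dfg x Dx.
have Cg' := (class_C_rV _ _ oD).1 (Cg.2 i).2.
apply: (@class_C_eq _ _ _ _ (fun x => pd 0 f (g x) * (pd i g x) 0 0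
                           + pd 1 f (g x) * (pd i g x) 0 1)) => //.
  by move=> x Dx; have [_ E1] := dfg x Dx; rewrite /pd E1 sum_ord2.
have H j := IH _ (Cf.2 j).2 (class_CS Cg).
by apply: class_CD => //; apply: class_CM.
Qed.

Lemma smooth_on_comp D E (f : pt -> R^o) (g : pt -> pt) : open D -> open E ->
  (forall x, D x -> E (g x)) -> smooth_on E f -> smooth_on D g ->
  smooth_on D (fun x => f (g x)).
Proof. by move=> oD oE DE sf sg k; exact: class_C_comp oD oE DE (sf k) (sg k). Qed.

Lemma pd_comp D E (f : pt -> R^o) (g : pt -> pt) i x : open D -> open E ->
  D x -> E (g x) -> smooth_on E f -> smooth_on D g ->
  pd i (fun x => f (g x)) x = \sum_j pd j f (g x) * (pd i g x) 0 j.
Proof.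
move=> oD oE Dx Egx sf sg.
have dg : derivable g x (delta_mx 0 i) by exact: smooth_on_derivable sg Dx.
by have [_ E1] := is_derive_comp2 oE Egx (sf 1%N) dg.
Qed.

(** The difference quotient of the root is that of [f] divided by the sum of the two roots, which
    stays away from 0. *)
Lemma is_derive_sqrt_comp (f : pt -> R^o) x v : 0 < f x -> derivable f x v ->
  is_derive x v (fun y => Num.sqrt (f y) : R^o) ((2 * Num.sqrt (f x))^-1 * 'D_v f x).
Proof.
move=> f0 df.
set s := fun y => Num.sqrt (f y) : R^o.
have s0 : 0 < s x by rewrite sqrtr_gt0.
have fc : f (h *: v + x) @[h --> 0^'] --> f x.
  exact: cvg_within_filter (derivable_line_cvg df).
have sc : s (h *: v + x) @[h --> 0^'] --> s x.
  exact: (cvg_comp _ _ fc (@sqrt_continuous R (f x))).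
have C : (h^-1 *: (s (h *: v + x) - s x) : R^o) @[h --> 0^'] -->
    ((2 * s x)^-1 * 'D_v f x : R^o).
  have : ((s (h *: v + x) + s x)^-1 * (h^-1 *: (f (h *: v + x) - f x)) : R^o)
      @[h --> 0^'] --> ((2 * s x)^-1 * 'D_v f x : R^o).
    apply: cvgM; last exact: df.
    apply: cvgV; first by rewrite gt_eqF// mulr_gt0.
    rewrite mulr_natl mulr2n; apply: cvgD; [exact: sc|exact: cvg_cst].
  apply: cvg_trans; apply: near_eq_cvg.
  have : \forall h \near 0^', 0 < f (h *: v + x) by apply: (cvgr_gt _ fc).
  apply: filterS => h fh.
  have sh : 0 < s (h *: v + x) by rewrite sqrtr_gt0.
  rewrite -(sqr_sqrtr (ltW fh)) -(sqr_sqrtr (ltW f0)) -/(s _) -/(s x) subr_sqr.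
  have scE (a : R) (b : R^o) : a *: b = a * b by [].
  by rewrite !scE mulrC -!mulrA mulfV ?gt_eqF ?addr_gt0// mulr1.
by apply: DeriveDef; [apply: cvgP C|apply: cvg_lim C].
Qed.

Lemma class_C_sqrt D k (f : pt -> R^o) : open D -> (forall x, D x -> 0 < f x) ->
  class_C D k f -> class_C D k (fun x => Num.sqrt (f x) : R^o).
Proof.
move=> oD f0; elim: k => [|k IH] Cf.
  split=> // x Dx; exact: (cvg_comp _ _ (Cf.1 x Dx) (@sqrt_continuous R (f x))).
split=> [x Dx|i].
  exact: (cvg_comp _ _ (Cf.1 x Dx) (@sqrt_continuous R (f x))).
have H x (Dx : D x) := is_derive_sqrt_comp (f0 x Dx) ((Cf.2 i).1 x Dx).
split=> [x Dx|]; first by have [] := H x Dx.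
apply: (@class_C_eq _ _ _ _ (fun x => (2 * Num.sqrt (f x))^-1 * pd i f x)) => //.
  by move=> x Dx; rewrite [RHS](@derive_val _ _ _ _ _ _ _ (H x Dx)).
apply: class_CM => //; last exact: (Cf.2 i).2.
apply: class_CV => // [x Dx|].
  by rewrite gt_eqF// mulr_gt0// sqrtr_gt0 f0.
by apply: class_CM => //; [exact: class_C_cst|exact/IH/class_CS].
Qed.

Lemma derivable_shift (V W : normedModType R) (f : V -> W) (a x v : V) :
  derivable f (a + x) v -> derivable (fun y : V => f (a + y)) x v.
Proof.
have E : (fun h : R => h^-1 *: (f (a + (h *: v + x)) - f (a + x)))
  = (fun h => h^-1 *: (f (h *: v + (a + x)) - f (a + x))).
  by apply/funext => h; rewrite addrCA.
by rewrite /derivable E.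
Qed.

Lemma derive_shift (V W : normedModType R) (f : V -> W) (a x v : V) :
  'D_v (fun y : V => f (a + y)) x = 'D_v f (a + x).
Proof.
have E : (fun h : R => h^-1 *: (f (a + (h *: v + x)) - f (a + x)))
  = (fun h => h^-1 *: (f (h *: v + (a + x)) - f (a + x))).
  by apply/funext => h; rewrite addrCA.
by rewrite /derive E.
Qed.

(** The second difference of [f] over a square of side [h] is symmetric in the two directions, and
    it equals [h^2] times either mixed derivative at a point that tends to [x] with [h]. *)
Lemma pd_sym D (f : pt -> R^o) i j x : open D -> D x -> smooth_on D f ->
  pd i (pd j f) x = pd j (pd i f) x.
Proof.
move=> oD Dx sf.
have /nbhs_ballP[e /= e0 eD] := open_nbhs_nbhs (conj oD Dx).
have K a b : a != b -> exists2 xi : R -> pt, xi h @[h --> 0^'] --> x &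
  \forall h \near 0^', f (h *: delta_mx 0 a + (h *: delta_mx 0 b + x))
     - f (h *: delta_mx 0 a + x) - f (h *: delta_mx 0 b + x) + f x
     = pd b (pd a f) (xi h) * h * h.
  move=> ab.
  set g := fun h : R => h *: delta_mx 0 a + (h *: delta_mx 0 b + x) : pt.
  have gx : g h @[h --> 0^'] --> x.
    have -> : x = 0 *: delta_mx 0 a + (0 *: delta_mx 0 b + x).
      by rewrite !scale0r !add0r.
    apply: cvg_within_filter.
    by apply: cvgD; [|apply: cvgD; [|exact: cvg_cst]]; apply: cvgZr_tmp; exact: cvg_id.
  have H h : exists xi, in_box x (g h) xi /\ (ball x e (g h) ->
     f (g h) - f (h *: delta_mx 0 a + x) - f (h *: delta_mx 0 b + x) + f x
     = pd b (pd a f) xi * h * h).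
    have [Bh|nB] := pselect (ball x e (g h)); last by exists x; split=> //; exact: in_box_refl.
    have B s t : 0 <= s <= 1 -> 0 <= t <= 1 ->
        in_box x (g h) ((s * h) *: delta_mx 0 a + ((t * h) *: delta_mx 0 b + x)).
      move=> s01 t01 k.
      have [->|->] : k = a \/ k = b by case: (ord2P a) (ord2P b) (ord2P k) ab => -> [] -> [] -> //; auto.
      - exists s => //; rewrite !mxE !eqxx (negbTE ab)/=; ring.
      - exists t => //; rewrite !mxE !eqxx eq_sym (negbTE ab)/=; ring.
    have BD s t : 0 <= s <= 1 -> 0 <= t <= 1 ->
        D ((s * h) *: delta_mx 0 a + ((t * h) *: delta_mx 0 b + x)).
      by move=> s01 t01; apply: eD; apply: ball_in_box (ballxx _ e0) Bh (B _ _ s01 t01).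
    have o1 : 0 <= (1 : R) <= 1 by rewrite ler01 lexx.
    have z1 : 0 <= (0 : R) <= 1 by rewrite ler01 lexx.
    set w := h *: delta_mx 0 b : pt.
    pose F : pt -> R^o := fun z => f (w + z) - f z.
    have dF s : 0 <= s <= 1 -> derivable F ((s * h) *: delta_mx 0 a + x) (delta_mx 0 a).
      move=> s01; apply: derivableB.
        apply: derivable_shift; apply: smooth_on_derivable sf _.
        by have := BD s 1 s01 o1; rewrite mul1r addrCA.
      apply: smooth_on_derivable sf _.
      by have := BD s 0 s01 z1; rewrite mul0r scale0r add0r.
    have [s s01 E1] := mean_value_line dF.
    have [t t01 E2] := @mean_value_line _ (pd a f) ((s * h) *: delta_mx 0 a + x) b h
      (fun t t01 => smooth_on_derivable (smooth_on_pd a sf)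
         (eq_ind _ D (BD s t s01 t01) _ (addrCA _ _ _))).
    exists ((t * h) *: delta_mx 0 b + ((s * h) *: delta_mx 0 a + x)); split.
      by rewrite addrCA; exact: B.
    move=> _; rewrite -E2.
    have EF : pd a F ((s * h) *: delta_mx 0 a + x)
       = pd a f (w + ((s * h) *: delta_mx 0 a + x)) - pd a f ((s * h) *: delta_mx 0 a + x).
      rewrite /pd deriveB ?derive_shift//.
        apply: derivable_shift; apply: smooth_on_derivable sf _.
        by have := BD s 1 s01 o1; rewrite mul1r addrCA.
      apply: smooth_on_derivable sf _.
      by have := BD s 0 s01 z1; rewrite mul0r scale0r add0r.
    rewrite -EF -E1 /F /g (addrCA w) -/w; ring.
  have [xi Hxi] := choice H.
  exists xi; first by apply: in_box_cvg gx _ => h; have [] := Hxi h.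
  have : \forall h \near 0^', ball x e (g h) by move/cvg_ballP: gx; exact.
  by apply: filterS => h; have [_] := Hxi h.
have [->//|ij] := eqVneq i j.
have [xi cxi E1] := K _ _ ij.
have ji : j != i by rewrite eq_sym.
have [ze cze E2] := K _ _ ji.
have c1 : pd j (pd i f) (xi h) @[h --> 0^'] --> pd j (pd i f) x.
  exact: (cvg_comp _ _ cxi (smooth_on_continuous (smooth_on_pd j (smooth_on_pd i sf)) Dx)).
have c2 : pd i (pd j f) (ze h) @[h --> 0^'] --> pd i (pd j f) x.
  exact: (cvg_comp _ _ cze (smooth_on_continuous (smooth_on_pd i (smooth_on_pd j sf)) Dx)).
have c3 : pd i (pd j f) (ze h) @[h --> 0^'] --> pd j (pd i f) x.
  apply: cvg_trans c1; apply: near_eq_cvg.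
  have : \forall h \near (0 : R)^', h != 0 by exact: nbhs_dnbhs_neq.
  apply: filterS3 E1 E2 => h E1 E2 h0.
  have E3 : pd j (pd i f) (xi h) * h * h = pd i (pd j f) (ze h) * h * h.
    have G (a b c d e' p q : R^o) : a = b -> a - c - d + e' = p -> b - d - c + e' = q -> p = q.
      by move=> -> <- <-; rewrite (addrAC b).
    exact: G (congr1 f (addrCA _ _ _)) E1 E2.
  exact: (@mulIf R h h0 _ _ (@mulIf R h h0 _ _ E3)).
exact: (cvg_unique (@norm_hausdorff _ R^o) c2 c3).
Qed.

End chain_rule.

HB.instance Definition _ (R : realType) (m n : nat) := NormedModule.on 'M[R]_(m, n).

Lemma det_mx22 (K : comPzRingType) (A : 'M[K]_2) :
  \det A = A 0 0 * A 1 1 - A 0 1 * A 1 0.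
Proof.
rewrite (expand_det_row _ 0) big_ord_recl big_ord1 /cofactor !det_mx11 !mxE /=.
have -> : lift ord0 (0 : 'I_1) = 1 :> 'I_2 by apply: val_inj.
have -> : lift (1 : 'I_2) (0 : 'I_1) = 0 :> 'I_2 by apply: val_inj.
rewrite (_ : (0 + bump 0 0)%N = 1%N)// (_ : (0 + 0)%N = 0%N)// expr0 expr1; ring.
Qed.

(** * The inverse function theorem *)

Section inverse_function.
Context {R : realType}.
Local Notation pt := 'rV[R]_2.
Implicit Types (D U E : set pt) (x y z : pt).

Lemma coord_le_norm n (x : 'rV[R]_n) j : `|x 0 j| <= `|x|.
Proof. by rewrite [leRHS]/Num.Def.normr/= mx_normrE; exact: (le_bigmax _ _ (0, j)). Qed.

Lemma norm_le_coord n (x : 'rV[R]_n) a :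
  0 <= a -> (forall j, `|x 0 j| <= a) -> `|x| <= a.
Proof.
move=> a0 H; rewrite /Num.Def.normr/= mx_normrE (bigmax_le _ a0)//= => -[i j] _.
by rewrite ord1.
Qed.

Lemma half_contraction_fixed (T : pt -> pt) x0 a : 0 < a ->
  (forall x, `|x - x0| <= a -> `|T x - x0| <= a) ->
  (forall x y, `|x - x0| <= a -> `|y - x0| <= a -> `|T x - T y| <= 2^-1 * `|x - y|) ->
  exists2 x, `|x - x0| <= a & x = T x.
Proof.
move=> a0 TS TL.
pose U : set pt := [set x | `|x - x0| <= a].
have UT : {homo T : x / U x >-> U x} by exact: TS.
pose F : {fun U >-> U} := mkfun_fun UT.
have [|||p Up Ep] := @banach_fixed_point R pt U F.
- exists (2^-1)%:nng; split=> /=; first by rewrite invf_lt1// ltr1n.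
  by move=> [x y] [/= Ux Uy]; exact: TL.
- have -> : U = closed_ball x0 a.
    by rewrite closed_ballE//; apply/seteqP; split=> x; rewrite /closed_ball_/U/= distrC.
  exact: closed_ball_closed.
- by exists x0; rewrite /U/= subrr normr0 ltW.
by exists p.
Qed.

Lemma smooth_on_coord D (f : pt -> pt) j : open D -> smooth_on D f ->
  smooth_on D (fun x => f x 0 j : R^o).
Proof. by move=> oD /(smooth_on_rV _ oD). Qed.

Lemma partialsE D (f : pt -> pt) x i k : D x -> smooth_on D f ->
  partials f x i k = pd i (fun x => f x 0 k : R^o) x.
Proof. by move=> Dx sf; rewrite /partials mxE (pd_rV _ _ Dx sf). Qed.

Lemma openI_preimage (S T : topologicalType) (A : set S) (B : set T) (f : S -> T) :
  open A -> open B -> (forall x : S, A x -> {for x, continuous f}) ->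
  open (A `&` f @^-1` B).
Proof.
move=> oA oB cf; rewrite openE => x [Ax Bfx]; apply: filterI.
  exact: open_nbhs_nbhs.
by apply: (cf x Ax); exact: open_nbhs_nbhs.
Qed.

Section near_identity.
Variables (D : set pt) (psi : pt -> pt) (x0 : pt).
Hypotheses (oD : open D) (Dx0 : D x0) (spsi : smooth_on D psi).
Hypothesis det0 : \det (partials psi x0) != 0.

(** [Phi] is [psi] followed by the inverse of its Jacobian at [x0], so its derivative at [x0] is the
    identity; [r] is its deviation from the identity map, with vanishing derivative there. *)
Let L := invmx (partials psi x0).
Let Phi k : pt -> R^o := fun x => psi x 0 0 * L 0 k + psi x 0 1 * L 1 k.
Let r k : pt -> R^o := fun x => Phi k x - coordf k x.

Let sPhi k : smooth_on D (Phi k).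
Proof.
move=> m; apply: class_CD => //; apply: class_CM => //; try exact: class_C_cst;
exact: smooth_on_coord.
Qed.

Let sr k : smooth_on D (r k).
Proof.
by move=> m; apply: class_CD => //; [exact: sPhi|apply: class_CN => //; exact: class_C_coordf].
Qed.

Let pd_r i k x : D x ->
  pd i (r k) x = partials psi x i 0 * L 0 k + partials psi x i 1 * L 1 k - (i == k)%:R.
Proof.
move=> Dx; rewrite !(partialsE _ _ Dx spsi).
have sp j := @smooth_on_coord _ _ j oD spsi.
have sc (c : R^o) := @smooth_on_cst R R^o D c.
rewrite /r (pdB _ Dx (sPhi k) (@smooth_on_coordf _ _ k)) pd_coordf.
rewrite /Phi (pdD _ Dx (smooth_onM oD (sp 0) (sc _)) (smooth_onM oD (sp 1) (sc _))).
by rewrite !(pdM _ Dx (sp _) (sc _)) !pd_cst !mulr0 !addr0.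
Qed.

(** With the bound 1/4 the two partial derivatives add up to a Lipschitz constant 1/2 for [r], and
    the determinant of the derivative of [Phi] is at least (3/4)^2 - (1/4)^2 > 0. *)
Lemma local_inverse_radius : exists2 rho, 0 < rho & forall x, ball x0 rho x ->
  D x /\ forall i k, `|pd i (r k) x| <= 4^-1.
Proof.
have H : \forall x \near x0, D x /\ forall i k, `|pd i (r k) x| <= 4^-1.
  apply: filterI; first exact: open_nbhs_nbhs.
  suff H i k : \forall x \near x0, `|pd i (r k) x| <= 4^-1.
    apply: filterS (filterI (filterI (H 0 0) (H 0 1)) (filterI (H 1 0) (H 1 1))).
    by move=> x [[h00 h01] [h10 h11]] i k; case: (ord2P i) (ord2P k) => -> [] ->.
  have c : {for x0, continuous (pd i (r k))}.
    exact: smooth_on_continuous (smooth_on_pd i (sr k)) Dx0.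
  have E0 : pd i (r k) x0 = 0.
    have : (partials psi x0 *m L) i k = (i == k)%:R.
      by rewrite mulmxV ?mxE// unitmxE unitfE.
    by rewrite pd_r// mxE sum_ord2 => ->; rewrite subrr.
  have p4 : 0 < (4^-1 : R) by rewrite invr_gt0.
  move/cvgrPdist_le : c => /(_ _ p4); apply: filterS => x.
  by rewrite E0 sub0r normrN.
have /nbhs_ballP[rho /= rho0 Hr] := H.
by exists rho.
Qed.

Lemma local_inverse_lipschitz rho x y : 0 < rho ->
  (forall x, ball x0 rho x -> D x /\ forall i k, `|pd i (r k) x| <= 4^-1) ->
  ball x0 rho x -> ball x0 rho y -> forall k, `|r k x - r k y| <= 2^-1 * `|x - y|.
Proof.
move=> rho0 Hr Bx By k.
have [z i b|xi bxi ->] := @mean_value _ (r k) y x.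
  apply: smooth_on_derivable (sr k) _; apply: (Hr _ _).1.
  exact: ball_in_box By Bx b.
rewrite sum_ord2 (le_trans (ler_normD _ _))// !normrM.
have H j : `|pd j (r k) (xi j)| * `|x 0 j - y 0 j| <= 4^-1 * `|x - y|.
  apply: ler_pM => //.
    by apply: (Hr _ _).2; exact: ball_in_box By Bx (bxi j).
  by have := coord_le_norm (x - y) j; rewrite !mxE.
apply: le_trans (lerD (H 0) (H 1)) _; lra.
Qed.

Lemma local_inverse_det rho x : 
  (forall x, ball x0 rho x -> D x /\ forall i k, `|pd i (r k) x| <= 4^-1) ->
  ball x0 rho x -> \det (partials psi x) != 0.
Proof.
move=> Hr Bx; have [Dx H] := Hr x Bx.
have : \det (partials psi x *m L) != 0.
  rewrite det_mx22 !mxE !sum_ord2.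
  have := H 0 0; have := H 0 1; have := H 1 0; have := H 1 1; rewrite !pd_r//=.
  set a := _ + _ * L 1 1; set b := _ + _ * L 1 0.
  set c := _ + _ * L 1 1; set d := _ + _ * L 1 0.
  rewrite !ler_norml => /andP[a1 a2] /andP[b1 b2] /andP[c1 c2] /andP[d1 d2].
  rewrite gt_eqF//; nra.
by apply: contraNneq; rewrite det_mulmx => ->; rewrite mul0r.
Qed.

Let C : R := \sum_i \sum_k `|L i k|.

Let PhiB x y k : `|Phi k x - Phi k y| <= C * `|psi x - psi y|.
Proof.
have -> : Phi k x - Phi k y
    = \sum_i (psi x - psi y) 0 i * L i k by rewrite sum_ord2 /Phi !mxE; ring.
apply: le_trans (ler_norm_sum _ _ _) _; rewrite mulr_suml; apply: ler_sum => i _.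
rewrite normrM mulrC ler_pM ?coord_le_norm//.
by rewrite (bigD1 k)//= lerDl sumr_ge0.
Qed.

(** [x - y] is the increment of [Phi] minus that of [r], and the latter absorbs at most half of
    [|x - y|]. This yields both the injectivity of [psi] and the continuity of its inverse. *)
Lemma local_inverse_expand rho x y : 0 < rho ->
  (forall x, ball x0 rho x -> D x /\ forall i k, `|pd i (r k) x| <= 4^-1) ->
  ball x0 rho x -> ball x0 rho y -> `|x - y| <= 2 * C * `|psi x - psi y|.
Proof.
move=> rho0 Hr Bx By.
have C0 : 0 <= C by do 2!(apply: sumr_ge0 => ? _).
have : `|x - y| <= C * `|psi x - psi y| + 2^-1 * `|x - y|.
  apply: norm_le_coord => [|k].
    by rewrite addr_ge0 ?mulr_ge0// invr_ge0.
  have -> : (x - y) 0 k = (Phi k x - Phi k y) - (r k x - r k y).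
    by rewrite /r /coordf !mxE; ring.
  apply: le_trans (ler_normB _ _) _; apply: lerD; first exact: PhiB.
  exact: local_inverse_lipschitz rho0 Hr Bx By k.
lra.
Qed.

(** The equation [psi x = eta] is the fixed point equation [x = phi eta - r x]. On the closed ball
    of radius [rho / 2] the contraction contributes [rho / 4] and the displacement of [eta] at most
    another [rho / 4]. *)
Lemma local_inverse_surj rho eta : 0 < rho ->
  (forall x, ball x0 rho x -> D x /\ forall i k, `|pd i (r k) x| <= 4^-1) ->
  C * `|eta - psi x0| <= rho / 4 -> exists2 x, ball x0 rho x & psi x = eta.
Proof.
move=> rho0 Hr He.
pose phi (y : pt) k := y 0 0 * L 0 k + y 0 1 * L 1 k.
pose T (x : pt) : pt := \row_k (phi eta k - r k x).
have small x : `|x - x0| <= rho / 2 -> ball x0 rho x.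
  move=> H; apply/ball_rVE => // j; apply: (@le_lt_trans _ _ (rho / 2)); last lra.
  by apply: le_trans H; rewrite (distrC (x0 0 j)); have := coord_le_norm (x - x0) j; rewrite !mxE.
have [||x y Hx Hy|x Hx Ex] := @half_contraction_fixed T x0 (rho / 2).
- by rewrite divr_gt0.
- move=> x Hx; apply: norm_le_coord => [|k]; first by rewrite divr_ge0// ltW.
  have -> : (T x - x0) 0 k = (\sum_i (eta - psi x0) 0 i * L i k) - (r k x - r k x0).
    by rewrite sum_ord2 /T /r /Phi /phi /coordf !mxE; ring.
  apply: le_trans (ler_normB _ _) _.
  have H1 : `|\sum_i (eta - psi x0) 0 i * L i k| <= rho / 4.
    apply: le_trans He; apply: le_trans (ler_norm_sum _ _ _) _.
    rewrite mulr_suml; apply: ler_sum => i _.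
    rewrite normrM mulrC ler_pM ?coord_le_norm//.
    by rewrite (bigD1 k)//= lerDl sumr_ge0.
  have H2 := local_inverse_lipschitz rho0 Hr (small _ Hx) (ballxx _ rho0) k.
  apply: le_trans (lerD H1 H2) _; lra.
- apply: norm_le_coord => [|k]; first by rewrite mulr_ge0// invr_ge0.
  have -> : (T x - T y) 0 k = - (r k x - r k y) by rewrite !mxE; ring.
  by rewrite normrN; exact: local_inverse_lipschitz rho0 Hr (small _ Hx) (small _ Hy) k.
exists x; first exact: small.
have LP : L *m partials psi x0 = 1%:M by rewrite mulVmx// unitmxE unitfE.
rewrite -[psi x]mulmx1 -[eta]mulmx1 -LP !mulmxA; congr (_ *m _).
apply/rowP => k; have /rowP/(_ k) := Ex; rewrite !mxE !sum_ord2 /r /Phi /phi /coordf.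
by move=> h; lra.
Qed.
End near_identity.

Lemma ball_rV_norm n (x y : 'rV[R]_n) e : ball x e y = (`|x - y| < e).
Proof. by rewrite -ball_normE. Qed.

Lemma cvg_lin2 T (F : set_system T) {FF : Filter F} (f g d : T -> R^o) (a b l m k : R^o) :
  k != 0 -> f t @[t --> F] --> l -> g t @[t --> F] --> m -> d t @[t --> F] --> k ->
  ((a * f t - b * g t) * (d t)^-1 : R^o) @[t --> F] --> ((a * l - b * m) * k^-1 : R^o).
Proof.
move=> k0 fl gm dk; apply: cvgM; last exact: cvgV k0 dk.
by apply: cvgB; apply: cvgM => //; apply: cvg_cst.
Qed.

Lemma continuous_atP (V W : normedModType R) (f : V -> W) (y : V) :
  (forall e : R, 0 < e -> \forall z \near y, `|f y - f z| < e) -> {for y, continuous f}.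
Proof. by move=> H; apply/cvgrPdist_lt. Qed.

(** Cramer's rule, applied to the two mean value equations for [psi] between values of [phi], gives
    the partial derivatives of [phi] as [N i j (phi y)], where [N] is the inverse Jacobian. As [phi]
    enters only by composition, class C^m of [phi] implies class C^(m+1). *)
Lemma smooth_on_local_inverse D V (psi phi : pt -> pt) : open D -> open V ->
  smooth_on D psi -> (forall y, V y -> {for y, continuous phi}) ->
  (forall y, V y -> [/\ D (phi y), \det (partials psi (phi y)) != 0 & psi (phi y) = y]) ->
  smooth_on V phi.
Proof.
move=> oD oV spsi cphi Hphi.
pose p (j k : 'I_2) : pt -> R^o := pd j (fun x => psi x 0 k : R^o).
have sp j k : smooth_on D (p j k) by apply: smooth_on_pd; exact: smooth_on_coord.
pose dt : pt -> R^o := fun x => p 0 0 x * p 1 1 x - p 0 1 x * p 1 0 x.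
have dtE x : D x -> \det (partials psi x) = dt x.
  by move=> Dx; rewrite det_mx22 !(partialsE _ _ Dx spsi).
pose de (i k : 'I_2) : R^o := (i == k)%:R.
pose N (i j : 'I_2) : pt -> R^o := fun x =>
  (if j == 0 then de i 0 * p 1 1 x - de i 1 * p 1 0 x
   else de i 1 * p 0 0 x - de i 0 * p 0 1 x) * (dt x)^-1.
pose D' := D `&` dt @^-1` [set t | t != 0].
have sdt : smooth_on D dt by apply: smooth_onB => //; apply: smooth_onM.
have oD' : open D'.
  apply: (openI_preimage oD); first exact: open_neq.
  by move=> x Dx; exact: smooth_on_continuous sdt Dx.
have sN i j : smooth_on D' (N i j).
  have s' a b : smooth_on D' (p a b) by apply: smooth_on_sub (sp a b) => x [].
  have sc (c : R^o) := @smooth_on_cst R R^o D' c.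
  have si : smooth_on D' (fun x => (dt x)^-1 : R^o).
    by apply: smooth_onV => // [x [_ //]|]; apply: smooth_on_sub sdt => x [].
  rewrite /N; case: (ord2P j) => -> /=; apply: smooth_onM => //;
    by apply: smooth_onB => //; apply: smooth_onM.
have VD' y : V y -> D' (phi y).
  by move=> /Hphi[Dy dy _]; split=> //; rewrite /= -dtE.
have dphi y i j : V y ->
    is_derive y (delta_mx 0 i) (fun y => phi y 0 j : R^o) (N i j (phi y)).
  move=> Vy; set x := phi y; have [Dx dx Ex] := Hphi y Vy.
  have /nbhs_ballP[e /= e0 eD] := open_nbhs_nbhs (conj oD Dx).
  pose ga (h : R) := phi (h *: delta_mx 0 i + y).
  have line : h *: delta_mx 0 i + y @[h --> (0 : R)^'] --> y.
    have E0 : y = 0 *: delta_mx 0 i + y by rewrite scale0r add0r.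
    rewrite {2}E0; apply: cvg_within_filter.
    by apply: cvgD; [apply: cvgZr_tmp; exact: cvg_id|exact: cvg_cst].
  have ga_cvg : ga h @[h --> (0 : R)^'] --> x by exact: (cvg_comp _ _ line (cphi y Vy)).
  have K k : exists2 xi : 'I_2 -> R -> pt, forall j h, in_box x (ga h) (xi j h) &
      forall h, ball x e (ga h) -> psi (ga h) 0 k - psi x 0 k
        = \sum_j p j k (xi j h) * (ga h 0 j - x 0 j).
    apply: (@in_box_choice _ R (fun h => ball x e (ga h)) (fun x => psi x 0 k : R^o)).
    move=> h Bh z l b; apply: smooth_on_derivable; first exact: smooth_on_coord spsi.
    by apply: eD; exact: ball_in_box (ballxx _ e0) Bh b.
  have [xi0 b0 E0] := K 0; have [xi1 b1 E1] := K 1.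
  have c0 l : p l 0 (xi0 l h) @[h --> (0 : R)^'] --> p l 0 x.
    have c1 : xi0 l h @[h --> (0 : R)^'] --> x by apply: in_box_cvg ga_cvg (b0 l).
    exact: (cvg_comp _ _ c1 (smooth_on_continuous (sp l 0) Dx)).
  have c1 l : p l 1 (xi1 l h) @[h --> (0 : R)^'] --> p l 1 x.
    have c1 : xi1 l h @[h --> (0 : R)^'] --> x by apply: in_box_cvg ga_cvg (b1 l).
    exact: (cvg_comp _ _ c1 (smooth_on_continuous (sp l 1) Dx)).
  pose d h : R^o := p 0 0 (xi0 0 h) * p 1 1 (xi1 1 h) - p 0 1 (xi1 0 h) * p 1 0 (xi0 1 h).
  have d_cvg : d h @[h --> (0 : R)^'] --> dt x by apply: cvgB; apply: cvgM.
  have dx0 : dt x != 0 by rewrite -dtE.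
  pose Q (h : R) : R^o := (if j == 0 then de i 0 * p 1 1 (xi1 1 h) - de i 1 * p 1 0 (xi0 1 h)
   else de i 1 * p 0 0 (xi0 0 h) - de i 0 * p 0 1 (xi1 0 h)) * (d h)^-1.
  have Q_cvg : Q h @[h --> (0 : R)^'] --> N i j x.
    rewrite /Q /N; case: (ord2P j) => -> /=.
    - exact: (cvg_lin2 dx0 (c1 1) (c0 1) d_cvg).
    - exact: (cvg_lin2 dx0 (c0 0) (c1 0) d_cvg).
  have C : (h^-1 *: (ga h 0 j - x 0 j) : R^o) @[h --> (0 : R)^'] --> N i j x.
    apply: cvg_trans Q_cvg; apply: near_eq_cvg.
    have n1 : \forall h \near (0 : R)^', ball x e (ga h) by move/cvg_ballP: ga_cvg; exact.
    have n2 : \forall h \near (0 : R)^', V (h *: delta_mx 0 i + y).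
      by apply: line; exact: open_nbhs_nbhs.
    have n3 : \forall h \near (0 : R)^', d h != 0.
      exact: (cvgr_neq0 _ d_cvg dx0).
    have n4 : \forall h \near (0 : R)^', h != 0 by exact: nbhs_dnbhs_neq.
    apply: filterS2 (filterI n1 n2) (filterI n3 n4) => h [Bh Vh] [dh h0].
    have F0 := E0 h Bh; have F1 := E1 h Bh.
    have [_ _ Eh] := Hphi _ Vh.
    rewrite /ga Eh Ex !mxE eqxx/= addrK sum_ord2 -/(ga h) in F0.
    rewrite /ga Eh Ex !mxE eqxx/= addrK sum_ord2 -/(ga h) in F1.
    rewrite -[_ *: _]/(h^-1 * (ga h 0 j - x 0 j)).
    rewrite /Q /de [i == 0]eq_sym [i == 1]eq_sym.
    have S0 := congr1 (fun t => h^-1 * t) F0; have S1 := congr1 (fun t => h^-1 * t) F1.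
    rewrite /= !mulrA !mulVf// !mul1r in S0 S1.
    apply: (mulIf dh); rewrite -mulrA mulVf// mulr1 S0 S1 /d.
    by case: (ord2P j) => -> /=; ring.
  by apply: DeriveDef; [apply: cvgP C|apply: cvg_lim C].
apply/smooth_on_rV => // j k.
have Cphi m : class_C V m phi.
  elim: m => [|m IH]; first by split.
  apply/class_C_rV => // l; split=> [y Vy|i].
    exact: (cvg_comp _ _ (cphi y Vy) (@coord_continuous R 1 2 0 l (phi y))).
  split=> [y Vy|]; first by have [] := dphi y i l Vy.
  apply: (@class_C_eq _ _ _ _ (fun y => N i l (phi y))) => //.
    by move=> y Vy; have [_] := dphi y i l Vy.
  exact: class_C_comp VD' (sN i l m) IH.
by have /class_C_rV := Cphi k; apply.
Qed.

Theorem inverse_function D (psi : pt -> pt) x0 :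
  open D -> D x0 -> smooth_on D psi -> \det (partials psi x0) != 0 ->
  exists (U V : set pt) (phi : pt -> pt),
    [/\ open U, open V, U x0, U `<=` D &
     [/\ forall x, U x -> V (psi x) /\ phi (psi x) = x,
         forall y, V y -> U (phi y) /\ psi (phi y) = y,
         forall x, U x -> \det (partials psi x) != 0 &
         smooth_on V phi]].
Proof.
move=> oD Dx0 spsi det0.
set L := invmx (partials psi x0); set C : R := \sum_i \sum_k `|L i k|.
have [rho rho0 Hr] := local_inverse_radius oD Dx0 spsi det0.
have C0 : 0 <= C by do 2!(apply: sumr_ge0 => ? _).
(* [C + 1] in place of [C] makes the denominator visibly positive. *)
pose del := rho / 4 / (C + 1).
have del0 : 0 < del by rewrite !divr_gt0// ltr_wpDl.
pose V : set pt := ball (psi x0) del.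
pose B : set pt := ball x0 rho.
pose U : set pt := B `&` psi @^-1` V.
have oV : open V by exact: ball_open.
have BD x : B x -> D x by move=> /Hr[].
have cpsi x : D x -> {for x, continuous psi} by exact: smooth_on_continuous.
have oU : open U.
  have oB : open B by exact: ball_open.
  by apply: (openI_preimage oB oV) => x Bx; exact/cpsi/BD.
have Hs y : V y -> exists2 x, B x & psi x = y.
  move=> Vy; apply: (local_inverse_surj oD spsi det0 rho0 Hr).
  have : `|y - psi x0| < del by rewrite distrC -ball_rV_norm.
  move=> /ltW h; apply: (@le_trans _ _ ((C + 1) * del)).
    by apply: ler_pM => //; rewrite lerDl.
  by rewrite mulrC divfK// gt_eqF// ltr_wpDl.
have /choice[phi Hphi] y : exists x, V y -> B x /\ psi x = y.
  have [/Hs[x Bx E]|nV] := pselect (V y); first by exists x.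
  by exists 0.
have expand x y : B x -> B y -> `|x - y| <= 2 * C * `|psi x - psi y|.
  exact: (local_inverse_expand oD spsi rho0 Hr).
have inj x y : B x -> B y -> psi x = psi y -> x = y.
  move=> Bx By E; apply/eqP; rewrite -subr_eq0 -normr_le0.
  by have := expand x y Bx By; rewrite E subrr normr0 mulr0.
have cphi y : V y -> {for y, continuous phi}.
  move=> Vy; apply: continuous_atP => e e0.
  have p0 : 0 < e / (2 * C + 1) by rewrite divr_gt0// ltr_wpDl ?mulr_ge0.
  have : \forall z \near y, V z /\ `|y - z| < e / (2 * C + 1).
    apply: filterI; first exact: open_nbhs_nbhs.
    by have := nbhsx_ballx y _ p0; apply: filterS => z; rewrite ball_rV_norm.
  apply: filterS => z [Vz Hz].
  have [By Ey] := Hphi y Vy; have [Bz Ez] := Hphi z Vz.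
  apply: le_lt_trans (expand _ _ By Bz) _; rewrite Ey Ez.
  move: Hz; rewrite ltr_pdivlMr ?ltr_wpDl ?mulr_ge0// mulrC; apply: le_lt_trans.
  by apply: ler_wpM2r => //; rewrite lerDl.
have det1 x : B x -> \det (partials psi x) != 0.
  exact: (local_inverse_det oD spsi Hr).
have UV x : U x -> V (psi x) /\ phi (psi x) = x.
  by move=> [Bx Vx]; split; [exact: Vx|have [By Ey] := Hphi _ Vx; exact: inj].
have VU y : V y -> U (phi y) /\ psi (phi y) = y.
  by move=> Vy; have [By Ey] := Hphi _ Vy; rewrite /U/= Ey.
have Ux0 : U x0 by split; apply: ballxx.
have UD : U `<=` D by move=> x [Bx _]; exact: BD.
have detU x : U x -> \det (partials psi x) != 0 by move=> [Bx _]; exact: det1.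
exists U, V, phi; split; [exact: oU|exact: oV|exact: Ux0|exact: UD|].
split; [exact: UV|exact: VU|exact: detU|].
apply: (smooth_on_local_inverse oD oV spsi cphi) => y Vy.
by have [By Ey] := Hphi y Vy; split; [exact: BD|exact: det1|exact: Ey].
Qed.
End inverse_function.

(** * Complex-valued functions and their complex derivatives *)

Section complex_parts.
Context {R : rcfType}.
Implicit Types a b : R[i].
Local Notation Re := complex.Re.
Local Notation Im := complex.Im.

Lemma complex_ext a b : Re a = Re b -> Im a = Im b -> a = b.
Proof. by case: a b => [a0 a1] [b0 b1] /= -> ->. Qed.
Lemma Re_cM a b : Re (a * b) = Re a * Re b - Im a * Im b.
Proof. by case: a b => [a0 a1] [b0 b1]. Qed.
Lemma Im_cM a b : Im (a * b) = Re a * Im b + Im a * Re b.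
Proof. by case: a b => [a0 a1] [b0 b1]. Qed.
Lemma Re_cD a b : Re (a + b) = Re a + Re b.
Proof. by case: a b => [a0 a1] [b0 b1]. Qed.
Lemma Im_cD a b : Im (a + b) = Im a + Im b.
Proof. by case: a b => [a0 a1] [b0 b1]. Qed.
Lemma Re_cN a : Re (- a) = - Re a.
Proof. by case: a. Qed.
Lemma Im_cN a : Im (- a) = - Im a.
Proof. by case: a. Qed.
Lemma Re_cV a : Re (a^-1) = Re a * (Re a * Re a + Im a * Im a)^-1.
Proof. by case: a => [a0 a1]; rewrite /GRing.inv/= !expr2. Qed.
Lemma Im_cV a : Im (a^-1) = - (Im a * (Re a * Re a + Im a * Im a)^-1).
Proof. by case: a => [a0 a1]; rewrite /GRing.inv/= !expr2. Qed.
Lemma normsq_neq0 a : a != 0 -> Re a * Re a + Im a * Im a != 0.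
Proof.
case: a => [a0 a1] /=; rewrite eq_complex /= negb_and => h.
have := sqr_ge0 a0; have := sqr_ge0 a1; rewrite !expr2 => h1 h0.
rewrite paddr_eq0// !mulf_eq0 !orbb negb_and; exact: h.
Qed.
End complex_parts.

Section complex_limits.
Context {R : realType} {T : Type}.
Local Notation Re := complex.Re.
Local Notation Im := complex.Im.

(** Convergence is componentwise, so that only limits of real functions are involved. *)
Definition clim (F : set_system T) (f : T -> R[i]) (l : R[i]) : Prop :=
  (fun t => Re (f t) : R^o) @ F --> (Re l : R^o) /\
  (fun t => Im (f t) : R^o) @ F --> (Im l : R^o).

Context {F : set_system T} {FF : Filter F}.
Implicit Types (f g : T -> R[i]) (l m : R[i]).

Lemma clim_unique {PF : ProperFilter F} f l m : clim F f l -> clim F f m -> l = m.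
Proof.
move=> [l0 l1] [m0 m1]; apply: complex_ext.
  exact: (cvg_unique (@norm_hausdorff _ R^o) l0 m0).
exact: (cvg_unique (@norm_hausdorff _ R^o) l1 m1).
Qed.

Lemma clim_cst l : clim F (fun _ => l) l.
Proof. by split; exact: cvg_cst. Qed.

Lemma climD f g l m : clim F f l -> clim F g m -> clim F (fun t => f t + g t) (l + m).
Proof.
move=> [f0 f1] [g0 g1]; split; rewrite ?Re_cD ?Im_cD.
  by under eq_fun do rewrite Re_cD; exact: cvgD.
by under eq_fun do rewrite Im_cD; exact: cvgD.
Qed.

Lemma climN f l : clim F f l -> clim F (fun t => - f t) (- l).
Proof.
move=> [f0 f1]; split; rewrite ?Re_cN ?Im_cN.
  by under eq_fun do rewrite Re_cN; exact: cvgN.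
by under eq_fun do rewrite Im_cN; exact: cvgN.
Qed.

Lemma climM f g l m : clim F f l -> clim F g m -> clim F (fun t => f t * g t) (l * m).
Proof.
move=> [f0 f1] [g0 g1]; split; rewrite ?Re_cM ?Im_cM.
  by under eq_fun do rewrite Re_cM; apply: cvgB; apply: cvgM.
by under eq_fun do rewrite Im_cM; apply: cvgD; apply: cvgM.
Qed.

Lemma climV f l : l != 0 -> clim F f l -> clim F (fun t => (f t)^-1) l^-1.
Proof.
move=> l0 [f0 f1]; have nl := normsq_neq0 l0.
have c : (fun t => Re (f t) * Re (f t) + Im (f t) * Im (f t) : R^o) @ F -->
   (Re l * Re l + Im l * Im l : R^o) by apply: cvgD; apply: cvgM.
split; rewrite ?Re_cV ?Im_cV.
  under eq_fun do rewrite Re_cV; apply: cvgM => //; exact: cvgV.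
under eq_fun do rewrite Im_cV; apply: cvgN; apply: cvgM => //; exact: cvgV.
Qed.

Lemma clim_near f g l : (\forall t \near F, f t = g t) -> clim F f l -> clim F g l.
Proof.
move=> fg [f0 f1]; split.
  by apply: cvg_trans f0; apply: near_eq_cvg; apply: filterS fg => t ->.
by apply: cvg_trans f1; apply: near_eq_cvg; apply: filterS fg => t ->.
Qed.

End complex_limits.

Section complex_functions.
Context {R : realType}.
Local Notation pt := 'rV[R]_2.
Local Notation Re := complex.Re.
Local Notation Im := complex.Im.
Implicit Types (D U : set pt) (x : pt) (f g : pt -> R[i]).

Definition csmooth D f := smooth_on D (re_part f) /\ smooth_on D (im_part f).

Lemma csmooth_eq D f g : open D -> (forall x, D x -> f x = g x) ->
  csmooth D f -> csmooth D g.
Proof.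
move=> oD fg [f0 f1]; split.
  by apply: smooth_on_eq oD _ f0 => x Dx; rewrite /re_part fg.
by apply: smooth_on_eq oD _ f1 => x Dx; rewrite /im_part fg.
Qed.

Lemma csmooth_sub D U f : U `<=` D -> csmooth D f -> csmooth U f.
Proof. by move=> UD [f0 f1]; split; [apply: smooth_on_sub f0|apply: smooth_on_sub f1]. Qed.

Lemma csmooth_cst D (c : R[i]) : csmooth D (fun _ => c).
Proof. by split; exact: smooth_on_cst. Qed.

Lemma csmoothD D f g : open D -> csmooth D f -> csmooth D g ->
  csmooth D (fun x => f x + g x).
Proof.
move=> oD [f0 f1] [g0 g1]; split.
  by apply: smooth_on_eq oD _ (smooth_onD oD f0 g0) => x _; rewrite /re_part Re_cD.
by apply: smooth_on_eq oD _ (smooth_onD oD f1 g1) => x _; rewrite /im_part Im_cD.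
Qed.

Lemma csmoothN D f : open D -> csmooth D f -> csmooth D (fun x => - f x).
Proof.
move=> oD [f0 f1]; split.
  by apply: smooth_on_eq oD _ (smooth_onN oD f0) => x _; rewrite /re_part Re_cN.
by apply: smooth_on_eq oD _ (smooth_onN oD f1) => x _; rewrite /im_part Im_cN.
Qed.

Lemma csmoothB D f g : open D -> csmooth D f -> csmooth D g ->
  csmooth D (fun x => f x - g x).
Proof. by move=> oD sf sg; apply: csmoothD => //; exact: csmoothN. Qed.

Lemma csmoothM D f g : open D -> csmooth D f -> csmooth D g ->
  csmooth D (fun x => f x * g x).
Proof.
move=> oD [f0 f1] [g0 g1]; split.
  apply: smooth_on_eq oD _ (smooth_onB oD (smooth_onM oD f0 g0) (smooth_onM oD f1 g1)).
  by move=> x _; rewrite /re_part Re_cM.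
apply: smooth_on_eq oD _ (smooth_onD oD (smooth_onM oD f0 g1) (smooth_onM oD f1 g0)).
by move=> x _; rewrite /im_part Im_cM.
Qed.

Lemma csmoothV D f : open D -> (forall x, D x -> f x != 0) -> csmooth D f ->
  csmooth D (fun x => (f x)^-1).
Proof.
move=> oD fn0 [f0 f1].
have s := smooth_onD oD (smooth_onM oD f0 f0) (smooth_onM oD f1 f1).
have sV := smooth_onV oD (fun x Dx => normsq_neq0 (fn0 x Dx)) s.
split.
  by apply: smooth_on_eq oD _ (smooth_onM oD f0 sV) => x _; rewrite /re_part Re_cV.
by apply: smooth_on_eq oD _ (smooth_onN oD (smooth_onM oD f1 sV)) => x _; rewrite /im_part Im_cV.
Qed.

Lemma csmoothX D f n : open D -> csmooth D f -> csmooth D (fun x => f x ^+ n).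
Proof.
move=> oD sf; elim: n => [|n IH]; first exact: csmooth_cst.
by apply: csmooth_eq oD _ (csmoothM oD sf IH) => x _; rewrite exprS.
Qed.

Lemma csmooth_cpd D f i : csmooth D f -> csmooth D (cpd i f).
Proof. by move=> [f0 f1]; split; apply: smooth_on_pd. Qed.

Lemma csmooth_real D (f : pt -> R^o) : smooth_on D f -> csmooth D (fun x => (f x)%:C).
Proof. by move=> sf; split=> //; exact: smooth_on_cst. Qed.

Lemma cpd_eq D f g i x : open D -> D x -> (forall y, D y -> f y = g y) ->
  cpd i f x = cpd i g x.
Proof.
move=> oD Dx fg; congr (_ +i* _).
  by apply: pd_eq_on oD Dx _ => y Dy; rewrite /re_part fg.
by apply: pd_eq_on oD Dx _ => y Dy; rewrite /im_part fg.
Qed.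

Lemma cpd_cst i (c : R[i]) x : cpd i (fun _ => c) x = 0.
Proof. by apply: complex_ext; rewrite /=; exact: pd_cst. Qed.

Lemma cpd_real i (f : pt -> R^o) x : cpd i (fun x => (f x)%:C) x = (pd i f x)%:C.
Proof. by apply: complex_ext => //=; exact: pd_cst. Qed.

Lemma cpdD D f g i x : D x -> csmooth D f -> csmooth D g ->
  cpd i (fun x => f x + g x) x = cpd i f x + cpd i g x.
Proof.
move=> Dx [f0 f1] [g0 g1]; apply: complex_ext; rewrite ?Re_cD ?Im_cD /=.
  rewrite -(pdD i Dx f0 g0); congr (pd i _ x); apply/funext => y; exact: Re_cD.
rewrite -(pdD i Dx f1 g1); congr (pd i _ x); apply/funext => y; exact: Im_cD.
Qed.

Lemma cpdN D f i x : D x -> csmooth D f ->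
  cpd i (fun x => - f x) x = - cpd i f x.
Proof.
move=> Dx [f0 f1]; apply: complex_ext; rewrite ?Re_cN ?Im_cN /=.
  rewrite -(pdN i Dx f0); congr (pd i _ x); apply/funext => y; exact: Re_cN.
rewrite -(pdN i Dx f1); congr (pd i _ x); apply/funext => y; exact: Im_cN.
Qed.

Lemma cpdM D f g i x : open D -> D x -> csmooth D f -> csmooth D g ->
  cpd i (fun x => f x * g x) x = cpd i f x * g x + f x * cpd i g x.
Proof.
move=> oD Dx [f0 f1] [g0 g1]; apply: complex_ext; rewrite ?Re_cD ?Im_cD ?Re_cM ?Im_cM /=.
  transitivity (pd i (fun x => re_part f x * re_part g x - im_part f x * im_part g x : R^o) x).
    by congr (pd i _ x); apply/funext => y; exact: Re_cM.
  rewrite (pdB i Dx (smooth_onM oD f0 g0) (smooth_onM oD f1 g1)).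
  rewrite (pdM i Dx f0 g0) (pdM i Dx f1 g1) /re_part /im_part; ring.
transitivity (pd i (fun x => re_part f x * im_part g x + im_part f x * re_part g x : R^o) x).
  by congr (pd i _ x); apply/funext => y; exact: Im_cM.
rewrite (pdD i Dx (smooth_onM oD f0 g1) (smooth_onM oD f1 g0)).
rewrite (pdM i Dx f0 g1) (pdM i Dx f1 g0) /re_part /im_part; ring.
Qed.

Lemma cpdZ D a f i x : open D -> D x -> csmooth D f ->
  cpd i (fun x => a * f x) x = a * cpd i f x.
Proof.
by move=> oD Dx sf; rewrite (cpdM i oD Dx (csmooth_cst D a) sf) cpd_cst mul0r add0r.
Qed.

Lemma cpdV D f i x : open D -> D x -> (forall x, D x -> f x != 0) -> csmooth D f ->
  cpd i (fun x => (f x)^-1) x = - (cpd i f x / f x ^+ 2).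
Proof.
move=> oD Dx fn0 sf; have fx0 := fn0 x Dx.
have sV := csmoothV oD fn0 sf.
have : cpd i (fun x => f x * (f x)^-1) x = 0.
  rewrite -(cpd_cst i 1 x); apply: cpd_eq oD Dx _ => y Dy; rewrite mulfV//; exact: fn0.
rewrite (cpdM i oD Dx sf sV) => E; apply: (mulfI fx0).
move/eqP: E; rewrite addrC addr_eq0 => /eqP ->; field.
exact: fx0.
Qed.

End complex_functions.

Section directional.
Context {R : realType}.
Local Notation pt := 'rV[R]_2.
Implicit Types (D U : set pt) (x p : pt) (f g : pt -> R[i]) (c d : 'I_2 -> R[i]).

(** Both [ddz] and [ddzbar] are instances, so their calculus rules are proved once, and [cdir_sym]
    makes them commute. *)
Definition cdir c f x : R[i] := \sum_(i < 2) c i * cpd i f x.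

Lemma cdir_eq D c f g x : open D -> D x -> (forall y, D y -> f y = g y) ->
  cdir c f x = cdir c g x.
Proof. by move=> oD Dx fg; apply: eq_bigr => i _; rewrite (cpd_eq i oD Dx fg). Qed.

Lemma csmooth_cdir D c f : open D -> csmooth D f -> csmooth D (cdir c f).
Proof.
move=> oD sf; have H i := csmoothM oD (csmooth_cst D (c i)) (csmooth_cpd i sf).
by apply: csmooth_eq oD _ (csmoothD oD (H 0) (H 1)) => x _; rewrite /cdir sum_ord2.
Qed.

Lemma cdir_cst c a x : cdir c (fun _ => a) x = 0.
Proof. by rewrite /cdir big1// => i _; rewrite cpd_cst mulr0. Qed.

Lemma cdirD D c f g x : D x -> csmooth D f -> csmooth D g ->
  cdir c (fun x => f x + g x) x = cdir c f x + cdir c g x.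
Proof.
by move=> Dx sf sg; rewrite /cdir -big_split; apply: eq_bigr => i _; rewrite (cpdD i Dx sf sg) mulrDr.
Qed.

Lemma cdirN D c f x : D x -> csmooth D f -> cdir c (fun x => - f x) x = - cdir c f x.
Proof.
by move=> Dx sf; rewrite /cdir -sumrN; apply: eq_bigr => i _; rewrite (cpdN i Dx sf) mulrN.
Qed.

Lemma cdirB D c f g x : open D -> D x -> csmooth D f -> csmooth D g ->
  cdir c (fun x => f x - g x) x = cdir c f x - cdir c g x.
Proof. by move=> oD Dx sf sg; rewrite (cdirD _ Dx sf (csmoothN oD sg)) (cdirN _ Dx sg). Qed.

Lemma cdirM D c f g x : open D -> D x -> csmooth D f -> csmooth D g ->
  cdir c (fun x => f x * g x) x = cdir c f x * g x + f x * cdir c g x.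
Proof.
move=> oD Dx sf sg; rewrite /cdir mulr_suml mulr_sumr -big_split; apply: eq_bigr => i _.
by rewrite (cpdM i oD Dx sf sg) /=; ring.
Qed.

Lemma cdirZ D c a f x : open D -> D x -> csmooth D f ->
  cdir c (fun x => a * f x) x = a * cdir c f x.
Proof.
by move=> oD Dx sf; rewrite (cdirM _ oD Dx (csmooth_cst D a) sf) cdir_cst mul0r add0r.
Qed.

Lemma cdirV D c f x : open D -> D x -> (forall x, D x -> f x != 0) -> csmooth D f ->
  cdir c (fun x => (f x)^-1) x = - (cdir c f x / f x ^+ 2).
Proof.
move=> oD Dx f0 sf; rewrite /cdir mulr_suml -sumrN; apply: eq_bigr => i _.
by rewrite (cpdV i oD Dx f0 sf); ring.
Qed.

Lemma cdirX D c f x n : open D -> D x -> csmooth D f ->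
  cdir c (fun x => f x ^+ n.+1) x = n.+1%:R * f x ^+ n * cdir c f x.
Proof.
move=> oD Dx sf; elim: n => [|n IH].
  by rewrite expr0 mulr1 mul1r; apply: eq_bigr => i _; congr (_ * cpd i _ x).
rewrite (cdir_eq (g := fun x => f x * f x ^+ n.+1) _ oD Dx); last by move=> y _; rewrite exprS.
by rewrite (cdirM _ oD Dx sf (csmoothX n.+1 oD sf)) IH -[in RHS]natr1 !exprS; ring.
Qed.

Lemma cpd_sym D f i j x : open D -> D x -> csmooth D f ->
  cpd i (cpd j f) x = cpd j (cpd i f) x.
Proof. move=> oD Dx [f0 f1]; apply: complex_ext; first exact: (pd_sym i j oD Dx f0).
exact: (pd_sym i j oD Dx f1). Qed.

Lemma cdir_sym D c d f x : open D -> D x -> csmooth D f ->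
  cdir c (cdir d f) x = cdir d (cdir c f) x.
Proof.
move=> oD Dx sf.
have E e i : cpd i (cdir e f) x = e 0 * cpd i (cpd 0 f) x + e 1 * cpd i (cpd 1 f) x.
  have H j := csmoothM oD (csmooth_cst D (e j)) (csmooth_cpd j sf).
  rewrite (cpd_eq (g := fun x => e 0 * cpd 0 f x + e 1 * cpd 1 f x) i oD Dx); last first.
    by move=> y _; rewrite /cdir sum_ord2.
  rewrite (cpdD i Dx (H 0) (H 1)).
  have Z0 := cpdZ (e 0) i oD Dx (csmooth_cpd 0 sf).
  have Z1 := cpdZ (e 1) i oD Dx (csmooth_cpd 1 sf).
  by congr (_ + _); [exact: Z0|exact: Z1].
have S := cpd_sym 0 1 oD Dx sf.
rewrite [LHS]/cdir [RHS]/cdir !sum_ord2 (E d 0) (E d 1) (E c 0) (E c 1).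
have K (c0 c1 d0 d1 a00 a01 a10 a11 : R[i]) : a01 = a10 ->
    c0 * (d0 * a00 + d1 * a01) + c1 * (d0 * a10 + d1 * a11)
    = d0 * (c0 * a00 + c1 * a01) + d1 * (c0 * a10 + c1 * a11) by move=> ->; ring.
exact: K S.
Qed.

Lemma ddzE f x : ddz f x = 2^-1 * (cpd 0 f x - 'i * cpd 1 f x).
Proof.
rewrite /ddz sum_ord2; have -> : ddz_comp R 0 = 2^-1 by rewrite /ddz_comp expr0 mulr1.
have -> : ddz_comp R 1 = - (2^-1 * 'i) by rewrite /ddz_comp expr1 mulrN.
by rewrite mulrBr mulNr mulrA.
Qed.

Lemma ddzbarE f x : ddzbar f x = 2^-1 * (cpd 0 f x + 'i * cpd 1 f x).
Proof. by rewrite /ddzbar sum_ord2 expr0 expr1 mulr1 mulrDr mulrA. Qed.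

Lemma csmooth_ddz D f : open D -> csmooth D f -> csmooth D (ddz f).
Proof. exact: csmooth_cdir. Qed.

Lemma csmooth_iter_ddz D f k : open D -> csmooth D f -> csmooth D (iter k (@ddz R) f).
Proof. by move=> oD sf; elim: k => //= k; exact: csmooth_ddz. Qed.

Definition zcoord p x : R[i] := (x 0 0 - p 0 0) +i* (x 0 1 - p 0 1).

Lemma csmooth_zcoord D p : csmooth D (zcoord p).
Proof.
by split=> k; (apply: class_C_sub (subsetT D) _; apply: class_CD; [exact: openT|exact: class_C_coordf|exact: class_C_cst]).
Qed.

Lemma cpd_zcoord p i x : cpd i (zcoord p) x = (i == 0)%:R +i* (i == 1)%:R.
Proof.
have H j : pd i (fun x => coordf j x - p 0 j) x = (i == j)%:R.
  have sc := @smooth_on_cst R R^o setT (p 0 j).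
  by rewrite (pdB i I (@smooth_on_coordf R setT j) sc) pd_coordf pd_cst subr0.
by apply: complex_ext; rewrite /=; exact: H.
Qed.

Lemma ddz_zcoord p x : ddz (zcoord p) x = 1.
Proof. by rewrite ddzE !cpd_zcoord; apply: complex_ext; rewrite /=; field. Qed.

Lemma ddzbar_zcoord p x : ddzbar (zcoord p) x = 0.
Proof. by rewrite ddzbarE !cpd_zcoord; apply: complex_ext; rewrite /=; field. Qed.

Lemma zcoord_eq0 p x : (zcoord p x == 0) = (x == p).
Proof.
rewrite eq_complex /= !subr_eq0; apply/andP/eqP => [[/eqP h0 /eqP h1]|->]; last by [].
exact: rV2E.
Qed.

End directional.

#[global] Instance dnbhs_rV2_proper {R : realType} (p : 'rV[R]_2) : ProperFilter p^'.
Proof.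
apply: Build_ProperFilter_ex => P; rewrite /dnbhs /within /= => /nbhs_ballP[e /= e0 H].
exists (p + (e / 2) *: delta_mx 0 0); apply: H.
  apply/ball_rVE => // j; rewrite !mxE opprD addNKr normrN normrM ger0_norm ?divr_ge0 ?ltW//.
  by case: (ord2P j) => -> /=; rewrite ?normr1 ?normr0 ?mulr1 ?mulr0//; lra.
apply/eqP => /rowP/(_ 0); rewrite !mxE /= mulr1 => /eqP.
by rewrite -subr_eq0 addrAC subrr add0r mulf_eq0 invr_eq0 pnatr_eq0 orbF gt_eqF.
Qed.

(** * Holomorphic functions and their leading Taylor term *)

Section holomorphic.
Context {R : realType}.
Local Notation pt := 'rV[R]_2.
Local Notation Re := complex.Re.
Local Notation Im := complex.Im.
Implicit Types (D U : set pt) (x p : pt) (f g : pt -> R[i]).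

Lemma holomorphicP D f :
  holomorphic_on D f <-> csmooth D f /\ forall x, D x -> ddzbar f x = 0.
Proof. by split=> [[f0 f1 H]|[[f0 f1] H]]. Qed.

Lemma holomorphic_cst D a : holomorphic_on D (fun _ => a).
Proof. by apply/holomorphicP; split=> [|x _]; [exact: csmooth_cst|exact: cdir_cst]. Qed.

Lemma holomorphic_zcoord D p : holomorphic_on D (zcoord p).
Proof. by apply/holomorphicP; split=> [|x _]; [exact: csmooth_zcoord|exact: ddzbar_zcoord]. Qed.

Lemma holomorphic_sub D U f : U `<=` D -> holomorphic_on D f -> holomorphic_on U f.
Proof.
move=> UD /holomorphicP[sf H]; apply/holomorphicP; split; first exact: csmooth_sub sf.
by move=> x /UD; exact: H.
Qed.

Lemma holomorphic_eq D f g : open D -> (forall x, D x -> f x = g x) ->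
  holomorphic_on D f -> holomorphic_on D g.
Proof.
move=> oD fg /holomorphicP[sf H]; apply/holomorphicP; split; first exact: csmooth_eq sf.
by move=> x Dx; rewrite [LHS](cdir_eq (g := f) _ oD Dx) ?[LHS]H// => y Dy; rewrite fg.
Qed.

Lemma holomorphicB D f g : open D ->
  holomorphic_on D f -> holomorphic_on D g -> holomorphic_on D (fun x => f x - g x).
Proof.
move=> oD /holomorphicP[sf Hf] /holomorphicP[sg Hg]; apply/holomorphicP; split.
  exact: csmoothB.
by move=> x Dx; rewrite [LHS](cdirB _ oD Dx sf sg) [cdir _ f x]Hf// [cdir _ g x]Hg// subrr.
Qed.

Lemma holomorphicM D f g : open D ->
  holomorphic_on D f -> holomorphic_on D g -> holomorphic_on D (fun x => f x * g x).
Proof.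
move=> oD /holomorphicP[sf Hf] /holomorphicP[sg Hg]; apply/holomorphicP; split.
  exact: csmoothM.
move=> x Dx; rewrite [LHS](cdirM _ oD Dx sf sg) [cdir _ f x]Hf// [cdir _ g x]Hg//.
by rewrite mul0r mulr0 addr0.
Qed.

Lemma holomorphicX D f n : open D ->
  holomorphic_on D f -> holomorphic_on D (fun x => f x ^+ n).
Proof.
move=> oD hf; elim: n => [|n IH]; first exact: holomorphic_cst.
by apply: holomorphic_eq oD _ (holomorphicM oD hf IH) => x _; rewrite exprS.
Qed.

Lemma holomorphicV D f : open D -> (forall x, D x -> f x != 0) ->
  holomorphic_on D f -> holomorphic_on D (fun x => (f x)^-1).
Proof.
move=> oD f0 /holomorphicP[sf Hf]; apply/holomorphicP; split; first exact: csmoothV.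
by move=> x Dx; rewrite [LHS](cdirV _ oD Dx f0 sf) [cdir _ f x]Hf// mul0r oppr0.
Qed.

Lemma holomorphic_ddz D f : open D -> holomorphic_on D f -> holomorphic_on D (ddz f).
Proof.
move=> oD /holomorphicP[sf Hf]; apply/holomorphicP; split; first exact: csmooth_ddz.
move=> x Dx; rewrite [LHS](cdir_sym _ _ oD Dx sf).
by rewrite (cdir_eq (g := fun _ => 0) _ oD Dx) ?cdir_cst// => y Dy; exact: Hf.
Qed.

Lemma holomorphic_cpd D f x : holomorphic_on D f -> D x ->
  cpd 0 f x = ddz f x /\ cpd 1 f x = 'i * ddz f x.
Proof.
move=> /holomorphicP[sf Hf] Dx; have := Hf x Dx; rewrite ddzbarE ddzE.
move=> /eqP; rewrite mulf_eq0 invr_eq0 (_ : 2 == 0 = false) ?orFb; last first.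
  by rewrite (pnatr_eq0 R[i] 2).
rewrite addr_eq0 => /eqP E0; split; first by rewrite E0; field.
have i2 : 'i * 'i = -1 :> R[i] by rewrite -expr2 sqr_i.
rewrite E0; transitivity (- ('i * 'i) * cpd 1 f x); first by rewrite i2; ring.
by field.
Qed.

(** The squared modulus with values in [R]: unlike the modulus it is polynomial in the two parts,
    hence smooth also at zeros. *)
Definition csq (a : R[i]) : R := Re a * Re a + Im a * Im a.

Lemma csq_ge0 a : 0 <= csq a.
Proof. by rewrite addr_ge0// -expr2 sqr_ge0. Qed.

Lemma csqM a b : csq (a * b) = csq a * csq b.
Proof. by rewrite /csq Re_cM Im_cM; ring. Qed.

Lemma csqX a n : csq (a ^+ n) = csq a ^+ n.
Proof.
elim: n => [|n IH]; first by rewrite /csq/= mul0r addr0 mulr1.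
by rewrite !exprS csqM IH.
Qed.

Lemma csqi : csq 'i = 1.
Proof. by rewrite /csq/= mul0r add0r mulr1. Qed.

Lemma csq_eq0 a : (csq a == 0) = (a == 0).
Proof.
apply/idP/idP => [|/eqP->]; last by rewrite /csq/= mul0r addr0.
by apply: contraTT => /normsq_neq0.
Qed.

Lemma clim0P T (F : set_system T) {FF : Filter F} (f : T -> R[i]) :
  clim F f 0 <-> forall e : R, 0 < e -> \forall t \near F, csq (f t) <= e.
Proof.
split=> [[f0 f1] e e0|H].
  have c : (csq (f t) : R^o) @[t --> F] --> (0 : R^o).
    have -> : (0 : R^o) = 0 * 0 + 0 * 0 by rewrite mul0r addr0.
    by apply: cvgD; apply: cvgM.
  move/cvgrPdist_le : c => /(_ e e0); apply: filterS => t.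
  by rewrite sub0r normrN ger0_norm// csq_ge0.
have K (u : T -> R) : (forall t, u t * u t <= csq (f t)) -> (u t : R^o) @[t --> F] --> (0 : R^o).
  move=> Hu; apply/cvgrPdist_le => e e0; have := H (e * e) (mulr_gt0 e0 e0).
  apply: filterS => t Ht; rewrite sub0r normrN.
  rewrite -(@ler_pXn2r _ 2)// ?nnegrE ?(ltW e0)// -normrX ger0_norm ?sqr_ge0//.
  by rewrite !expr2 (le_trans (Hu t)).
by split; apply: K => t; rewrite /csq; [rewrite lerDl|rewrite lerDr]; rewrite -expr2 sqr_ge0.
Qed.

Lemma csq_zcoord_in_box p x y : in_box p x y -> csq (zcoord p y) <= csq (zcoord p x).
Proof.
move=> b; rewrite /csq /=; have H j := in_box_norm j b.
have K (u v : R) : `|u| <= `|v| -> u * u <= v * v.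
  by move=> uv; rewrite -!expr2 -[u ^+ 2]real_normK ?num_real// -[v ^+ 2]real_normK ?num_real// lerXn2r ?nnegrE.
by apply: lerD; apply: K.
Qed.

Lemma csq_cpd_le f x i : pd i (re_part f) x ^+ 2 <= csq (cpd i f x) /\
  pd i (im_part f) x ^+ 2 <= csq (cpd i f x).
Proof. by rewrite /csq/= !expr2 lerDl lerDr -!expr2 !sqr_ge0. Qed.

(** Integrates a bound on the derivative and gains one power of [|z|^2]. The factor 4 arises as 2
    for the two mean value terms in each real component, by Cauchy-Schwarz, times 2 components. *)
Lemma csq_mean_value D f p x e m : holomorphic_on D f -> f p = 0 -> 0 <= e ->
  (forall y, in_box p x y -> D y /\ csq (ddz f y) <= e * csq (zcoord p y) ^+ m) ->
  csq (f x) <= 4 * e * csq (zcoord p x) ^+ m.+1.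
Proof.
move=> hf fp e0 H; have /holomorphicP[[f0 f1] _] := hf.
set z := csq (zcoord p x).
have B y i : in_box p x y -> csq (cpd i f y) <= e * z ^+ m.
  move=> b; have [Dy Hy] := H y b; have [c0 c1] := holomorphic_cpd hf Dy.
  have -> : csq (cpd i f y) = csq (ddz f y).
    by case: (ord2P i) => ->; rewrite ?c0 ?c1 // csqM csqi mul1r.
  apply: le_trans Hy _; apply: ler_wpM2l => //.
  by apply: lerXn2r; rewrite ?nnegrE ?csq_ge0 ?csq_zcoord_in_box.
have K (g : pt -> R^o) : smooth_on D g -> g p = 0 ->
    (forall y i, pd i g y ^+ 2 <= csq (cpd i f y)) -> g x ^+ 2 <= 2 * (e * z ^+ m) * z.
  move=> sg gp Hg.
  have [y i b|xi bxi E] := @mean_value _ g p x.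
    by apply: (smooth_on_derivable sg); have [] := H y b.
  have {}E : g x = pd 0 g (xi 0) * (x 0 0 - p 0 0) + pd 1 g (xi 1) * (x 0 1 - p 0 1).
    by rewrite -[LHS]subr0 -gp E sum_ord2.
  have B0 := le_trans (Hg _ 0) (B _ 0 (bxi 0)).
  have B1 := le_trans (Hg _ 1) (B _ 1 (bxi 1)).
  rewrite E /z /csq /=; move: B0 B1.
  move: (pd 0 g (xi 0)) (pd 1 g (xi 1)) (x 0 0 - p 0 0) (x 0 1 - p 0 1) (e * z ^+ m).
  move=> a b h k c; rewrite !expr2 => B0 B1.
  have : (a * h + b * k) * (a * h + b * k) <= (a * a + b * b) * (h * h + k * k).
    have := sqr_ge0 (a * k - b * h); rewrite expr2; nra.
  move=> /le_trans; apply; apply: ler_wpM2r; last lra.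
  by rewrite addr_ge0 -?expr2 ?sqr_ge0.
have fp0 : Re (f p) = 0 by rewrite fp.
have fp1 : Im (f p) = 0 by rewrite fp.
have := K _ f0 fp0 (fun y i => (csq_cpd_le f y i).1).
have := K _ f1 fp1 (fun y i => (csq_cpd_le f y i).2).
rewrite /csq /re_part /im_part -!expr2 [z ^+ m.+1]exprSr => h1 h2.
apply: le_trans (lerD h2 h1) _; rewrite le_eqVlt; apply/orP; left; apply/eqP; ring.
Qed.

Lemma clim_continuous D f p : csmooth D f -> D p -> clim (nbhs p) f (f p).
Proof.
by move=> [f0 f1] Dp; split; [exact: smooth_on_continuous f0 Dp|exact: smooth_on_continuous f1 Dp].
Qed.

Lemma clim_dnbhs f p l : clim (nbhs p) f l -> clim p^' f l.
Proof. by move=> [f0 f1]; split; exact: cvg_within_filter. Qed.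

(** A rule of l'Hopital type. Subtracting the expected monomial reduces it to the limit 0, where
    [csq_mean_value] transfers the smallness of [ddz r] to [r]. *)
Lemma holomorphic_taylorS D f p m d : open D -> D p -> holomorphic_on D f -> f p = 0 ->
  clim p^' (fun x => ddz f x / zcoord p x ^+ m) d ->
  clim p^' (fun x => f x / zcoord p x ^+ m.+1) (d / m.+1%:R).
Proof.
move=> oD Dp hf fp fd.
have m0 : m.+1%:R != 0 :> R[i] by rewrite pnatr_eq0.
pose r := fun x => f x - d / m.+1%:R * zcoord p x ^+ m.+1.
have hz := holomorphicX m.+1 oD (@holomorphic_zcoord D p).
have hr : holomorphic_on D r.
  exact: holomorphicB oD hf (holomorphicM oD (holomorphic_cst D _) hz).
have rp : r p = 0.
  have /eqP z0 : zcoord p p == 0 by rewrite zcoord_eq0.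
  by rewrite /r z0 expr0n mulr0 subr0.
have dr x : D x -> ddz r x = ddz f x - d * zcoord p x ^+ m.
  move=> Dx; have /holomorphicP[sf _] := hf; have /holomorphicP[sz _] := hz.
  rewrite [LHS](cdirB _ oD Dx sf (csmoothM oD (csmooth_cst D _) sz)).
  rewrite (cdirZ _ _ oD Dx sz) (cdirX _ _ oD Dx (csmooth_zcoord D p)) [cdir _ (zcoord p) x]ddz_zcoord.
  by congr (_ - _); field.
have nz : \forall x \near p^', zcoord p x != 0.
  have : \forall x \near p^', x != p by exact: nbhs_dnbhs_neq.
  by apply: filterS => x; rewrite zcoord_eq0.
have nD : \forall x \near p^', D x by apply: nbhs_dnbhs; exact: open_nbhs_nbhs.
have rd0 : clim p^' (fun x => ddz r x / zcoord p x ^+ m) 0.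
  have H : clim p^' (fun x => ddz f x / zcoord p x ^+ m + - d) (d + - d).
    by apply: climD fd _; apply: climN; exact: clim_cst.
  rewrite subrr in H; apply: clim_near H; apply: filterS2 nz nD => x zx Dx.
  by rewrite dr// mulrBl mulfK// expf_neq0.
suff : clim p^' (fun x => r x / zcoord p x ^+ m.+1) 0.
  move=> H.
  have {}H : clim p^' (fun x => r x / zcoord p x ^+ m.+1 + d / m.+1%:R) (0 + d / m.+1%:R).
    by apply: climD H _; exact: clim_cst.
  rewrite add0r in H; apply: clim_near H; apply: filterS nz => x zx.
  by rewrite /r mulrBl mulfK ?expf_neq0// subrK.
apply/clim0P => e e0.
have e40 : 0 < e / 4 by rewrite divr_gt0.
have Hd : \forall x \near p^', csq (ddz r x) <= e / 4 * csq (zcoord p x) ^+ m.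
  have /clim0P/(_ _ e40) := rd0; apply: filterS2 nz => x zx H.
  rewrite -csqX -ler_pdivrMr; last by rewrite lt_def csq_ge0 csq_eq0 expf_neq0.
  apply: le_trans H; rewrite csqM le_eqVlt; apply/orP; left; apply/eqP; congr (_ * _).
  apply: (mulIf (x := csq (zcoord p x ^+ m))); first by rewrite csq_eq0 expf_neq0.
  rewrite mulVf ?csq_eq0 ?expf_neq0// -csqM mulVf ?expf_neq0//.
  by rewrite /csq/= mulr1 mulr0 addr0.
(* The mean value box contains [p] itself, which limits along [p^'] do not see; there continuity of
   [ddz r] forces the value 0. *)
have rdp : csq (ddz r p) <= e / 4 * csq (zcoord p p) ^+ m.
  have c1 : clim p^' (ddz r) (ddz r p).
    have /holomorphicP[sr _] := hr.
    exact: clim_dnbhs (clim_continuous (csmooth_ddz oD sr) Dp).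
  have c2 : clim p^' (ddz r) 0.
    have cz := clim_dnbhs (clim_continuous (csmoothX m openT (csmooth_zcoord setT p)) (I : setT p)).
    have H : clim p^' (fun x => ddz r x / zcoord p x ^+ m * zcoord p x ^+ m) (0 * zcoord p p ^+ m).
      exact: climM rd0 cz.
    rewrite mul0r in H; apply: clim_near H; apply: filterS nz => x zx.
    by rewrite divfK// expf_neq0.
  have -> : csq (ddz r p) = 0 by apply/eqP; rewrite csq_eq0; apply/eqP; exact: clim_unique c1 c2.
  by rewrite mulr_ge0 ?(ltW e40)// exprn_ge0// csq_ge0.
have : \forall x \near p, D x /\ csq (ddz r x) <= e / 4 * csq (zcoord p x) ^+ m.
  apply: filterI; first exact: open_nbhs_nbhs.
  have : nbhs p (fun x => x != p -> csq (ddz r x) <= e / 4 * csq (zcoord p x) ^+ m) by exact: Hd.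
  by apply: filterS => x H; have [->//|/H] := eqVneq x p.
move=> /nbhs_ballP[del /= del0 Hdel].
have : \forall x \near p^', ball p del x by apply: nbhs_dnbhs; exact: nbhsx_ballx.
apply: filterS2 nz => x zx Bx.
have := @csq_mean_value D r p x (e / 4) m hr rp (ltW e40)
  (fun y b => Hdel y (ball_in_box (ballxx _ del0) Bx b)).
rewrite [4 * _]mulrC divfK// -csqX => H.
have zm0 : zcoord p x ^+ m.+1 != 0 by rewrite expf_neq0.
rewrite -(@ler_pM2r _ (csq (zcoord p x ^+ m.+1))); last by rewrite lt_def csq_ge0 csq_eq0 zm0.
by rewrite -csqM divfK.
Qed.

Lemma holomorphic_taylor D f p m : open D -> D p -> holomorphic_on D f ->
  (forall k, (k < m)%N -> iter k (@ddz R) f p = 0) ->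
  clim p^' (fun x => f x / zcoord p x ^+ m) (iter m (@ddz R) f p / m`!%:R).
Proof.
move=> oD Dp; elim: m f => [|m IH] f hf H.
  have /holomorphicP[sf _] := hf; have H0 : clim p^' f (f p) := clim_dnbhs (clim_continuous sf Dp).
  rewrite /= fact0 divr1; apply: clim_near H0; apply: nearW => x.
  by rewrite expr0 divr1.
have fp : f p = 0 by exact: (H 0).
have := @holomorphic_taylorS D f p m (iter m (@ddz R) (ddz f) p / m`!%:R) oD Dp hf fp.
rewrite -iterSr factS natrM invfM [m.+1%:R^-1 * _]mulrC mulrA; apply.
rewrite iterSr; apply: IH; first exact: holomorphic_ddz.
by move=> k km; rewrite -iterSr; exact: H.
Qed.
End holomorphic.

(** * The maximum principle and functions flat at a point *)

Section maximum_principle.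
Context {R : realType}.
Local Notation pt := 'rV[R]_2.
Local Notation Re := complex.Re.
Local Notation Im := complex.Im.
Implicit Types (D U : set pt) (x p c : pt) (f : pt -> R[i]) (g : pt -> R^o).

(** Were the second derivative positive at [c], it would be so nearby, and two successive mean
    values would give [pd i g c * h < 0] for small [h] of both signs. *)
Lemma pd2_at_max D g c i : open D -> D c -> smooth_on D g ->
  (forall x, D x -> g x <= g c) -> pd i (pd i g) c <= 0.
Proof.
have neg (u v : R) : u + v <= 0 -> 0 < v -> u < 0 by move=> ? ?; lra.
have half (u : R) : 0 < u -> u / 2 < u by move=> ?; lra.
have contra (u v : R) : u * v < 0 -> u * (- v) < 0 -> False by move=> ? ?; lra.
move=> oD Dc sg gmax; rewrite leNgt; apply/negP => k0.
have sg1 := smooth_on_pd i sg; have sg2 := smooth_on_pd i sg1.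
have : \forall x \near c, D x /\ 0 < pd i (pd i g) x.
  apply: filterI; first exact: open_nbhs_nbhs.
  have c2 : {for c, continuous (pd i (pd i g))} := smooth_on_continuous sg2 Dc.
  exact: (cvgr_gt _ c2).
move=> /nbhs_ballP[e /= e0 He].
have Bh (h s : R) : `|h| <= e / 2 -> 0 <= s <= 1 -> ball c e ((s * h) *: delta_mx 0 i + c).
  move=> he /andP[s0 s1]; apply/ball_rVE => // j.
  rewrite !mxE /= opprD addrCA addrN addr0 normrN normrM.
  apply: (@le_lt_trans _ _ (e / 2)); last exact: half.
  rewrite -[leRHS]mulr1; apply: ler_pM => //.
    by rewrite normrM ger0_norm// -[leRHS]mul1r ler_pM.
  by case: (j == i); rewrite ?normr1 ?normr0.
have K h : `|h| <= e / 2 -> h != 0 -> pd i g c * h < 0.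
  move=> he h0.
  have [s /andP[s0 s1] E] := @mean_value_line_strict _ g c i h
    (fun s s01 => smooth_on_derivable sg (He _ (Bh h s he s01)).1).
  have s01 : 0 <= s <= 1 by rewrite !ltW.
  have she : `|s * h| <= e / 2.
    by apply: le_trans he; rewrite normrM ger0_norm ?(ltW s0)// ler_piMl// ltW.
  have [t /andP[t0 t1] E2] := @mean_value_line_strict _ (pd i g) c i (s * h)
    (fun t t01 => smooth_on_derivable sg1 (He _ (Bh (s * h) t she t01)).1).
  have [_ kpos] := He _ (Bh (s * h) t she (introT andP (conj (ltW t0) (ltW t1)))).
  have D1 : D (h *: delta_mx 0 i + c).
    by have := Bh h 1 he; rewrite mul1r => /(_ (introT andP (conj ler01 (lexx _))))/He[].
  have := gmax _ D1; rewrite -subr_le0 E.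
  have -> : pd i g ((s * h) *: delta_mx 0 i + c)
     = pd i g c + pd i (pd i g) ((t * (s * h)) *: delta_mx 0 i + c) * (s * h).
    by rewrite -E2 [RHS]addrC subrK.
  rewrite mulrDl => H; have : 0 < pd i (pd i g) ((t * (s * h)) *: delta_mx 0 i + c) * (s * h) * h.
    rewrite -!mulrA mulr_gt0// mulr_gt0//.
    by rewrite -expr2 lt_def sqr_ge0 sqrf_eq0 h0.
  exact: neg.
have e2 : 0 < e / 2 by rewrite divr_gt0.
have ne2 : `|e / 2| <= e / 2 by rewrite ger0_norm// ltW.
have h1 := K (e / 2) ne2 (lt0r_neq0 e2).
have h2 : pd i g c * - (e / 2) < 0.
  by apply: K; [rewrite normrN|rewrite oppr_eq0 lt0r_neq0].
exact: contra h1 h2.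
Qed.

(** Both parts of [f] are harmonic by the Cauchy-Riemann equations, so only twice the sum of the
    squares of their first derivatives survives in the Laplacian. *)
Lemma laplacian_csq D f x : open D -> D x -> holomorphic_on D f ->
  0 <= \sum_i pd i (pd i (fun x => csq (f x) : R^o)) x.
Proof.
move=> oD Dx hf; have /holomorphicP[[a b] _] := hf.
have d1 i y : D y -> pd i (fun x => csq (f x) : R^o) y
    = 2 * (re_part f y * pd i (re_part f) y + im_part f y * pd i (im_part f) y).
  move=> Dy; rewrite [LHS](pdD i Dy (smooth_onM oD a a) (smooth_onM oD b b)).
  by rewrite (pdM i Dy a a) (pdM i Dy b b); ring.
have s1 i := smooth_onM oD a (smooth_on_pd i a).
have s2 i := smooth_onM oD b (smooth_on_pd i b).
have d2 i : pd i (pd i (fun x => csq (f x) : R^o)) x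
    = 2 * (pd i (re_part f) x ^+ 2 + pd i (im_part f) x ^+ 2
       + re_part f x * pd i (pd i (re_part f)) x + im_part f x * pd i (pd i (im_part f)) x).
  rewrite (pd_eq_on (g := fun y => 2 * (re_part f y * pd i (re_part f) y + im_part f y * pd i (im_part f) y) : R^o) i oD Dx); last by move=> y Dy; exact: d1.
  rewrite (pdM i Dx (@smooth_on_cst R R^o D 2) (smooth_onD oD (s1 i) (s2 i))) pd_cst mul0r add0r.
  rewrite (pdD i Dx (s1 i) (s2 i)) (pdM i Dx a (smooth_on_pd i a)) (pdM i Dx b (smooth_on_pd i b)).
  have K (u du ddu v dv ddv : R) : 2 * (du * du + u * ddu + (dv * dv + v * ddv))
      = 2 * (du ^+ 2 + dv ^+ 2 + u * ddu + v * ddv) by ring.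
  exact: K.
have CR y : D y -> pd 0 (re_part f) y = pd 1 (im_part f) y /\ pd 1 (re_part f) y = - pd 0 (im_part f) y.
  move=> Dy; have [c0 c1] := holomorphic_cpd hf Dy.
  have E : cpd 1 f y = 'i * cpd 0 f y by rewrite c1 c0.
  have := congr1 (@complex.Re R) E; have := congr1 (@complex.Im R) E; rewrite Re_cM Im_cM /=.
  by rewrite !mul0r !mul1r sub0r add0r => -> ->.
have L0 : pd 0 (pd 0 (re_part f)) x + pd 1 (pd 1 (re_part f)) x = 0.
  rewrite (pd_eq_on (g := pd 1 (im_part f)) 0 oD Dx); last by move=> y /CR[].
  rewrite (pd_eq_on (g := fun y => - pd 0 (im_part f) y) 1 oD Dx); last by move=> y /CR[].
  by rewrite (pdN 1 Dx (smooth_on_pd 0 b)) (pd_sym 1 0 oD Dx b) subrr.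
have L1 : pd 0 (pd 0 (im_part f)) x + pd 1 (pd 1 (im_part f)) x = 0.
  rewrite (pd_eq_on (f := pd 1 (im_part f)) (g := pd 0 (re_part f)) 1 oD Dx); last by move=> y /CR[].
  rewrite (pd_eq_on (f := pd 0 (im_part f)) (g := fun y => - pd 1 (re_part f) y) 0 oD Dx); last first.
    by move=> y /CR[_ ->]; rewrite opprK.
  by rewrite (pdN 0 Dx (smooth_on_pd 1 a)) (pd_sym 1 0 oD Dx a) addNr.
rewrite sum_ord2 !d2.
have K (u u0 u1 u00 u11 v v0 v1 v00 v11 : R) : u00 + u11 = 0 -> v00 + v11 = 0 ->
    0 <= 2 * (u0 ^+ 2 + v0 ^+ 2 + u * u00 + v * v00) + 2 * (u1 ^+ 2 + v1 ^+ 2 + u * u11 + v * v11).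
  move=> Eu Ev.
  have -> : 2 * (u0 ^+ 2 + v0 ^+ 2 + u * u00 + v * v00) + 2 * (u1 ^+ 2 + v1 ^+ 2 + u * u11 + v * v11)
    = 2 * (u0 ^+ 2 + v0 ^+ 2 + u1 ^+ 2 + v1 ^+ 2 + u * (u00 + u11) + v * (v00 + v11)) by ring.
  by rewrite Eu Ev !mulr0 !addr0 mulr_ge0// !addr_ge0// sqr_ge0.
exact: K L0 L1.
Qed.

Lemma laplacian_csq_zcoord p x :
  \sum_i pd i (pd i (fun x => csq (zcoord p x) : R^o)) x = 4.
Proof.
have s j : smooth_on setT (fun x => coordf j x - p 0 j).
  by apply: smooth_onB; [exact: openT|exact: smooth_on_coordf|exact: smooth_on_cst].
have d i j y : pd i (fun x => coordf j x - p 0 j) y = (i == j)%:R.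
  rewrite (pdB i (I : setT y) (@smooth_on_coordf R setT j) (@smooth_on_cst R R^o setT (p 0 j))).
  by rewrite pd_coordf pd_cst subr0.
have d1 i y : pd i (fun x => csq (zcoord p x) : R^o) y = 2 * (coordf i y - p 0 i).
  rewrite [LHS](pdD i (I : setT y) (smooth_onM openT (s 0) (s 0)) (smooth_onM openT (s 1) (s 1))).
  rewrite (pdM i (I : setT y) (s 0) (s 0)) (pdM i (I : setT y) (s 1) (s 1)) !d.
  by case: (ord2P i) => -> /=; ring.
have d2 i : pd i (pd i (fun x => csq (zcoord p x) : R^o)) x = 2.
  rewrite (pd_eq_on (g := fun y => 2 * (coordf i y - p 0 i) : R^o) i openT (I : setT x)); last by [].
  rewrite (pdM i (I : setT x) (@smooth_on_cst R R^o setT 2) (s i)) pd_cst mul0r add0r d eqxx mulr1.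
  by [].
by rewrite sum_ord2 !d2; ring.
Qed.

Lemma csq0 : csq (0 : R[i]) = 0.
Proof. by rewrite /csq/= mul0r addr0. Qed.

Lemma smooth_on_csq_zcoord U p : open U -> smooth_on U (fun x => csq (zcoord p x) : R^o).
Proof.
move=> oU; have [a b] := @csmooth_zcoord R U p.
exact: smooth_onD oU (smooth_onM oU a a) (smooth_onM oU b b).
Qed.

Lemma open_punctured D p : open D -> open (D `&` [set x | x != p]).
Proof.
move=> oD; have -> : D `&` [set x | x != p]
    = D `&` (fun x => csq (zcoord p x) : R^o) @^-1` [set t | t != 0].
  by congr (_ `&` _); apply/seteqP; split=> x /=; rewrite csq_eq0 zcoord_eq0.
apply: (openI_preimage oD); first exact: open_neq.
by move=> x _; exact: smooth_on_continuous (smooth_on_csq_zcoord p openT) I.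
Qed.

Lemma closed_csq_le p (r : R) : closed [set x | csq (zcoord p x) <= r].
Proof.
have s : smooth_on setT (fun x => csq (zcoord p x) : R^o).
  by have [a b] := @csmooth_zcoord R setT p; exact: smooth_onD openT (smooth_onM openT a a) (smooth_onM openT b b).
apply: (@closed_comp _ R^o (fun x => csq (zcoord p x) : R^o) [set t | t <= r]).
  by move=> x _; exact: smooth_on_continuous s I.
exact: closed_le.
Qed.

Lemma compact_csq_le p (r : R) : compact [set x | csq (zcoord p x) <= r].
Proof.
apply: bounded_closed_compact; last exact: closed_csq_le.
exists (`|p| + (1 + `|r|)); split; first exact: num_real.
move=> M HM x Hx; apply: ltW; apply: le_lt_trans HM.
have -> : x = p + (x - p) by rewrite addrC subrK.
apply: le_trans (ler_normD _ _) _; rewrite lerD2l.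
apply: norm_le_coord => [|j]; first by rewrite addr_ge0.
have H : (x 0 j - p 0 j) ^+ 2 <= `|r|.
  apply: le_trans (ler_norm r); apply: le_trans Hx; rewrite /csq/= expr2.
  by case: (ord2P j) => ->; rewrite ?lerDl ?lerDr -expr2 sqr_ge0.
rewrite !mxE; move: H; rewrite -real_normK ?num_real//.
move: (`|x 0 j - p 0 j|) (normr_ge0 (x 0 j - p 0 j)) (`|r|) (normr_ge0 r) => u u0 s s0.
by rewrite expr2; nra.
Qed.

(* The maximum principle is applied to |f / z^m|^2 + e |z|^2, which is strictly
   subharmonic off [p] and vanishes at [p]. *)
Lemma flat_bound D f p (rho M e : R) m : open D -> holomorphic_on D f ->
  0 < rho -> 0 < e -> [set x | csq (zcoord p x) <= rho] `<=` D ->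
  clim p^' (fun x => f x / zcoord p x ^+ m) 0 ->
  (forall x, csq (zcoord p x) <= rho -> csq (f x) <= M) ->
  forall x, csq (zcoord p x) <= rho -> x != p ->
    csq (f x / zcoord p x ^+ m) <= M / rho ^+ m + e * rho.
Proof.
move=> oD hf rho0 e0 KD cf Mf.
pose F x := f x / zcoord p x ^+ m.
pose K := [set x | csq (zcoord p x) <= rho].
pose u : pt -> R^o := fun x => csq (F x) + e * csq (zcoord p x).
(* The value 0 at [p] is the continuous extension of [u], by the hypothesis on the limit of
   [f / z^m]; it lets the maximum be taken over the whole compact disc. *)
pose v : pt -> R^o := fun x => if x == p then 0 else u x.
pose D' := D `&` [set x | x != p].
have oD' : open D' by exact: open_punctured.
have z0 x : D' x -> zcoord p x != 0 by move=> [_]; rewrite /= zcoord_eq0.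
have hF : holomorphic_on D' F.
  apply: holomorphicM => //; first by apply: holomorphic_sub hf => x [].
  apply: holomorphicV => // [x /z0 zx|]; first by rewrite expf_neq0.
  by apply: holomorphicX => //; exact: holomorphic_zcoord.
have scsq (U : set pt) (h : pt -> R[i]) : open U -> csmooth U h -> smooth_on U (fun x => csq (h x) : R^o).
  by move=> oU [a b]; exact: smooth_onD oU (smooth_onM oU a a) (smooth_onM oU b b).
have sF : smooth_on D' (fun x => csq (F x) : R^o).
  by apply: scsq => //; have /holomorphicP[] := hF.
have sz (U : set pt) : open U -> smooth_on U (fun x => csq (zcoord p x) : R^o).
  by move=> oU; apply: scsq => //; exact: csmooth_zcoord.
have sez (U : set pt) : open U -> smooth_on U (fun x => e * csq (zcoord p x) : R^o).
  by move=> oU; apply: smooth_onM => //; [exact: smooth_on_cst|exact: sz].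
have su : smooth_on D' u by apply: smooth_onD => //; exact: sez.
have Kp : K p by rewrite /K/= /csq/= !subrr !mulr0 addr0 ltW.
have vc x : K x -> {for x, continuous v}.
  move=> Kx; have [->|xp] := eqVneq x p.
    apply: continuous_atP => d d0; rewrite /v eqxx.
    have d2 : 0 < d / 2 / 2 by rewrite !divr_gt0.
    have c1 : {for p, continuous (fun x => e * csq (zcoord p x) : R^o)}.
      exact: smooth_on_continuous (sez _ openT) I.
    have n1 : \forall x \near p, `|0 - e * csq (zcoord p x)| <= d / 2 / 2.
      have E0 : e * csq (zcoord p p) = 0 by rewrite /csq/= !subrr !mulr0 addr0 mulr0.
      by move/cvgrPdist_le : c1 => /(_ _ d2); rewrite E0.
    have n2 : nbhs p (fun x => x != p -> csq (F x) <= d / 2 / 2).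
      by have /clim0P/(_ _ d2) := cf.
    apply: filterS2 n1 n2 => y h1 h2; case: eqVneq => [_|yp].
      by rewrite subrr normr0.
    have A0 : 0 <= e * csq (zcoord p y) by rewrite mulr_ge0 ?csq_ge0// ltW.
    have A1 : 0 <= u y by rewrite addr_ge0 ?csq_ge0.
    have := h2 yp; move: h1; rewrite !sub0r !normrN (ger0_norm A0) (ger0_norm A1) /u.
    move: (csq (F y)) (e * csq (zcoord p y)) d0 => a b {}d0; lra.
  have : {for x, continuous u} by apply: smooth_on_continuous su _; split; [exact: KD|].
  apply: near_continuous.
  have : \forall y \near x, D' y by apply: open_nbhs_nbhs; split=> //; split=> //; exact: KD.
  by apply: filterS => y [_ yp]; rewrite /v (negbTE yp).
have [|//|c] := @EVT_max_rV R 2 v K _ (@compact_csq_le p rho).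
- by exists p.
- by apply: continuous_in_subspaceT => x; rewrite inE; exact: vc.
rewrite inE => Kc cmax.
have vcB : v c <= M / rho ^+ m + e * rho.
  have M0 : 0 <= M by apply: le_trans (csq_ge0 (f p)) (Mf p Kp).
  have B0 : 0 <= M / rho ^+ m + e * rho.
    by rewrite addr_ge0// ?mulr_ge0 ?invr_ge0 ?exprn_ge0// ltW.
  rewrite /v; case: eqVneq => [//|cp].
  (* On the boundary circle the bound is [|f|^2 <= M]. At an interior maximum the Laplacian of [u]
     would be at least [4 e], against [pd2_at_max]. *)
  have [lt|ge] := ltP (csq (zcoord p c)) rho; last first.
    have E : csq (zcoord p c) = rho by apply/eqP; rewrite eq_le ge Kc.
    rewrite /u E lerD2r; have zc : zcoord p c != 0 by rewrite zcoord_eq0.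
    rewrite ler_pdivlMr ?exprn_gt0// -E -csqX -csqM divfK ?expf_neq0//.
    exact: Mf.
  pose D2 := D' `&` [set x | csq (zcoord p x) < rho].
  have oD2 : open D2.
    apply: (@openI_preimage _ R^o D' [set t | t < rho] (fun x => csq (zcoord p x) : R^o) oD').
      exact: open_lt.
    by move=> x _; exact: smooth_on_continuous (sz _ openT) I.
  have D2c : D2 c by split=> //; split=> //; exact: KD.
  have su2 : smooth_on D2 u by apply: smooth_on_sub su => x [].
  have umax x : D2 x -> u x <= u c.
    move=> [[Dx xp] xr]; have := cmax x; rewrite /v (negbTE xp) (negbTE cp); apply.
    by rewrite inE /K/= ltW.
  have L i := pd2_at_max i oD2 D2c su2 umax.
  have D'c : D' c by case: D2c.
  have d1 i y : D' y -> pd i u y = pd i (fun x => csq (F x) : R^o) y + e * pd i (fun x => csq (zcoord p x) : R^o) y.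
    move=> Dy; rewrite [LHS](pdD i Dy sF (sez _ oD')).
    by rewrite (pdM i Dy (@smooth_on_cst R R^o D' e) (sz _ oD')) pd_cst mul0r add0r.
  have d2 i : pd i (pd i u) c = pd i (pd i (fun x => csq (F x) : R^o)) c
      + e * pd i (pd i (fun x => csq (zcoord p x) : R^o)) c.
    rewrite (pd_eq_on i oD' D'c (d1 i)).
    have s2 := smooth_on_pd i (sz _ oD'); have se := @smooth_on_cst R R^o D' e.
    rewrite (pdD i D'c (smooth_on_pd i sF) (smooth_onM oD' se s2)).
    by rewrite (pdM i D'c se s2) pd_cst mul0r add0r.
  have E1 := laplacian_csq_zcoord p c; rewrite sum_ord2 in E1.
  have E2 := laplacian_csq oD' D'c hF; rewrite sum_ord2 in E2.
  have E3 := lerD (L 0) (L 1); rewrite (d2 0) (d2 1) addr0 in E3.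
  suff KK (A B a b : R) : a + b = 4 -> 0 <= A + B -> A + e * a + (B + e * b) <= 0 -> False.
    by exfalso; exact: KK E1 E2 E3.
  move=> Eab AB; rewrite leNgt => /negP; case.
  have -> : A + e * a + (B + e * b) = A + B + e * (a + b) by ring.
  by rewrite Eab ltr_wpDl// mulr_gt0.
move=> x Kx xp; have : v x <= v c by apply: cmax; rewrite inE.
move=> /le_trans/(_ vcB); rewrite /v (negbTE xp); apply: le_trans.
by rewrite lerDl mulr_ge0 ?csq_ge0// ltW.
Qed.

(** Letting [e] tend to 0 in [flat_bound] leaves [|f|^2 <= M (|z|^2 / rho)^m] for every [m]; for
    [|z|^2 < rho] the right side tends to 0 as [m] grows. *)
Lemma holomorphic_flat D f p : open D -> D p -> holomorphic_on D f ->
  (forall k, iter k (@ddz R) f p = 0) -> \forall x \near p, f x = 0.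
Proof.
move=> oD Dp hf flat.
have /nbhs_ballP[d /= d0 dD] := open_nbhs_nbhs (conj oD Dp).
(* [rho] is compared with a squared modulus: the disc of radius [d / 2] lies in the ball of radius
   [d] for the maximum norm. *)
pose rho := (d / 2) ^+ 2.
have rho0 : 0 < rho by rewrite exprn_gt0// divr_gt0.
have KD : [set x | csq (zcoord p x) <= rho] `<=` D.
  move=> x /= H; apply: dD; apply/ball_rVE => // j.
  have Hj : (x 0 j - p 0 j) ^+ 2 <= rho.
    apply: le_trans H; rewrite /csq/= expr2.
    by case: (ord2P j) => ->; rewrite ?lerDl ?lerDr -expr2 sqr_ge0.
  move: Hj; rewrite distrC /rho -[(x 0 j - p 0 j) ^+ 2]real_normK ?num_real//.
  move: (`|x 0 j - p 0 j|) (normr_ge0 (x 0 j - p 0 j)) => u u0.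
  rewrite ler_pXn2r ?nnegrE ?divr_ge0 ?(ltW d0)// => /le_lt_trans; apply.
  by rewrite ltr_pdivrMr// mulr_natr mulr2n ltrDl.
have [M HM] : exists M, forall x, csq (zcoord p x) <= rho -> csq (f x) <= M.
  have [||c _ cmax] := @EVT_max_rV R 2 (fun x => csq (f x)) _ _ (@compact_csq_le p rho).
  - by exists p; rewrite /= /csq/= !subrr !mulr0 addr0 ltW.
  - apply: continuous_in_subspaceT => x; rewrite inE => Kx.
    have /holomorphicP[[a b] _] := hf.
    exact: smooth_on_continuous (smooth_onD oD (smooth_onM oD a a) (smooth_onM oD b b)) (KD x Kx).
  by exists (csq (f c)) => x Hx; apply: cmax; rewrite inE.
have fp : f p = 0 by exact: (flat 0%N).
have H m x : csq (zcoord p x) <= rho -> csq (f x) <= M * (csq (zcoord p x) / rho) ^+ m.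
  move=> Kx; have [->|xp] := eqVneq x p.
    have zp : zcoord p p = 0 by apply/eqP; rewrite zcoord_eq0.
    rewrite fp csq0 zp csq0 mul0r mulr_ge0 ?exprn_ge0//.
    by apply: le_trans (csq_ge0 (f p)) (HM p _); rewrite zp csq0 ltW.
  have cf : clim p^' (fun x => f x / zcoord p x ^+ m) 0.
    have := @holomorphic_taylor R D f p m oD Dp hf (fun k _ => flat k).
    by rewrite flat mul0r.
  have zx : csq (zcoord p x) ^+ m != 0 by rewrite expf_neq0// csq_eq0 zcoord_eq0.
  have Hle : csq (f x / zcoord p x ^+ m) <= M / rho ^+ m.
    apply/ler_addgt0Pr => e e0.
    have := @flat_bound D f p rho M (e / rho) m oD hf rho0 (divr_gt0 e0 rho0) KD cf HM x Kx xp.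
    by rewrite divfK// gt_eqF.
  have zc0 : zcoord p x ^+ m != 0 by rewrite expf_neq0// zcoord_eq0.
  rewrite -[f x](divfK zc0) csqM csqX exprMn exprVn mulrCA mulrA.
  by rewrite [_ * M]mulrC [leRHS]mulrAC ler_wpM2r// exprn_ge0// csq_ge0.
have : \forall x \near p, csq (zcoord p x) < rho.
  have s : smooth_on setT (fun x => csq (zcoord p x) : R^o).
    by have [a b] := @csmooth_zcoord R setT p; exact: smooth_onD openT (smooth_onM openT a a) (smooth_onM openT b b).
  have c : {for p, continuous (fun x => csq (zcoord p x) : R^o)} := smooth_on_continuous s I.
  by apply: (cvgr_lt _ c); rewrite /csq/= !subrr !mulr0 addr0.
apply: filterS => x xr; apply/eqP; rewrite -csq_eq0 eq_le csq_ge0 andbT.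
set t := csq (zcoord p x) / rho.
have t01 : `|t| < 1.
  by rewrite ger0_norm ?divr_ge0 ?csq_ge0 ?(ltW rho0)// ltr_pdivrMr// mul1r.
have c0 : M * t ^+ m @[m --> \oo] --> (0 : R).
  by rewrite -[X in _ --> X](mulr0 M); apply: cvgM; [exact: cvg_cst|exact: cvg_expr].
by apply: (cvgr_to_ge c0); apply: nearW => m; apply: H; exact: ltW.
Qed.
End maximum_principle.

(** * The entropy differentials at a zero of the Hopf differential *)

Section leading_terms.
Context {R : realType}.
Local Notation pt := 'rV[R]_2.
Variables (D : set pt) (p : pt).
Hypotheses (oD : open D) (Dp : D p).
Implicit Types (F G f : pt -> R[i]) (k l : int) (c d : R[i]).
Let D' := D `&` [set x | x != p].
Let z := zcoord p.

(** The formal derivative of [c z^-k] is [- k c z^(-k-1)], whence the recursion. The coefficient [c]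
    may be 0; the condition then says that [F] is of smaller order than [z^-k]. *)
Fixpoint lead (N : nat) k c F : Prop :=
  clim p^' (fun x => z x ^ k * F x) c /\
  (if N is N'.+1 then lead N' (k + 1) (- k%:~R * c) (ddz F) else True).

(* [F ~ c z^(-k)] at [p], and this expansion may be differentiated termwise. *)
Definition leads k c F := csmooth D' F /\ forall N, lead N k c F.

Lemma open_D' : open D'.
Proof. exact: open_punctured. Qed.
Let oD' := open_D'.

Lemma dclim_unique F c d : clim p^' F c -> clim p^' F d -> c = d.
Proof. exact: clim_unique. Qed.
Lemma dclimD F G c d : clim p^' F c -> clim p^' G d -> clim p^' (fun x => F x + G x) (c + d).
Proof. exact: climD. Qed.
Lemma dclimM F G c d : clim p^' F c -> clim p^' G d -> clim p^' (fun x => F x * G x) (c * d).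
Proof. exact: climM. Qed.
Lemma dclimV F c : c != 0 -> clim p^' F c -> clim p^' (fun x => (F x)^-1) c^-1.
Proof. exact: climV. Qed.
Lemma dclim_near F G c : (\forall x \near p^', F x = G x) -> clim p^' F c -> clim p^' G c.
Proof. exact: clim_near. Qed.

Lemma near_D' : \forall x \near p^', D' x.
Proof.
have : nbhs p D by exact: open_nbhs_nbhs.
by apply: filterS => x Dx xp; split.
Qed.

Lemma z_neq0 x : D' x -> z x != 0.
Proof. by move=> [_]; rewrite /= zcoord_eq0. Qed.

Lemma lead_eq N k c F G : (forall x, D' x -> F x = G x) -> lead N k c F -> lead N k c G.
Proof.
elim: N k c F G => [|N IH] k c F G FG /= [cF H]; split=> //.
- by apply: dclim_near cF; apply: filterS near_D' => x Dx; rewrite FG.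
- by apply: dclim_near cF; apply: filterS near_D' => x Dx; rewrite FG.
- by apply: IH H => x Dx; exact: cdir_eq oD' Dx FG.
Qed.

Lemma leads_eq k c F G : (forall x, D' x -> F x = G x) -> leads k c F -> leads k c G.
Proof. by move=> FG [sF H]; split=> [|N]; [exact: csmooth_eq FG sF|exact: lead_eq FG (H N)]. Qed.

Lemma leads_lim k c F : leads k c F -> clim p^' (fun x => z x ^ k * F x) c.
Proof. by move=> [_ /(_ 0%N)[]]. Qed.

Lemma leads_ddz k c F : leads k c F -> leads (k + 1) (- k%:~R * c) (ddz F).
Proof. by move=> [sF H]; split=> [|N]; [exact: csmooth_ddz|have [] := H N.+1]. Qed.

Lemma leadS N k c F : lead N.+1 k c F -> lead N k c F.
Proof. by elim: N k c F => [|N IH] k c F [cF H]; split=> //; exact: IH. Qed.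

Lemma leadD N k c d F G : csmooth D' F -> csmooth D' G ->
  lead N k c F -> lead N k d G -> lead N k (c + d) (fun x => F x + G x).
Proof.
elim: N k c d F G => [|N IH] k c d F G sF sG [cF HF] [cG HG].
  split=> //; have H := dclimD cF cG; apply: dclim_near H; apply: nearW => x.
  by rewrite mulrDr.
split; first by have H := dclimD cF cG; apply: dclim_near H; apply: nearW => x; rewrite mulrDr.
rewrite mulrDr; apply: (@lead_eq _ _ _ (fun x => ddz F x + ddz G x)).
  by move=> x Dx; rewrite [RHS](cdirD _ Dx sF sG).
by apply: IH => //; exact: csmooth_ddz.
Qed.

Lemma leadM N k l c d F G : csmooth D' F -> csmooth D' G ->
  lead N k c F -> lead N l d G -> lead N (k + l) (c * d) (fun x => F x * G x).
Proof.
have L k' l' c' d' F' G' : clim p^' (fun x => z x ^ k' * F' x) c' ->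
    clim p^' (fun x => z x ^ l' * G' x) d' ->
    clim p^' (fun x => z x ^ (k' + l') * (F' x * G' x)) (c' * d').
  move=> cF cG; have H := dclimM cF cG; apply: dclim_near H; apply: filterS near_D' => x Dx.
  by rewrite expfzDr ?z_neq0//; ring.
elim: N k l c d F G => [|N IH] k l c d F G sF sG HF HG.
  by split=> //; apply: L; [case: HF|case: HG].
split; first by apply: L; [case: HF|case: HG].
apply: (@lead_eq _ _ _ (fun x => ddz F x * G x + F x * ddz G x)).
  by move=> x Dx; rewrite [RHS](cdirM _ oD' Dx sF sG).
have -> : - (k + l)%:~R * (c * d) = (- k%:~R * c) * d + c * (- l%:~R * d).
  by rewrite rmorphD/=; ring.
have sdF := csmooth_ddz oD' sF; have sdG := csmooth_ddz oD' sG.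
apply: leadD; [exact: csmoothM|exact: csmoothM| |].
  by rewrite addrAC; apply: IH => //; [case: HF|exact: leadS].
by rewrite -addrA; apply: IH => //; [exact: leadS|case: HG].
Qed.

Lemma lead0 N k : lead N k 0 (fun _ => 0).
Proof.
elim: N k => [|N IH] k; (split; first by apply: dclim_near (clim_cst 0); apply: nearW => x; rewrite mulr0) => //.
rewrite mulr0; apply: (@lead_eq _ _ _ (fun _ => 0)) => // x _.
by rewrite [RHS]cdir_cst.
Qed.

Lemma leads_cst c : leads 0 c (fun _ => c).
Proof.
split=> [|N]; first exact: csmooth_cst.
have L : clim p^' (fun x => z x ^ 0 * c) c.
  by apply: dclim_near (clim_cst c); apply: nearW => x; rewrite expr0z mul1r.
case: N => [|N]; split=> //.
rewrite mulr0z oppr0 mul0r; apply: (@lead_eq _ _ _ (fun _ => 0)); last exact: lead0.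
by move=> x _; rewrite [RHS]cdir_cst.
Qed.

Lemma leadsD k c d F G : leads k c F -> leads k d G -> leads k (c + d) (fun x => F x + G x).
Proof.
by move=> [sF HF] [sG HG]; split=> [|N]; [exact: csmoothD|exact: leadD].
Qed.

Lemma leadsM k l c d F G : leads k c F -> leads l d G ->
  leads (k + l) (c * d) (fun x => F x * G x).
Proof.
by move=> [sF HF] [sG HG]; split=> [|N]; [exact: csmoothM|exact: leadM].
Qed.

Lemma leadsZ k a c F : leads k c F -> leads k (a * c) (fun x => a * F x).
Proof. by move=> H; have := leadsM (leads_cst a) H; rewrite add0r. Qed.

Lemma leadsN k c F : leads k c F -> leads k (- c) (fun x => - F x).
Proof.
move=> /(leadsZ (-1)); rewrite mulN1r; apply: leads_eq => x _; exact: mulN1r.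
Qed.

Lemma leadsB k c d F G : leads k c F -> leads k d G -> leads k (c - d) (fun x => F x - G x).
Proof. by move=> HF HG; apply: leadsD => //; exact: leadsN. Qed.

(** The derivative of [1/F] is a product of [F'] and two factors [1/F], needed only to one
    derivative less, so the product rule closes the induction on [N]. *)
Lemma leadsV k c F : c != 0 -> (forall x, D' x -> F x != 0) -> leads k c F ->
  leads (- k) c^-1 (fun x => (F x)^-1).
Proof.
move=> c0 F0 [sF HF]; have sV := csmoothV oD' F0 sF; split=> // N.
have L : clim p^' (fun x => z x ^ (- k) * (F x)^-1) c^-1.
  have H := dclimV c0 (HF 0%N).1; apply: dclim_near H; apply: nearW => x.
  by rewrite invfM -invr_expz.
elim: N => [|N IH]; split=> //.
apply: (@lead_eq _ _ _ (fun x => -1 * ddz F x * ((F x)^-1 * (F x)^-1))).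
  move=> x Dx; rewrite [RHS](cdirV _ oD' Dx F0 sF) -[cdir _ F x]/(ddz F x).
  by rewrite expr2 invfM; ring.
have -> : - (- k)%:~R * c^-1 = -1 * (- k%:~R * c) * (c^-1 * c^-1) by rewrite mulrNz; field.
have -> : - k + 1 = 0 + (k + 1) + (- k + - k) by ring.
have sdF := csmooth_ddz oD' sF; have s1 := csmooth_cst D' (-1).
apply: leadM; [exact: csmoothM|exact: csmoothM| |].
  apply: leadM => //; last by have [] := HF N.+1.
  by have [_] := leads_cst (-1).
exact: leadM.
Qed.

(** A function smooth across [p] is negligible against [z^-(k+1)], and so are its derivatives at
    each later stage. This is how the factor [W], which is only assumed smooth, is handled. *)
Lemma lead_pos N (k : nat) F : csmooth D F -> lead N k.+1%:Z 0 F.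
Proof.
elim: N k F => [|N IH] k F sF.
  split=> //; have c1 := clim_dnbhs (clim_continuous sF Dp).
  have c2 := clim_dnbhs (clim_continuous (csmoothX k.+1 openT (csmooth_zcoord setT p)) (I : setT p)).
  have /eqP zp : zcoord p p == 0 by rewrite zcoord_eq0.
  by have := dclimM c2 c1; rewrite zp expr0n/= mul0r.
split.
  have c1 := clim_dnbhs (clim_continuous sF Dp).
  have c2 := clim_dnbhs (clim_continuous (csmoothX k.+1 openT (csmooth_zcoord setT p)) (I : setT p)).
  have /eqP zp : zcoord p p == 0 by rewrite zcoord_eq0.
  by have := dclimM c2 c1; rewrite zp expr0n/= mul0r.
by rewrite mulr0 -[_ + 1]/((k.+1 + 1)%N%:Z) addn1; apply: IH; exact: csmooth_ddz.
Qed.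

Lemma leads_smooth F : csmooth D F -> leads 0 (F p) F.
Proof.
move=> sF; split=> [|N]; first by apply: csmooth_sub sF => x [].
have L : clim p^' (fun x => z x ^ 0 * F x) (F p).
  have c1 := clim_dnbhs (clim_continuous sF Dp).
  by apply: dclim_near c1; apply: nearW => x; rewrite expr0z mul1r.
case: N => [|N]; split=> //.
by rewrite mulr0z oppr0 mul0r add0r; apply: (@lead_pos N 0); exact: csmooth_ddz.
Qed.

(** Differentiation lowers by one the order up to which derivatives vanish at [p], so the Taylor
    limit applies again to [ddz f]. After [m] steps the predicted coefficient is 0 and [lead_pos]
    takes over. *)
Lemma leads_holomorphic m f : holomorphic_on D f ->
  (forall j, (j < m)%N -> iter j (@ddz R) f p = 0) ->
  leads (- m%:Z) (iter m (@ddz R) f p / m`!%:R) f.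
Proof.
move=> hf H; have /holomorphicP[sf _] := hf.
split=> [|N]; first by apply: csmooth_sub sf => x [].
elim: N m f hf sf H => [|N IH] m f hf sf H.
  split=> //; have := holomorphic_taylor oD Dp hf H; apply: dclim_near; apply: nearW => x.
  by rewrite mulrC -invr_expz.
split.
  have := holomorphic_taylor oD Dp hf H; apply: dclim_near; apply: nearW => x.
  by rewrite mulrC -invr_expz.
case: m H => [|m] H.
  rewrite oppr0 mulr0z oppr0 mul0r add0r; apply: (@lead_pos N 0); exact: csmooth_ddz.
have -> : - m.+1%:Z + 1 = - m%:Z by rewrite -addn1 PoszD opprD addrNK.
have -> : - (- m.+1%:Z)%:~R * (iter m.+1 (@ddz R) f p / m.+1`!%:R)
    = iter m (@ddz R) (ddz f) p / m`!%:R.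
  rewrite mulrNz opprK -iterSr factS natrM invfM mulrCA [m.+1%:R^-1 * _]mulrC.
  have -> : m.+1%:Z%:~R = m.+1%:R :> R[i] by [].
  by congr (_ * _); rewrite mulrCA mulfV ?mulr1// pnatr_eq0.
apply: IH; [exact: holomorphic_ddz|exact: csmooth_ddz|].
by move=> k km; rewrite -iterSr; exact: H.
Qed.

Lemma leads_cast k l c d F : k = l -> c = d -> leads k c F -> leads l d F.
Proof. by move=> -> ->. Qed.

Section entropies_at_zero.
Variables (q W gamma : pt -> R[i]) (f : pt -> riemann_sphere R) (m : nat).
Hypotheses (hq : holomorphic_on D q) (sW : csmooth D W).
Hypothesis qlow : forall j, (j < m)%N -> iter j (@ddz R) q p = 0.
Hypothesis qm : iter m (@ddz R) q p != 0.
Hypothesis q0 : forall x, D' x -> q x != 0.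
Hypothesis W0 : forall x, D x -> W x != 0.
Hypothesis gammaE : forall x, D' x -> gamma x = ddz q x / (2 * q x).
(** [h] plays the part of the derivative of the Gauss map in a projection that is finite near
    [p]. *)
Let h x := q x * W x.
Hypothesis fE : forall x, D' x ->
  schwarzian f x = ddz (ddz h) x / h x - 3 / 2 * (ddz h x / h x) ^+ 2.

Local Notation P := (nabla_schwarzian gamma f).
(** With [h ~ z^m] and [gamma ~ (m / 2) z^-1], the Schwarzian contributes [m (m - 1) - 3/2 m^2], the
    term [gamma^2 / 2] contributes [m^2 / 8], and [- gamma'] contributes [m / 2]. *)
Let c2 : R[i] := - (m%:R * (3 * m%:R + 4) / 8).

Let leads_h : exists2 a, a != 0 & leads (- m%:Z) a h.
Proof.
exists (iter m (@ddz R) q p / m`!%:R * W p).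
  by rewrite !mulf_neq0 ?invr_eq0 ?pnatr_eq0 -?lt0n ?fact_gt0// W0.
apply: (leads_cast _ erefl (leadsM (leads_holomorphic hq qlow) (leads_smooth sW))).
exact: addr0.
Qed.

Let leads_gamma : leads 1 (m%:R / 2) gamma.
Proof.
have Lq := leads_holomorphic hq qlow.
have a0 : iter m (@ddz R) q p / m`!%:R != 0.
  by rewrite mulf_neq0// invr_eq0 pnatr_eq0 -lt0n fact_gt0.
have L := leadsM (leads_ddz Lq) (leadsV a0 q0 Lq).
apply: (@leads_eq _ _ (fun x => 2^-1 * (ddz q x * (q x)^-1))).
  by move=> x Dx; rewrite gammaE// invfM; ring.
apply: leads_cast (leadsZ 2^-1 L); first by ring.
rewrite mulrNz opprK -pmulrn; move: (iter _ _ _ _ / _) a0 => a a0; field.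
exact: a0.
Qed.

Lemma leads_entropy2 : leads 2 c2 (P 0).
Proof.
have [a a0 Lh] := leads_h; have Lg := leads_gamma.
have h0 x : D' x -> h x != 0 by move=> Dx; rewrite mulf_neq0 ?q0 ?W0//; case: Dx.
have L1 := leads_ddz Lh; have L2 := leads_ddz L1; have LV := leadsV a0 h0 Lh.
have LA := leadsM L2 LV; have LB := leadsM L1 LV; have LC := leadsZ (3 / 2) (leadsM LB LB).
have LG := leadsZ 2^-1 (leadsM Lg Lg).
have e1 : - m%:Z + 1 + 1 - - m%:Z = 2 by ring.
have e2 : - m%:Z + 1 - - m%:Z + (- m%:Z + 1 - - m%:Z) = 2 by ring.
have e3 : 1 + 1 = 2 :> int by [].
have := leadsB (leadsD (leadsB (leads_cast e1 erefl LA) (leads_cast e2 erefl LC))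
  (leads_cast e3 erefl LG)) (leads_cast e3 erefl (leads_ddz Lg)).
move=> L; apply: (leads_eq _ (leads_cast erefl _ L)).
  by move=> x Dx; rewrite /= fE// !expr2.
rewrite !rmorphD !mulrNz -pmulrn /= rmorph1 /c2; field.
exact: a0.
Qed.

(** [P j] has degree [j + 2] as a differential, which is the multiple of [gamma] in the covariant
    derivative; [k] comes from differentiating [z^-k]. *)
Lemma leads_entropyS j (k : nat) c : leads k%:Z c (P j) ->
  leads k.+1%:Z (- (k%:R + (j + 2)%:R * (m%:R / 2)) * c) (P j.+1).
Proof.
move=> L; have e1 : k%:Z + 1 = k.+1%:Z by rewrite -PoszD addn1.
have e2 : 1 + k%:Z = k.+1%:Z by rewrite addrC.
have L2 := leadsZ (j + 2)%:R (leads_cast e2 erefl (leadsM leads_gamma L)).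
apply: (leads_eq _ (leads_cast erefl _ (leadsB (leads_cast e1 erefl (leads_ddz L)) L2))).
  by move=> x _; rewrite /= mulrA.
by rewrite -pmulrn; ring.
Qed.

Lemma entropy_ratio (a : R[i]) : (0 < m)%N -> (forall x, D' x -> P 3 x = a * (P 0 x * P 1 x)) ->
  a * (m%:R * (3 * m%:R + 4)) = - (24 * (m%:R + 2) ^+ 2).
Proof.
move=> m0 H.
have L2 := leads_entropy2; have L3 := @leads_entropyS 0 2 _ L2.
have L4 := @leads_entropyS 1 3 _ L3; have L5 := @leads_entropyS 2 4 _ L4.
have L23 := leadsZ a (leadsM L2 L3).
have E : forall x, D' x -> a * (P 0 x * P 1 x) = P 3 x by move=> x Dx; rewrite H.
have := dclim_unique (leads_lim (leads_eq E L23)) (leads_lim L5).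
have mC : m%:R != 0 :> R[i] by rewrite pnatr_eq0 -lt0n.
have pos (k : nat) : (k.+1%:R + m%:R : R[i]) != 0 by rewrite -natrD pnatr_eq0.
have c20 : c2 != 0.
  by rewrite /c2 oppr_eq0 !mulf_neq0 ?invr_eq0 ?(pnatr_eq0 _ 8)// -natrM -natrD pnatr_eq0 addnS.
have c30 : - (2 + (0 + 2)%:R * (m%:R / 2)) * c2 != 0.
  have -> : 2 + (0 + 2)%:R * (m%:R / 2) = 2%:R + m%:R :> R[i] by rewrite add0n; field.
  by rewrite mulf_neq0// oppr_eq0; exact: (pos 1%N).
move=> E2.
(* Both sides carry the leading coefficient of [P 1], nonzero because [m > 0], and it cancels. The
   two remaining factors [3 + 3 m / 2] and [4 + 2 m] multiply to [3 (m + 2)^2]. *)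
have E3 : a * c2 * (- (2 + (0 + 2)%:R * (m%:R / 2)) * c2)
   = (- (3 + (1 + 2)%:R * (m%:R / 2))) * (- (4 + (2 + 2)%:R * (m%:R / 2)))
      * (- (2 + (0 + 2)%:R * (m%:R / 2)) * c2).
  by rewrite -mulrA E2; ring.
have {}E3 := mulIf c30 E3.
have : a * (m%:R * (3 * m%:R + 4)) = - 8 * (a * c2) by rewrite /c2; field.
by move=> ->; rewrite E3; field.
Qed.

End entropies_at_zero.

End leading_terms.

(** * Fundamental forms and their reparametrization *)

Section euclidean_space.
Context {R : realType}.
Local Notation E3 := 'rV[R]_3.
Implicit Types (u v w a b n e : E3).

Lemma ord3P (j : 'I_3) : [\/ j = 0, j = 1 | j = 2].
Proof.
by case: j => -[|[|[|//]]] p; [constructor 1|constructor 2|constructor 3]; apply: val_inj.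
Qed.

Lemma rV3E u v : u 0 0 = v 0 0 -> u 0 1 = v 0 1 -> u 0 2 = v 0 2 -> u = v.
Proof. by move=> h0 h1 h2; apply/rowP => j; case: (ord3P j) => ->. Qed.

Lemma sum_ord3 (V : nmodType) (F : 'I_3 -> V) : \sum_j F j = F 0 + F 1 + F 2.
Proof.
rewrite !big_ord_recl big_ord0 addr0 addrA.
by congr (_ + F _ + F _); apply: val_inj.
Qed.

Lemma dotE u v : dot u v = u 0 0 * v 0 0 + u 0 1 * v 0 1 + u 0 2 * v 0 2.
Proof. by rewrite /dot mxE sum_ord3 !mxE. Qed.

Lemma cross0E u v : (cross u v) 0 0 = u 0 1 * v 0 2 - u 0 2 * v 0 1.
Proof. by rewrite mxE; congr (u 0 _ * v 0 _ - u 0 _ * v 0 _); apply: val_inj. Qed.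
Lemma cross1E u v : (cross u v) 0 1 = u 0 2 * v 0 0 - u 0 0 * v 0 2.
Proof. by rewrite mxE; congr (u 0 _ * v 0 _ - u 0 _ * v 0 _); apply: val_inj. Qed.
Lemma cross2E u v : (cross u v) 0 2 = u 0 0 * v 0 1 - u 0 1 * v 0 0.
Proof. by rewrite mxE; congr (u 0 _ * v 0 _ - u 0 _ * v 0 _); apply: val_inj. Qed.
Definition crossE := (cross0E, cross1E, cross2E).

Lemma dotC u v : dot u v = dot v u.
Proof. by rewrite !dotE; ring. Qed.

Lemma dotvv_ge0 u : 0 <= dot u u.
Proof. by rewrite dotE !addr_ge0// -expr2 sqr_ge0. Qed.

Lemma dotvv_eq0 u : (dot u u == 0) = (u == 0).
Proof.
apply/idP/eqP => [|->]; last by rewrite dotE !mxE mulr0 !addr0.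
rewrite dotE -!expr2 paddr_eq0 ?addr_ge0 ?sqr_ge0// paddr_eq0 ?sqr_ge0// !sqrf_eq0.
by move=> /andP[/andP[/eqP h0 /eqP h1] /eqP h2]; apply: rV3E; rewrite !mxE.
Qed.

Lemma dot_crossl u v : dot u (cross u v) = 0.
Proof. by rewrite dotE !crossE; ring. Qed.
Lemma dot_crossr u v : dot v (cross u v) = 0.
Proof. by rewrite dotE !crossE; ring. Qed.

Lemma lagrange_cross u v :
  dot (cross u v) (cross u v) = dot u u * dot v v - dot u v ^+ 2.
Proof. by rewrite !dotE !crossE; ring. Qed.

Lemma dotZl (c : R) u v : dot (c *: u) v = c * dot u v.
Proof. by rewrite !dotE !mxE; ring. Qed.
Lemma dotZr (c : R) u v : dot u (c *: v) = c * dot u v.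
Proof. by rewrite !dotE !mxE; ring. Qed.
Lemma dotDl u v w : dot (u + v) w = dot u w + dot v w.
Proof. by rewrite !dotE !mxE; ring. Qed.

(** Two triple product identities: [v x (a x b) = (v . b) a - (v . a) b] vanishes, and [|w|^2 v] is
    recovered from [w x (v x w)] and [w . v]. *)
Lemma orthogonal_frame_eq0 a b v : cross a b != 0 ->
  dot v a = 0 -> dot v b = 0 -> dot v (cross a b) = 0 -> v = 0.
Proof.
move=> w0 va vb vw; set w := cross a b in w0 vw.
have ww0 : dot w w != 0 by rewrite dotvv_eq0.
have cvw : cross v w = 0.
  have E k : (cross v w) 0 k = a 0 k * dot v b - b 0 k * dot v a.
    by case: (ord3P k) => ->; rewrite /w !dotE !crossE; ring.
  by apply/rowP => k; rewrite E va vb !mulr0 subr0 mxE.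
apply: (scalerI ww0); rewrite scaler0.
have -> : dot w w *: v = cross w (cross v w) + dot w v *: w.
  have E k : dot w w * v 0 k = (cross w (cross v w)) 0 k + dot w v * w 0 k.
    by case: (ord3P k) => ->; rewrite !dotE !crossE; ring.
  by apply/rowP => k; rewrite [LHS]mxE E [RHS]mxE [X in _ = _ + X]mxE.
rewrite cvw [dot w v]dotC vw scale0r addr0.
by apply: rV3E; rewrite !crossE !mxE; ring.
Qed.

Definition unit_normal (P : 'M[R]_(2, 3)) : E3 :=
  let w := cross (row 0 P) (row 1 P) in (Num.sqrt (dot w w))^-1 *: w.

Lemma cross_mulmx (J : 'M[R]_2) (P : 'M[R]_(2, 3)) :
  cross (row 0 (J *m P)) (row 1 (J *m P)) = \det J *: cross (row 0 P) (row 1 P).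
Proof.
rewrite det_mx22; apply/rowP => k; rewrite [RHS]mxE.
by case: (ord3P k) => ->; rewrite !crossE !mxE !sum_ord2; ring.
Qed.

Lemma unit_normal_mulmx (J : 'M[R]_2) (P : 'M[R]_(2, 3)) :
  0 < \det J -> unit_normal (J *m P) = unit_normal P.
Proof.
move=> J0; rewrite /unit_normal cross_mulmx dotZl dotZr mulrA -expr2.
rewrite sqrtrM ?sqr_ge0// sqrtr_sqr gtr0_norm// invfM scalerA mulrAC mulVf ?mul1r//.
exact: lt0r_neq0.
Qed.

Lemma det_mulmx_tr (P : 'M[R]_(2, 3)) :
  \det (P *m P^T) = dot (cross (row 0 P) (row 1 P)) (cross (row 0 P) (row 1 P)).
Proof. by rewrite det_mx22 dotE !crossE !mxE !sum_ord3 !mxE; ring. Qed.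

Lemma row_free_cross (P : 'M[R]_(2, 3)) : row_free P -> cross (row 0 P) (row 1 P) != 0.
Proof.
move=> rf; apply/negP => /eqP w0.
have [[k Pk]|P0] := pselect (exists k, P 0 k != 0 \/ P 1 k != 0); last first.
  have PE : P = 0.
    apply/matrixP => i k; rewrite mxE; apply/eqP/negP => /negP Pik; apply: P0; exists k.
    by case: (ord2P i) Pik => ->; [left|right].
  by move: rf; rewrite PE /row_free mxrank0.
have c i j : P 0 i * P 1 j = P 0 j * P 1 i.
  have h0 := congr1 (fun u : E3 => u 0 0) w0; have h1 := congr1 (fun u : E3 => u 0 1) w0.
  have h2 := congr1 (fun u : E3 => u 0 2) w0.
  rewrite !crossE !mxE in h0 h1 h2.
  by case: (ord3P i) (ord3P j) => -> [] ->; lra.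
(* A vanishing cross product means that all minors of [P] vanish, so this vector built from a
   nonzero column [k] is a nontrivial relation between the rows. *)
pose u : 'rV[R]_2 := \row_i (if i == 0 then P 1 k else - P 0 k).
have uP : u *m P = 0.
  by apply/rowP => j; rewrite !mxE sum_ord2 !mxE /= (mulrC (P 1 k)) (c j k); ring.
have /row_freeP[Q PQ] := rf.
have u0 : u = 0 by rewrite -[u]mulmx1 -PQ mulmxA uP mul0mx.
have u00 := congr1 (fun u : 'rV_2 => u 0 0) u0; have u01 := congr1 (fun u : 'rV_2 => u 0 1) u0.
rewrite !mxE /= in u00 u01.
by case: Pk => /eqP; apply; [apply/eqP; rewrite -oppr_eq0 u01|].
Qed.

End euclidean_space.

Section reparametrization.
Context {R : realType}.
Local Notation pt := 'rV[R]_2.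
Implicit Types (D E : set pt) (f : pt -> 'rV[R]_3) (tau : pt -> pt).

(** This and the next two definitions are [first_form], [gauss_map] and [second_form] for a map of
    the plane; at [f = local_rep X c] they agree with those by unfolding. They allow
    reparametrization by arbitrary maps, not only by charts. *)
Definition first_fundamental f (x : pt) : 'M[R]_2 :=
  \matrix_(i, j) dot (pd i f x) (pd j f x).
Definition normal_map f (x : pt) : 'rV[R]_3 :=
  let w := cross (pd 0 f x) (pd 1 f x) in (Num.sqrt (dot w w))^-1 *: w.
Definition second_fundamental f (x : pt) : 'M[R]_2 :=
  \matrix_(i, j) (- dot (pd i (normal_map f) x) (pd j f x)).

Lemma first_fundamentalE f x : first_fundamental f x = partials f x *m (partials f x)^T.
Proof.
apply/matrixP => i j; rewrite !mxE /dot !mxE; apply: eq_bigr => k _; rewrite !mxE.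
by [].
Qed.

Lemma second_fundamentalE f x :
  second_fundamental f x = - (partials (normal_map f) x *m (partials f x)^T).
Proof.
apply/matrixP => i j; rewrite !mxE /dot !mxE; congr (- _); apply: eq_bigr => k _; rewrite !mxE.
by [].
Qed.

Lemma row_partials n (f : pt -> 'rV[R]_n.+1) x i : row i (partials f x) = pd i f x.
Proof. by rewrite /partials rowK. Qed.

Lemma normal_mapE f x : normal_map f x = unit_normal (partials f x).
Proof. by rewrite /unit_normal !row_partials. Qed.

Lemma partials_eq n D (f g : pt -> 'rV[R]_n.+1) x : open D -> D x ->
  (forall y, D y -> f y = g y) -> partials f x = partials g x.
Proof.
by move=> oD Dx fg; apply/matrixP => i j; rewrite !mxE (pd_eq_on i oD Dx fg).
Qed.

Lemma partials_comp n D E (f : pt -> 'rV[R]_n.+1) tau x : open D -> open E ->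
  D x -> E (tau x) -> smooth_on E f -> smooth_on D tau ->
  partials (fun y => f (tau y)) x = partials tau x *m partials f (tau x).
Proof.
move=> oD oE Dx Ex sf st; apply/matrixP => i k; rewrite !mxE.
have sfk := (smooth_on_rV _ oE).1 sf k.
have dk : derivable (fun y => f (tau y)) x (delta_mx 0 i).
  apply/derivable_mxP => a j; rewrite ord1.
  have [] := is_derive_comp2 oE Ex ((smooth_on_rV _ oE).1 sf j 1%N) (smooth_on_derivable (i := i) st Dx).
  by [].
rewrite /pd (derive_mx dk) mxE -/(pd i (fun y => f (tau y) 0 k : R^o) x).
rewrite (pd_comp i oD oE Dx Ex sfk st); apply: eq_bigr => j _.
by rewrite !mxE mulrC (pd_rV _ _ Ex sf).
Qed.

Lemma normal_map_comp D E f tau x : open D -> open E -> D x -> E (tau x) ->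
  smooth_on E f -> smooth_on D tau -> 0 < \det (partials tau x) ->
  normal_map (fun y => f (tau y)) x = normal_map f (tau x).
Proof.
move=> oD oE Dx Ex sf st J0.
by rewrite !normal_mapE (partials_comp oD oE Dx Ex sf st) unit_normal_mulmx.
Qed.

Lemma smooth_on_normal_map E f : open E -> smooth_on E f ->
  (forall x, E x -> cross (pd 0 f x) (pd 1 f x) != 0) -> smooth_on E (normal_map f).
Proof.
move=> oE sf w0.
have s i j : smooth_on E (fun x => pd i f x 0 j : R^o).
  exact: (smooth_on_rV _ oE).1 (smooth_on_pd i sf) j.
pose w x := cross (pd 0 f x) (pd 1 f x).
have sw k : smooth_on E (fun x => w x 0 k : R^o).
  have H i j : smooth_on E (fun x => pd 0 f x 0 i * pd 1 f x 0 j - pd 0 f x 0 j * pd 1 f x 0 i : R^o).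
    by apply: smooth_onB => //; apply: smooth_onM.
  by case: (ord3P k) => ->; [apply: smooth_on_eq oE _ (H 1 2)|apply: smooth_on_eq oE _ (H 2 0)|
    apply: smooth_on_eq oE _ (H 0 1)] => x _; rewrite /w crossE.
have sd : smooth_on E (fun x => dot (w x) (w x) : R^o).
  apply: smooth_on_eq oE _ (smooth_onD oE (smooth_onD oE (smooth_onM oE (sw 0) (sw 0))
    (smooth_onM oE (sw 1) (sw 1))) (smooth_onM oE (sw 2) (sw 2))).
  by move=> x _; rewrite dotE.
have d0 x : E x -> 0 < dot (w x) (w x).
  by move=> Ex; rewrite lt_def dotvv_ge0 dotvv_eq0 w0.
have ss : smooth_on E (fun x => Num.sqrt (dot (w x) (w x)) : R^o).
  by move=> k; apply: class_C_sqrt => //; exact: sd.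
have sV : smooth_on E (fun x => (Num.sqrt (dot (w x) (w x)))^-1 : R^o).
  by apply: smooth_onV => // x Ex; rewrite gt_eqF// sqrtr_gt0 d0.
apply/smooth_on_rV => // k; apply: smooth_on_eq oE _ (smooth_onM oE sV (sw k)).
by move=> x _; rewrite /normal_map /= [RHS]mxE.
Qed.

Lemma first_fundamental_comp D E f tau x : open D -> open E -> D x -> E (tau x) ->
  smooth_on E f -> smooth_on D tau ->
  first_fundamental (fun y => f (tau y)) x
  = partials tau x *m first_fundamental f (tau x) *m (partials tau x)^T.
Proof.
move=> oD oE Dx Ex sf st.
by rewrite !first_fundamentalE (partials_comp oD oE Dx Ex sf st) trmx_mul !mulmxA.
Qed.

Lemma second_fundamental_comp D E f tau x : open D -> open E -> D x ->
  (forall y, D y -> E (tau y)) -> smooth_on E f -> smooth_on D tau ->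
  (forall x, E x -> cross (pd 0 f x) (pd 1 f x) != 0) ->
  (forall y, D y -> 0 < \det (partials tau y)) ->
  second_fundamental (fun y => f (tau y)) x
  = partials tau x *m second_fundamental f (tau x) *m (partials tau x)^T.
Proof.
move=> oD oE Dx DE sf st w0 J0; have Ex := DE x Dx.
rewrite !second_fundamentalE (partials_comp oD oE Dx Ex sf st).
have E0 : partials (normal_map (fun y => f (tau y))) x
    = partials (fun y => normal_map f (tau y)) x.
  apply: (partials_eq oD Dx) => y Dy.
  exact: normal_map_comp oD oE Dy (DE y Dy) sf st (J0 y Dy).
have E1 := partials_comp oD oE Dx Ex (smooth_on_normal_map oE sf w0) st.
have K (J : 'M[R]_2) (N M P : 'M[R]_(2, 3)) : N = J *m M ->
    - (N *m (J *m P)^T) = J *m - (M *m P^T) *m J^T.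
  by move=> ->; rewrite trmx_mul mulmxN mulNmx !mulmxA.
exact: K (eq_trans E0 E1).
Qed.

End reparametrization.

Section vector_calculus.
Context {R : realType}.
Local Notation pt := 'rV[R]_2.
Local Notation E3 := 'rV[R]_3.
Implicit Types (D : set pt) (u v : pt -> E3) (x : pt).

Lemma smooth_on_dot D u v : open D -> smooth_on D u -> smooth_on D v ->
  smooth_on D (fun x => dot (u x) (v x) : R^o).
Proof.
move=> oD /(smooth_on_rV _ oD) su /(smooth_on_rV _ oD) sv.
have s k := smooth_onM oD (su k) (sv k).
apply: smooth_on_eq oD _ (smooth_onD oD (smooth_onD oD (s 0) (s 1)) (s 2)).
by move=> x _; rewrite dotE.
Qed.

Lemma pd_dot D u v i x : open D -> D x -> smooth_on D u -> smooth_on D v ->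
  pd i (fun x => dot (u x) (v x) : R^o) x = dot (pd i u x) (v x) + dot (u x) (pd i v x).
Proof.
move=> oD Dx su0 sv0; have su := (smooth_on_rV _ oD).1 su0; have sv := (smooth_on_rV _ oD).1 sv0.
have s k := smooth_onM oD (su k) (sv k).
transitivity (pd i (fun x => u x 0 0 * v x 0 0 + u x 0 1 * v x 0 1 + u x 0 2 * v x 0 2 : R^o) x).
  by congr (pd i _ x); apply/funext => y; rewrite dotE.
have t1 := pdD i Dx (smooth_onD oD (s 0) (s 1)) (s 2).
have t2 := pdD i Dx (s 0) (s 1).
have m0 := pdM i Dx (su 0) (sv 0); have m1 := pdM i Dx (su 1) (sv 1).
have m2 := pdM i Dx (su 2) (sv 2).
have pu k := pd_rV i k Dx su0; have pv k := pd_rV i k Dx sv0.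
have K (t a0 a1 a2 a01 : R) (u1 v1 u' v' : E3) (b c : 'I_3 -> R) :
  t = a01 + a2 -> a01 = a0 + a1 ->
  a0 = b 0 * v1 0 0 + u1 0 0 * c 0 -> a1 = b 1 * v1 0 1 + u1 0 1 * c 1 ->
  a2 = b 2 * v1 0 2 + u1 0 2 * c 2 -> (forall k, u' 0 k = b k) -> (forall k, v' 0 k = c k) ->
  t = dot u' v1 + dot u1 v'.
  by move=> -> -> -> -> -> bE cE; rewrite !dotE !bE !cE; ring.
exact: K t1 t2 m0 m1 m2 pu pv.
Qed.

Lemma pd_sym_rV D u i j x : open D -> D x -> smooth_on D u ->
  pd i (pd j u) x = pd j (pd i u) x.
Proof.
move=> oD Dx su; have sc := (smooth_on_rV _ oD).1 su.
apply/rowP => k.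
have e a b : pd a (pd b u) x 0 k = pd a (pd b (fun x => u x 0 k : R^o)) x.
  apply: etrans (pd_rV a k Dx (smooth_on_pd b su)) _.
  by apply: (pd_eq_on a oD Dx) => y Dy; exact: pd_rV Dy su.
by apply: etrans (e i j) _; apply: etrans _ (esym (e j i)); exact: pd_sym oD Dx (sc k).
Qed.

Lemma pd_cst_on D (V : normedModType R) (c : V) (g : pt -> V) i x : open D -> D x ->
  (forall y, D y -> g y = c) -> pd i g x = 0.
Proof. by move=> oD Dx gc; rewrite (pd_eq_on (g := fun _ => c) i oD Dx gc) pd_cst. Qed.

End vector_calculus.

(** * Minimal surfaces in isothermal coordinates *)

Section conformal_frame.
Context {R : realType}.
Local Notation E3 := 'rV[R]_3.
Variables (a b : E3) (E : R).
Hypotheses (E0 : 0 < E) (aa : dot a a = E) (bb : dot b b = E) (ab : dot a b = 0).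

(** [m] is tangent, hence equal to its expansion in the orthogonal tangent basis [a], [b] of equal
    lengths. *)
Lemma conformal_decomposition (m v : E3) : dot m (cross a b) = 0 ->
  dot m v = (dot m a * dot a v + dot m b * dot b v) / E.
Proof.
move=> mw; have w0 : cross a b != 0.
  by rewrite -dotvv_eq0 lagrange_cross aa bb ab expr0n subr0 mulf_neq0// gt_eqF.
have : E *: m - (dot m a *: a + dot m b *: b) = 0.
  apply: (orthogonal_frame_eq0 w0).
  - rewrite -scaleN1r dotDl dotZl dotZl dotDl !dotZl aa [dot b a]dotC ab; ring.
  - rewrite -scaleN1r dotDl dotZl dotZl dotDl !dotZl bb ab; ring.
  - by rewrite -scaleN1r dotDl dotZl dotZl dotDl !dotZl mw dot_crossl dot_crossr; ring.
move=> /eqP; rewrite subr_eq0 => /eqP e.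
have := dotZl E m v; rewrite e dotDl !dotZl => ->.
by rewrite mulrAC mulfV ?mul1r// gt_eqF.
Qed.

(** Here [mi] stands for a derivative of the normal and [fij] for a second derivative of the
    surface. The conclusion matches the terms of the Codazzi equations that the symmetry of mixed
    derivatives of the normal leaves over; it follows from conformality and the vanishing trace. *)
Lemma codazzi_algebra (m0 m1 f00 f01 f11 : E3) :
  dot m0 (cross a b) = 0 -> dot m1 (cross a b) = 0 ->
  dot m0 b = dot m1 a -> dot m0 a + dot m1 b = 0 ->
  dot f00 a = dot f01 b -> dot f01 a = dot f11 b ->
  dot f00 b + dot f01 a = 0 -> dot f01 b + dot f11 a = 0 ->
  dot m1 f00 = dot m0 f01 /\ dot m1 f01 = dot m0 f11.
Proof.
move=> w0 w1 sym tr p r /eqP; rewrite addr_eq0 => /eqP r' /eqP; rewrite addr_eq0 => /eqP p'.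
have /eqP := tr; rewrite addr_eq0 => /eqP tr'.
rewrite (conformal_decomposition f00 w1) (conformal_decomposition f01 w0).
rewrite (conformal_decomposition f01 w1) (conformal_decomposition f11 w0).
rewrite ![dot a _]dotC ![dot b _]dotC sym tr' p r' -r p'.
by split; congr (_ / _); ring.
Qed.

End conformal_frame.

Section immersion.
Context {R : realType}.
Local Notation pt := 'rV[R]_2.
Local Notation E3 := 'rV[R]_3.
Variables (D : set pt) (f : pt -> E3).
Hypotheses (oD : open D) (sf : smooth_on D f).
Hypothesis w0 : forall x, D x -> cross (pd 0 f x) (pd 1 f x) != 0.
Implicit Types (x : pt).

Local Notation N := (normal_map f).
Local Notation h := (second_fundamental f).
Local Notation g := (first_fundamental f).

Lemma smooth_on_normal : smooth_on D N.
Proof. exact: smooth_on_normal_map. Qed.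

Lemma dot_normal_pd x i : dot (N x) (pd i f x) = 0.
Proof.
have K (a b : E3) (c : R) : dot (c *: cross a b) a = 0 /\ dot (c *: cross a b) b = 0.
  by rewrite !dotZl ![dot (cross a b) _]dotC dot_crossl dot_crossr mulr0.
by case: (ord2P i) => ->; [exact: (K _ _ _).1|exact: (K _ _ _).2].
Qed.

Lemma dot_normal_normal x : D x -> dot (N x) (N x) = 1.
Proof.
move=> Dx; have K (w : E3) : w != 0 ->
    dot ((Num.sqrt (dot w w))^-1 *: w) ((Num.sqrt (dot w w))^-1 *: w) = 1.
  move=> n0; have ww : 0 < dot w w by rewrite lt_def dotvv_ge0 dotvv_eq0 n0.
  rewrite dotZl dotZr mulrA -invfM -expr2 sqr_sqrtr ?ltW// mulVf//.
  exact: lt0r_neq0.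
exact: K (w0 Dx).
Qed.

Lemma dot_pd_normal_normal x i : D x -> dot (pd i N x) (N x) = 0.
Proof.
move=> Dx; have sN := smooth_on_normal.
have e1 := pd_dot i oD Dx sN sN.
have e2 : pd i (fun y => dot (N y) (N y) : R^o) x = 0.
  apply: (pd_cst_on (c := 1 : R^o) _ oD Dx) => y Dy.
  exact: dot_normal_normal.
have K (t : R) (m n : E3) : t = dot m n + dot n m -> t = 0 -> dot m n = 0.
  by move=> -> /eqP; rewrite (dotC n) -mulr2n mulrn_eq0 => /eqP.
exact: K e1 e2.
Qed.

Lemma second_fundamental_entry x i j : h x i j = - dot (pd i N x) (pd j f x).
Proof. by rewrite mxE. Qed.

Lemma first_fundamental_entry x i j : g x i j = dot (pd i f x) (pd j f x).
Proof. by rewrite mxE. Qed.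

(** Differentiating [N . f_l = 0] turns each side into [- N . f_kl], which is symmetric in [k] and
    [l]. *)
Lemma dot_pd_normal x i j : D x -> dot (pd i N x) (pd j f x) = dot (pd j N x) (pd i f x).
Proof.
move=> Dx; have sN := smooth_on_normal.
have E k l : dot (pd k N x) (pd l f x) = - dot (N x) (pd k (pd l f) x).
  have e1 := pd_dot k oD Dx sN (smooth_on_pd l sf).
  have e2 : pd k (fun y => dot (N y) (pd l f y) : R^o) x = 0.
    apply: (pd_cst_on (c := 0 : R^o) _ oD Dx) => y Dy.
    exact: dot_normal_pd.
  have K (t s r : R) : t = s + r -> t = 0 -> s = - r by move=> -> /eqP; rewrite addr_eq0 => /eqP.
  exact: K e1 e2.
have K (n u v : E3) (s t : R) : s = - dot n u -> t = - dot n v -> u = v -> s = t.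
  by move=> -> -> ->.
exact: K (E i j) (E j i) (pd_sym_rV i j oD Dx sf).
Qed.

Lemma second_fundamental_sym x i j : D x -> h x i j = h x j i.
Proof.
move=> Dx; have K (s t u v : R) : s = - u -> t = - v -> u = v -> s = t by move=> -> -> ->.
exact: K (second_fundamental_entry x i j) (second_fundamental_entry x j i) (dot_pd_normal i j Dx).
Qed.

Lemma smooth_on_second i j : smooth_on D (fun x => h x i j : R^o).
Proof.
apply: smooth_on_eq oD _ (smooth_onN oD (smooth_on_dot oD (smooth_on_pd i smooth_on_normal) (smooth_on_pd j sf))).
by move=> x _; rewrite mxE.
Qed.

Lemma pd_second_fundamental x k i j : D x -> pd k (fun x => h x i j : R^o) x
  = - (dot (pd k (pd i N) x) (pd j f x) + dot (pd i N x) (pd k (pd j f) x)).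
Proof.
move=> Dx; have sN := smooth_on_normal.
have sd := smooth_on_dot oD (smooth_on_pd i sN) (smooth_on_pd j sf).
rewrite (pd_eq_on (g := fun y => - dot (pd i N y) (pd j f y) : R^o) k oD Dx); last first.
  by move=> y _; rewrite mxE.
apply: etrans (pdN k Dx sd) _; congr (- _).
exact: (pd_dot k oD Dx (smooth_on_pd i sN) (smooth_on_pd j sf)).
Qed.

Section isothermal.
Hypothesis conf : forall x, D x -> g x 0 0 = g x 1 1 /\ g x 0 1 = 0.
Hypothesis minimal : forall x, D x -> h x 0 0 + h x 1 1 = 0.

Definition conformal_factor x : R^o := dot (pd 0 f x) (pd 0 f x).
Local Notation E := conformal_factor.

Lemma conformal_dot11 x : D x -> dot (pd 1 f x) (pd 1 f x) = E x.
Proof.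
move=> Dx; have [e _] := conf Dx.
exact: etrans (esym (first_fundamental_entry x 1 1)) (etrans (esym e) (first_fundamental_entry x 0 0)).
Qed.

Lemma conformal_dot01 x : D x -> dot (pd 0 f x) (pd 1 f x) = 0.
Proof.
by move=> Dx; have [_ e] := conf Dx; exact: etrans (esym (first_fundamental_entry x 0 1)) e.
Qed.

Lemma conformal_factor_gt0 x : D x -> 0 < E x.
Proof.
move=> Dx; have K (a b : E3) : dot b b = dot a a -> dot a b = 0 -> cross a b != 0 -> 0 < dot a a.
  move=> e1 e2; rewrite -dotvv_eq0 lagrange_cross e1 e2 expr0n subr0 mulf_eq0 orbb => a0.
  by rewrite lt_def a0 dotvv_ge0.
exact: K (conformal_dot11 Dx) (conformal_dot01 Dx) (w0 Dx).
Qed.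

Lemma conformal_normal x : D x -> N x = (E x)^-1 *: cross (pd 0 f x) (pd 1 f x).
Proof.
move=> Dx; have K (a b : E3) : 0 < dot a a -> dot b b = dot a a -> dot a b = 0 ->
    (Num.sqrt (dot (cross a b) (cross a b)))^-1 *: cross a b = (dot a a)^-1 *: cross a b.
  by move=> a0 e1 e2; rewrite lagrange_cross e1 e2 expr0n subr0 -expr2 sqrtr_sqr gtr0_norm.
exact: K (conformal_factor_gt0 Dx) (conformal_dot11 Dx) (conformal_dot01 Dx).
Qed.

Lemma dot_pd_normal_cross x i : D x -> dot (pd i N x) (cross (pd 0 f x) (pd 1 f x)) = 0.
Proof.
move=> Dx; have K (e : R) (m n w : E3) : 0 < e -> dot m n = 0 -> n = e^-1 *: w -> dot m w = 0.
  move=> e0 mn nw; rewrite nw dotZr in mn; move/eqP: mn.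
  by rewrite mulf_eq0 invr_eq0 (gt_eqF e0) => /eqP.
exact: K (conformal_factor_gt0 Dx) (dot_pd_normal_normal i Dx) (conformal_normal Dx).
Qed.

Lemma trace_dot x : D x -> dot (pd 0 N x) (pd 0 f x) + dot (pd 1 N x) (pd 1 f x) = 0.
Proof.
move=> Dx; have K (s t u v : R) : s + t = 0 -> s = - u -> t = - v -> u + v = 0.
  by move=> st sE tE; rewrite sE tE in st; apply/eqP; rewrite -oppr_eq0 opprD st.
exact: K (minimal Dx) (second_fundamental_entry x 0 0) (second_fundamental_entry x 1 1).
Qed.

Lemma pd_conformal_factor x i : D x ->
  dot (pd i (pd 0 f) x) (pd 0 f x) = dot (pd i (pd 1 f) x) (pd 1 f x) /\
  dot (pd i (pd 0 f) x) (pd 1 f x) + dot (pd i (pd 1 f) x) (pd 0 f x) = 0.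
Proof.
move=> Dx; have s0 := smooth_on_pd 0 sf; have s1 := smooth_on_pd 1 sf.
have e1 := pd_dot i oD Dx s0 s0; have e2 := pd_dot i oD Dx s1 s1; have e3 := pd_dot i oD Dx s0 s1.
have c1 : pd i (fun x => dot (pd 1 f x) (pd 1 f x) : R^o) x = pd i E x.
  by apply: (pd_eq_on i oD Dx) => y Dy; exact: conformal_dot11.
have c2 : pd i (fun x => dot (pd 0 f x) (pd 1 f x) : R^o) x = 0.
  apply: (pd_cst_on (c := 0 : R^o) _ oD Dx) => y Dy.
  exact: conformal_dot01.
have K (e t s : R) (a b a' b' : E3) : e = dot a' a + dot a a' -> t = dot b' b + dot b b' ->
    s = dot a' b + dot a b' -> t = e -> s = 0 -> dot a' a = dot b' b /\ dot a' b + dot b' a = 0.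
  clear; rewrite (dotC a a') (dotC b b') (dotC a b') => -> -> -> t1 t2; split; last exact: t2.
  by clear t2; lra.
exact: K e1 e2 e3 c1 c2.
Qed.

(** For a symmetric trace free form these are exactly the Cauchy-Riemann equations of
    [h00 - i h01]. *)
Lemma codazzi x : D x ->
  pd 1 (fun x => h x 0 0 : R^o) x = pd 0 (fun x => h x 0 1 : R^o) x /\
  pd 0 (fun x => h x 0 0 : R^o) x = - pd 1 (fun x => h x 0 1 : R^o) x.
Proof.
move=> Dx; have sN := smooth_on_normal; have E0 := conformal_factor_gt0 Dx.
have [a1 a2] := pd_conformal_factor 0 Dx; have [b1 b2] := pd_conformal_factor 1 Dx.
have f10 := pd_sym_rV 1 0 oD Dx sf; have N10 := pd_sym_rV 1 0 oD Dx sN.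
have eqf (u v w : E3) : u = v -> dot u w = dot v w by move=> ->.
have eqr (u v w : E3) : u = v -> dot w u = dot w v by move=> ->.
have [c1 c2] := codazzi_algebra E0 erefl (conformal_dot11 Dx) (conformal_dot01 Dx)
  (dot_pd_normal_cross 0 Dx) (dot_pd_normal_cross 1 Dx) (dot_pd_normal 0 1 Dx) (trace_dot Dx)
  a1 (etrans (esym (eqf _ _ _ f10)) b1) a2 (etrans (congr2 +%R (esym (eqf _ _ _ f10)) erefl) b2).
have K (s t : R) (n n' a m0 m1 u v : E3) : s = - (dot n a + dot m0 u) -> t = - (dot n' a + dot m1 v) ->
    n = n' -> dot m1 v = dot m0 u -> s = t.
  by move=> -> -> -> ->.
have h01 : pd 0 (fun x => h x 0 1 : R^o) x = pd 0 (fun x => h x 1 0 : R^o) x.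
  by apply: (pd_eq_on 0 oD Dx) => y Dy; exact: second_fundamental_sym.
have h00 : pd 0 (fun x => h x 0 0 : R^o) x = - pd 0 (fun x => h x 1 1 : R^o) x.
  apply: etrans (pd_eq_on (g := fun x => - h x 1 1 : R^o) 0 oD Dx _) (pdN 0 Dx (smooth_on_second 1 1)).
  by move=> y Dy; apply/eqP; rewrite -addr_eq0; apply/eqP; exact: minimal.
split.
- apply: etrans _ (esym h01).
  exact: K (pd_second_fundamental 1 0 0 Dx) (pd_second_fundamental 0 1 0 Dx) N10
    (etrans c1 (esym (eqr _ _ _ f10))).
- apply: etrans h00 _; congr (- _); apply: esym.
  exact: K (pd_second_fundamental 1 0 1 Dx) (pd_second_fundamental 0 1 1 Dx) N10 c2.
Qed.

End isothermal.
End immersion.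

(** * The Hopf differential in isothermal coordinates *)

Section hopf_function.
Context {R : realType}.
Local Notation pt := 'rV[R]_2.
Local Notation E3 := 'rV[R]_3.
Variables (D : set pt) (f : pt -> E3).
Hypotheses (oD : open D) (sf : smooth_on D f).
Hypothesis w0 : forall x, D x -> cross (pd 0 f x) (pd 1 f x) != 0.
Local Notation N := (normal_map f).
Local Notation h := (second_fundamental f).
Local Notation g := (first_fundamental f).
Hypothesis conf : forall x, D x -> g x 0 0 = g x 1 1 /\ g x 0 1 = 0.
Hypothesis minimal : forall x, D x -> h x 0 0 + h x 1 1 = 0.
Implicit Types (x : pt).
Local Notation E := (conformal_factor f).

(** The minus sign is forced by [Re (q dz^2) = A]: the mixed term of the left side is
    [- 2 Im q v_0 v_1]. *)
Definition hopf_function x : R[i] := h x 0 0 +i* - h x 0 1.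
Local Notation q := hopf_function.

Lemma hopf_function_holomorphic : holomorphic_on D q.
Proof.
have s0 : smooth_on D (fun x => h x 0 0 : R^o) by exact: (smooth_on_second oD sf w0).
have s1 : smooth_on D (fun x => h x 0 1 : R^o) by exact: (smooth_on_second oD sf w0).
split; [exact: s0|exact: (smooth_onN oD s1)|move=> x Dx].
rewrite ddzbarE; have [c1 c2] := codazzi oD sf w0 conf minimal Dx.
have n0 := pdN 0 Dx s1; have n1 := pdN 1 Dx s1.
have K (a b c d a' b' : R) : b = a' -> a = - b' -> c = - a' -> d = - b' ->
    2^-1 * ((a +i* c) + 'i * (b +i* d)) = 0 :> R[i].
  move=> -> -> -> ->; apply/eqP; rewrite mulf_eq0; apply/orP; right; apply/eqP.
  by apply: complex_ext; rewrite /= ; ring.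
exact: K c1 c2 n0 n1.
Qed.

Lemma hopf_function_form x (v : pt) : D x ->
  complex.Re (q x * (v 0 0 +i* v 0 1) ^+ 2) = (v *m h x *m v^T) 0 0.
Proof.
move=> Dx; have sy := second_fundamental_sym oD sf w0 0 1 Dx; have tr := minimal Dx.
have K (H : 'M[R]_2) : H 0 1 = H 1 0 -> H 0 0 + H 1 1 = 0 ->
    complex.Re ((H 0 0 +i* - H 0 1) * (v 0 0 +i* v 0 1) ^+ 2) = (v *m H *m v^T) 0 0.
  move=> e1 /eqP; rewrite addrC addr_eq0 => /eqP e2.
  by rewrite !mxE sum_ord2 !mxE !sum_ord2 -e1 e2 expr2 /=; ring.
exact: K sy tr.
Qed.

Lemma hopf_function_unique x (a : R[i]) : D x ->
  (forall v : pt, complex.Re (a * (v 0 0 +i* v 0 1) ^+ 2) = (v *m h x *m v^T) 0 0) -> a = q x.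
Proof.
(* The vector (1, 0) detects the real part; (1, 1) detects the imaginary part, since
   [(1 + i)^2 = 2 i]. *)
move=> Dx av; have e1 := av (\row_j (j == 0)%:R); have e2 := av (\row_j 1).
rewrite -!hopf_function_form// !mxE in e1 e2; move: e1 e2.
have -> : ((1 : 'I_2) == 0) = false by [].
rewrite eqxx.
case: a {av} => a b; case: (q x) => c d; rewrite /= ?expr2 /= => e1 e2.
by apply: complex_ext; rewrite /=; lra.
Qed.

(** In isothermal coordinates [det h = - |q|^2] and [det g = E^2], so [sqrt (- K) = |q| / E] and the
    conformal factor cancels. *)
Lemma flat_metric_local x : D x ->
  Num.sqrt (- (\det (h x) / \det (g x))) *: g x = (Num.sqrt (csq (q x)))%:M.
Proof.
move=> Dx; have sy := second_fundamental_sym oD sf w0 0 1 Dx; have tr := minimal Dx.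
have [c0 c1] := conf Dx.
have E0 := conformal_factor_gt0 w0 conf Dx.
have gE : g x 0 0 = E x by rewrite mxE.
have gs : g x 1 0 = g x 0 1.
  exact: etrans (first_fundamental_entry f x 1 0)
    (etrans (dotC _ _) (esym (first_fundamental_entry f x 0 1))).
have K (H G : 'M[R]_2) (e : R) : 0 < e -> G 0 0 = e -> G 0 0 = G 1 1 -> G 0 1 = 0 -> G 1 0 = G 0 1 ->
   H 0 1 = H 1 0 -> H 0 0 + H 1 1 = 0 ->
   Num.sqrt (- (\det H / \det G)) *: G = (Num.sqrt (csq (H 0 0 +i* - H 0 1)))%:M.
  clear; move=> e0 G0 G1 G01 G10 e1 /eqP; rewrite addrC addr_eq0 => /eqP e2.
  rewrite !det_mx22 -G1 G10 G01 G0 -e1 e2.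
  have -> : - ((H 0 0 * - H 0 0 - H 0 1 * H 0 1) / (e * e - 0 * 0))
     = csq (H 0 0 +i* - H 0 1) * (e^-1) ^+ 2.
    by rewrite /csq /=; field; rewrite gt_eqF.
  rewrite sqrtrM ?csq_ge0// sqrtr_sqr ger0_norm ?invr_ge0 ?ltW//.
  apply/matrixP => i j; rewrite !mxE.
  by case: (ord2P i) (ord2P j) => -> [] ->; rewrite /= ?mulr1n ?mulr0n ?G10 -?G1 ?G01 ?G0 ?mulr0// mulfVK// gt_eqF.
exact: K E0 gE c0 c1 gs sy tr.
Qed.

End hopf_function.

(** * The connection coefficient of a conformal metric *)

Section conformal_connection.
Context {R : realType}.
Local Notation pt := 'rV[R]_2.
Implicit Types (D : set pt) (x : pt).

Lemma connection_coef_eq D (g1 g2 : pt -> 'M[R]_2) x : open D -> D x ->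
  (forall y, D y -> g1 y = g2 y) -> connection_coef g1 x = connection_coef g2 x.
Proof.
move=> oD Dx gg; apply: eq_bigr => k _; congr (_ * _).
apply: eq_bigr => i _; apply: eq_bigr => j _; congr (_ * _%:C).
rewrite /christoffel; congr (_ * _); apply: eq_bigr => l _.
rewrite (gg x Dx); congr (_ * _).
by congr (_ + _ - _); apply: (pd_eq_on _ oD Dx) => y Dy; rewrite gg.
Qed.

Lemma connection_coef_conformal (rho : pt -> R^o) x : rho x != 0 ->
  connection_coef (fun y => (rho y)%:M) x = ddz (fun y => (rho y)%:C) x / (rho x)%:C.
Proof.
move=> r0.
have pdS i k l : pd i (fun y => (rho y)%:M k l : R^o) x = (k == l)%:R * pd i rho x.
  case: (altP (k =P l)) => [->|kl].
    by rewrite mul1r; congr (pd i _ x); apply/funext => y; rewrite mxE eqxx mulr1n.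
  rewrite mul0r -(pd_cst i (0 : R^o) x); congr (pd i _ x).
  by apply/funext => y; rewrite mxE (negbTE kl) mulr0n.
have G k i j : christoffel (fun y => (rho y)%:M) k i j x
    = (2 * rho x)^-1 * ((j == k)%:R * pd i rho x + (i == k)%:R * pd j rho x - (i == j)%:R * pd k rho x).
  rewrite /christoffel (bigD1 k)//= big1 ?addr0.
    by rewrite invmx_scalar mxE eqxx mulr1n !pdS invfM mulrA.
  by move=> l lk; rewrite invmx_scalar mxE eq_sym (negbTE lk) mulr0n mul0r.
pose d i := pd i rho x.
rewrite ddzE !cpd_real -[pd 0 rho x]/(d 0) -[pd 1 rho x]/(d 1).
transitivity (\sum_k dz_comp R k * \sum_i \sum_j ddz_comp R i * ddz_comp R j *
    ((2 * rho x)^-1 * ((j == k)%:R * d i + (i == k)%:R * d j - (i == j)%:R * d k))%:C).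
  by apply: eq_bigr => k _; congr (_ * _); apply: eq_bigr => i _; apply: eq_bigr => j _; rewrite G.
clearbody d; rewrite !sum_ord2 /= /dz_comp /ddz_comp !expr0 !expr1.
have K (a b r : R) : r != 0 ->
 1 * (2^-1 * 1 * (2^-1 * 1) * ((2 * r)^-1 * (1%:R * a + 1%:R * a - 1%:R * a))%:C +
      2^-1 * 1 * (2^-1 * - 'i) * ((2 * r)^-1 * (0%:R * a + 1%:R * b - 0%:R * a))%:C +
     (2^-1 * - 'i * (2^-1 * 1) * ((2 * r)^-1 * (1%:R * b + 0%:R * a - 0%:R * a))%:C +
      2^-1 * - 'i * (2^-1 * - 'i) * ((2 * r)^-1 * (0%:R * b + 0%:R * b - 1%:R * a))%:C)) +
 'i * (2^-1 * 1 * (2^-1 * 1) * ((2 * r)^-1 * (0%:R * a + 0%:R * a - 1%:R * b))%:C +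
      2^-1 * 1 * (2^-1 * - 'i) * ((2 * r)^-1 * (1%:R * a + 0%:R * b - 0%:R * b))%:C +
     (2^-1 * - 'i * (2^-1 * 1) * ((2 * r)^-1 * (0%:R * b + 1%:R * a - 0%:R * b))%:C +
      2^-1 * - 'i * (2^-1 * - 'i) * ((2 * r)^-1 * (1%:R * b + 1%:R * b - 1%:R * b))%:C))
 = 2^-1 * (a%:C - 'i * b%:C) / r%:C :> R[i].
  move=> n0; have h2 : 2^-1 = (2^-1 : R)%:C :> R[i] by rewrite fmorphV rmorph_nat.
  have hr : r%:C^-1 = (r^-1)%:C :> R[i] by rewrite fmorphV.
  by rewrite h2 hr; apply: complex_ext; rewrite /=; field.
exact: K.
Qed.

(** Formally [log |q|] is half the sum of [log q] and its conjugate, and [d/dz] kills the conjugate.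
    The proof avoids logarithms: it differentiates [rho^2 = |q|^2] and inserts the Cauchy-Riemann
    equations. *)
Lemma ddz_sqrt_csq D (q : pt -> R[i]) x : open D -> D x -> holomorphic_on D q ->
  (forall y, D y -> q y != 0) ->
  ddz (fun y => (Num.sqrt (csq (q y)))%:C) x / (Num.sqrt (csq (q x)))%:C = ddz q x / (2 * q x).
Proof.
move=> oD Dx hq q0; have [sr si _] := hq.
have sc : smooth_on D (fun y => csq (q y) : R^o).
  exact: smooth_onD oD (smooth_onM oD sr sr) (smooth_onM oD si si).
have c0 y : D y -> 0 < csq (q y).
  by move=> Dy; rewrite lt_def csq_ge0 csq_eq0 q0.
have ss : smooth_on D (fun y => Num.sqrt (csq (q y)) : R^o).
  by move=> k; apply: class_C_sqrt => //; exact: sc.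
set rho := fun y => Num.sqrt (csq (q y)) : R^o.
have pr i : pd i rho x * rho x + rho x * pd i rho x
   = pd i (re_part q) x * re_part q x + re_part q x * pd i (re_part q) x
   + (pd i (im_part q) x * im_part q x + im_part q x * pd i (im_part q) x).
  apply: etrans (esym (pdM i Dx ss ss)) _.
  apply: etrans (pd_eq_on (g := fun y => re_part q y * re_part q y + im_part q y * im_part q y : R^o) i oD Dx _) _.
    by move=> y Dy; rewrite -expr2 sqr_sqrtr ?csq_ge0.
  apply: etrans (pdD i Dx (smooth_onM oD sr sr) (smooth_onM oD si si)) _.
  by congr (_ + _); [exact: (pdM i Dx sr sr)|exact: (pdM i Dx si si)].
have [e0 e1] := holomorphic_cpd hq Dx.
rewrite ddzE !cpd_real.
have r0 : rho x != 0 by rewrite gt_eqF// sqrtr_gt0 c0.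
have rr : rho x * rho x = csq (q x) by rewrite -expr2 sqr_sqrtr ?csq_ge0.
have K (a b r A B : R) (z : R[i]) (a0 b0 a1 b1 : R) : r != 0 -> r * r = a * a + b * b ->
   a0 +i* b0 = z -> a1 +i* b1 = 'i * z ->
   A * r + r * A = a0 * a + a * a0 + (b0 * b + b * b0) ->
   B * r + r * B = a1 * a + a * a1 + (b1 * b + b * b1) ->
   2^-1 * (A%:C - 'i * B%:C) / r%:C = z / (2 * (a +i* b)).
  clear; move=> r0 rr <- [-> ->] hA hB.
  have n0 : a * a + b * b != 0 by rewrite -rr mulf_neq0.
  have ab0 : a +i* b != 0 by rewrite -csq_eq0 /csq.
  have rC : (r%:C)^-1 = r%:C * ((a * a + b * b)^-1)%:C.
    have rc0 : r%:C != 0 by rewrite (fmorph_eq0 (real_complex R)).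
    apply: (mulfI rc0); rewrite mulfV// mulrA -!rmorphM/= rr mulfV//.
  have hA' : A * r = a0 * a + b0 * b by lra.
  have hB' : B * r = - b0 * a + a0 * b by lra.
  have h2 : (2 * (a +i* b))^-1 = (2^-1)%:C * (Complex a (- b) * ((a * a + b * b)^-1)%:C).
    rewrite invfM; congr (_ * _); first by rewrite fmorphV rmorph_nat.
    by apply: complex_ext; rewrite ?Re_cV ?Im_cV /=; ring.
  have h2' : 2^-1 = (2^-1 : R)%:C :> R[i] by rewrite fmorphV rmorph_nat.
  have F : (A%:C - 'i * B%:C) * (r%:C * ((a * a + b * b)^-1)%:C)
      = (a0 +i* b0) * (Complex a (- b) * ((a * a + b * b)^-1)%:C).
    rewrite !mulrA; congr (_ * _).
    transitivity (Complex (A * r) (- (B * r))); first by apply: complex_ext; rewrite /=; ring.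
    by rewrite hA' hB'; apply: complex_ext; rewrite /=; ring.
  by rewrite rC h2 h2' -mulrA F mulrCA.
have qE : q x = re_part q x +i* im_part q x by apply: complex_ext.
rewrite [in RHS]qE.
exact: K r0 rr e0 e1 (pr 0) (pr 1).
Qed.

End conformal_connection.

(** * The Schwarzian derivative and its invariance under inversion *)

Section schwarzian_calculus.
Context {R : realType}.
Local Notation pt := 'rV[R]_2.
Implicit Types (D : set pt) (x : pt) (u k : pt -> R[i]).

(** The Schwarzian of [f] involves [f] only through its derivative [k], and a formula for [k] is
    what is available for the Gauss map. *)
Definition schwarzian_of_derivative k x : R[i] :=
  ddz (ddz k) x / k x - 3 / 2 * (ddz k x / k x) ^+ 2.

Lemma ddz_eq D u v x : open D -> D x -> (forall y, D y -> u y = v y) -> ddz u x = ddz v x.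
Proof. exact: cdir_eq. Qed.

Lemma ddzN D u x : D x -> csmooth D u -> ddz (fun x => - u x) x = - ddz u x.
Proof. exact: cdirN. Qed.
Lemma ddzD D u v x : D x -> csmooth D u -> csmooth D v ->
  ddz (fun x => u x + v x) x = ddz u x + ddz v x.
Proof. exact: cdirD. Qed.
Lemma ddzB D u v x : open D -> D x -> csmooth D u -> csmooth D v ->
  ddz (fun x => u x - v x) x = ddz u x - ddz v x.
Proof. exact: cdirB. Qed.
Lemma ddzM D u v x : open D -> D x -> csmooth D u -> csmooth D v ->
  ddz (fun x => u x * v x) x = ddz u x * v x + u x * ddz v x.
Proof. exact: cdirM. Qed.
Lemma ddzZ D a u x : open D -> D x -> csmooth D u -> ddz (fun x => a * u x) x = a * ddz u x.
Proof. exact: cdirZ. Qed.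
Lemma ddzV D u x : open D -> D x -> (forall x, D x -> u x != 0) -> csmooth D u ->
  ddz (fun x => (u x)^-1) x = - (ddz u x / u x ^+ 2).
Proof. exact: cdirV. Qed.
Lemma ddz_cst a x : ddz (fun _ => a) x = 0.
Proof. exact: cdir_cst. Qed.

Lemma schwarzian_finE D u k x : open D -> D x -> (forall y, D y -> ddz u y = k y) ->
  schwarzian_fin u x = schwarzian_of_derivative k x.
Proof.
move=> oD Dx uk.
have uk1 y : D y -> ddz (ddz u) y = ddz k y by move=> Dy; exact: ddz_eq oD Dy uk.
have K (a b c a' b' c' : R[i]) : a = a' -> b = b' -> c = c' ->
  c / a - 3 / 2 * (b / a) ^+ 2 = c' / a' - 3 / 2 * (b' / a') ^+ 2 by move=> -> -> ->.
exact: K (uk x Dx) (uk1 x Dx) (ddz_eq oD Dx uk1).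
Qed.

Lemma schwarzian_fin_eq D u v x : open D -> D x -> (forall y, D y -> u y = v y) ->
  schwarzian_fin u x = schwarzian_fin v x.
Proof.
move=> oD Dx uv; apply: (schwarzian_finE oD Dx) => y Dy.
exact: ddz_eq oD Dy uv.
Qed.

(** The Schwarzians of [u] and [1/u] agree, which reconciles the two coordinates of the Riemann
    sphere. Here [A] is the derivative of [1/u], written with [v = 1/u] so that its derivatives stay
    polynomial in [v], [k] and the derivatives of [k]. *)
Lemma schwarzian_finV D u k x : open D -> D x -> csmooth D u -> csmooth D k ->
  (forall y, D y -> u y != 0) -> (forall y, D y -> k y != 0) ->
  (forall y, D y -> ddz u y = k y) ->
  schwarzian_fin (fun y => (u y)^-1) x = schwarzian_of_derivative k x.
Proof.
move=> oD Dx su sk u0 k0 uk.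
pose v y := (u y)^-1.
have sv : csmooth D v by exact: csmoothV.
have dv y : D y -> ddz v y = - (k y * (v y * v y)).
  by move=> Dy; apply: etrans (ddzV oD Dy u0 su) _; rewrite uk// expr2 invfM.
have svv := csmoothM oD sv sv.
pose A y := - (k y * (v y * v y)).
have dvv y : D y -> ddz (fun y => v y * v y) y = - (2 * (k y * (v y * (v y * v y)))).
  by move=> Dy; apply: etrans (ddzM oD Dy sv sv) _; rewrite dv//; ring.
have sk' := csmooth_ddz oD sk.
have sM := csmoothM oD sk svv.
have dA y : D y -> ddz A y = 2 * (k y * k y * (v y * (v y * v y))) - ddz k y * (v y * v y).
  move=> Dy; apply: etrans (ddzN Dy sM) _.
  by rewrite (ddzM oD Dy sk svv) dvv//; ring.
have skk := csmoothM oD sk sk.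
have svvv := csmoothM oD sv svv.
have dvvv y : D y -> ddz (fun y => v y * (v y * v y)) y = - (3 * (k y * (v y * v y * (v y * v y)))).
  by move=> Dy; rewrite (ddzM oD Dy sv svv) dvv// dv//; ring.
have dA2 : ddz (ddz A) x = 2 * (2 * k x * ddz k x * (v x * (v x * v x))
    - 3 * (k x * k x * k x * (v x * v x * (v x * v x))))
    - (ddz (ddz k) x * (v x * v x) - 2 * (ddz k x * (k x * (v x * (v x * v x))))).
  have s1 := csmoothM oD skk svvv; have s2 := csmoothM oD sk' svv.
  rewrite (ddz_eq oD Dx dA) (ddzB oD Dx (csmoothM oD (csmooth_cst D 2) s1) s2) (ddzZ _ oD Dx s1).
  rewrite (ddzM oD Dx skk svvv) (ddzM oD Dx sk sk) (ddzM oD Dx sk' svv).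
  by rewrite dvv// dvvv//; ring.
rewrite (schwarzian_finE (k := A) oD Dx dv) /schwarzian_of_derivative dA2 (dA _ Dx) /A.
have v0 : v x != 0 by rewrite invr_eq0 u0.
move: (v x) (k x) (ddz k x) (ddz (ddz k) x) v0 (k0 x Dx) => a b c d a0 b0.
by field; rewrite a0 b0.
Qed.

End schwarzian_calculus.

(** * The derivative of the stereographic Gauss map *)

Lemma stereo_derivative_algebra (R : rcfType) (s n0 n1 n2 v0 v1 v2 e p : R[i]) : s * s = 1 -> 1 - s * n2 != 0 -> e != 0 ->
   n1 * v2 - n2 * v1 = - 'i * v0 -> n2 * v0 - n0 * v2 = - 'i * v1 ->
   (- (p * v0 / (2 * e)) + s * 'i * - (p * v1 / (2 * e))) / (1 - s * n2) +
   (n0 + s * 'i * n1) * - ((0 - s * - (p * v2 / (2 * e))) / (1 - s * n2) ^+ 2)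
   = p * - ((v0 + s * 'i * v1) / (e * (1 - s * n2) ^+ 2)).
Proof.
move=> s1 a0 e0 h0 h1.
  have ii : 'i * 'i = -1 :> R[i] by rewrite -expr2 sqr_i.
  (* The relation [n x v = - i v] makes both terms of the quotient rule multiples of [v0 + s i v1],
     with factors [1 - s n2] and [1 + s n2]; their sum is 2 and cancels the 2 in [2 * e]. *)
  have F : s * (n0 + s * 'i * n1) * v2 = (v0 + s * 'i * v1) * (1 + s * n2).
    have -> : s * (n0 + s * 'i * n1) * v2 = s * (n0 * v2) + (s * s) * 'i * (n1 * v2) by ring.
    have -> : n0 * v2 = n2 * v0 + 'i * v1 by rewrite -[n2 * v0](subrK (n0 * v2)) h1; ring.
    have -> : n1 * v2 = n2 * v1 - 'i * v0 by rewrite -[n1 * v2](subrK (n2 * v1)) h0; ring.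
    have -> : (v0 + s * 'i * v1) * (1 + s * n2) = v0 + s * 'i * v1 + s * n2 * v0 + (s * s) * 'i * v1 * n2 by ring.
    rewrite s1.
    have -> : s * (n2 * v0 + 'i * v1) + 1 * 'i * (n2 * v1 - 'i * v0) =
       s * n2 * v0 + s * 'i * v1 + 'i * (n2 * v1) - ('i * 'i) * v0 by ring.
    by rewrite ii; ring.
  transitivity (- (p / (2 * e) / (1 - s * n2) ^+ 2) *
    ((v0 + s * 'i * v1) * (1 - s * n2) + s * (n0 + s * 'i * n1) * v2)).
    by field; rewrite e0 a0.
  by rewrite F; field; rewrite e0 a0.
Qed.

(** Isotropy gives [v2^2 = - (v0 + s i v1) (v0 - s i v1)], so [v2 = 0]; then the component [h0] of
    [n x v = - i v] reduces to [s v1 (1 - s n2) = 0]. *)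
Lemma isotropic_eq0 (R : rcfType) (s n1 n2 v0 v1 v2 : R[i]) : s * s = 1 -> 1 - s * n2 != 0 ->
   n1 * v2 - n2 * v1 = - 'i * v0 ->  v0 * v0 + v1 * v1 + v2 * v2 = 0 ->
   v0 + s * 'i * v1 = 0 -> [/\ v0 = 0, v1 = 0 & v2 = 0].
Proof.
move=> s1 a0 h0 h1 h2.
  have ii : 'i * 'i = -1 :> R[i] by rewrite -expr2 sqr_i.
  have v2z : v2 = 0.
    have : v2 * v2 = - ((v0 + s * 'i * v1) * (v0 - s * 'i * v1)).
      have -> : v2 * v2 = - (v0 * v0 + v1 * v1) by rewrite -[LHS](addKr (v0 * v0 + v1 * v1)) h1 addr0.
      have -> : (v0 + s * 'i * v1) * (v0 - s * 'i * v1) = v0 * v0 - (s * s) * ('i * 'i) * v1 * v1 by ring.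
      by rewrite s1 ii; ring.
    by rewrite h2 mul0r oppr0 => /eqP; rewrite mulf_eq0 orbb => /eqP.
  have v0E : v0 = - (s * 'i * v1) by apply/eqP; rewrite -addr_eq0 h2.
  have v1z : v1 = 0.
    rewrite v2z v0E mulr0 in h0.
    have : s * v1 * (1 - s * n2) = 0.
      have -> : s * v1 * (1 - s * n2) = (0 - n2 * v1) * (s * s) + s * v1 by ring.
      rewrite h0 s1.
      have -> : - 'i * - (s * 'i * v1) * 1 + s * v1 = s * v1 * (1 + 'i * 'i) by ring.
      by rewrite ii; ring.
    move=> /eqP; rewrite !mulf_eq0 (negbTE a0) orbF => /orP[/eqP s0|/eqP//].
    by have := s1; rewrite s0 mul0r => /esym/eqP; rewrite oner_eq0.
  by split=> //; rewrite v0E v1z mulr0 oppr0.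
Qed.

Section gauss_map.
Context {R : realType}.
Local Notation pt := 'rV[R]_2.
Local Notation E3 := 'rV[R]_3.
Variables (D : set pt) (f : pt -> E3).
Hypotheses (oD : open D) (sf : smooth_on D f).
Hypothesis w0 : forall x, D x -> cross (pd 0 f x) (pd 1 f x) != 0.
Local Notation N := (normal_map f).
Local Notation h := (second_fundamental f).
Local Notation g := (first_fundamental f).
Hypothesis conf : forall x, D x -> g x 0 0 = g x 1 1 /\ g x 0 1 = 0.
Hypothesis minimal : forall x, D x -> h x 0 0 + h x 1 1 = 0.
Implicit Types (x : pt).
Local Notation E := (conformal_factor f).
Local Notation q := (hopf_function f).

(* [2 df/dzbar] *)
Definition isotropic x (k : 'I_3) : R[i] := pd 0 f x 0 k +i* pd 1 f x 0 k.
Local Notation v := isotropic.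

(** The Weingarten equations in complex form, [dN/dz = - (q / E) df/dzbar]: a vanishing trace
    removes the [df/dz] component. *)
Lemma ddz_normal x k : D x ->
  ddz (fun x => (N x 0 k)%:C) x = - (q x * v x k / (2 * (E x)%:C)).
Proof.
move=> Dx; rewrite ddzE !cpd_real.
have sN := smooth_on_normal oD sf w0.
have dotd (m : E3) : dot m (delta_mx 0 k) = m 0 k.
  by rewrite dotE !mxE; case: (ord3P k) => -> /=; ring.
have W i := conformal_decomposition (conformal_factor_gt0 w0 conf Dx) erefl
  (conformal_dot11 conf Dx) (conformal_dot01 conf Dx) (delta_mx 0 k) (dot_pd_normal_cross oD sf w0 conf i Dx).
have p i := pd_rV i k Dx sN.
have K (n0 n1 a b : E3) (e h00 h01 h10 h11 p0 p1 : R) : e != 0 -> h00 = - dot n0 a -> h01 = - dot n0 b ->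
    h10 = - dot n1 a -> h11 = - dot n1 b -> h01 = h10 -> h00 + h11 = 0 ->
    dot n0 (delta_mx 0 k) = (dot n0 a * dot a (delta_mx 0 k) + dot n0 b * dot b (delta_mx 0 k)) / e ->
    dot n1 (delta_mx 0 k) = (dot n1 a * dot a (delta_mx 0 k) + dot n1 b * dot b (delta_mx 0 k)) / e ->
    n0 0 k = p0 -> n1 0 k = p1 ->
    2^-1 * (p0%:C - 'i * p1%:C) = - ((h00 +i* - h01) * (a 0 k +i* b 0 k) / (2 * e%:C)) :> R[i].
  rewrite !dotd; clear -k; move=> e0 -> -> -> -> s t -> -> <- <-.
  have h2 : (2 * e%:C)^-1 = 2^-1 * (e^-1)%:C :> R[i] by rewrite invfM (fmorphV (real_complex R)).
  transitivity (2^-1 * - ((- dot n0 a +i* - - dot n0 b) * (a 0 k +i* b 0 k) * (e^-1)%:C) : R[i]);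
    last by rewrite h2; ring.
  congr (_ * _).
  have t' : dot n1 b = - dot n0 a by lra.
  have s' : dot n1 a = dot n0 b by lra.
  by rewrite t' s'; apply: complex_ext; rewrite /=; ring.
have en i j := second_fundamental_entry f x i j.
have e0 : E x != 0 by rewrite gt_eqF// (conformal_factor_gt0 w0 conf Dx).
exact: K e0 (en 0 0) (en 0 1) (en 1 0) (en 1 1) (second_fundamental_sym oD sf w0 0 1 Dx) (minimal Dx)
  (W 0) (W 1) (p 0) (p 1).
Qed.

(** The cross product with [N] turns the tangent plane by a right angle, sending [f_0] to [f_1] and
    [f_1] to [- f_0]; so [v = f_0 + i f_1] is an eigenvector for [- i]. Isotropy of [v] is
    conformality. *)
Lemma normal_cross_isotropic x : D x ->
  [/\ (N x 0 1)%:C * v x 2 - (N x 0 2)%:C * v x 1 = - 'i * v x 0,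
      (N x 0 2)%:C * v x 0 - (N x 0 0)%:C * v x 2 = - 'i * v x 1 &
      v x 0 * v x 0 + v x 1 * v x 1 + v x 2 * v x 2 = 0] /\
  (exists k, v x k != 0).
Proof.
move=> Dx.
have K (a b n : E3) : 0 < dot a a -> dot b b = dot a a -> dot a b = 0 ->
   n = (dot a a)^-1 *: cross a b ->
   let v k := a 0 k +i* b 0 k in
  [/\ (n 0 1)%:C * v 2 - (n 0 2)%:C * v 1 = - 'i * v 0,
      (n 0 2)%:C * v 0 - (n 0 0)%:C * v 2 = - 'i * v 1 &
      v 0 * v 0 + v 1 * v 1 + v 2 * v 2 = 0] /\
  (exists k, v k != 0).
  clear; move=> a0 bb ab nE v.
  have e0 : dot a a != 0 by rewrite gt_eqF.
  have nk k : n 0 k = (dot a a)^-1 * (cross a b) 0 k by rewrite nE [LHS]mxE.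
  have na : cross n a = b.
    have F j : (cross n a) 0 j = (dot a a)^-1 * (dot a a * b 0 j - dot a b * a 0 j).
      move: (dot a a)^-1 nk => c nk.
      by rewrite !dotE; case: (ord3P j) => ->; rewrite !crossE !nk !crossE; ring.
    by apply/rowP => j; rewrite F ab mul0r subr0 mulKf.
  have nb : cross n b = - a.
    have F j : (cross n b) 0 j = (dot a a)^-1 * (dot a b * b 0 j - dot b b * a 0 j).
      rewrite (dotE a b) (dotE b b); case: (ord3P j) => ->; rewrite !crossE !nk !crossE; ring.
    by apply/rowP => j; rewrite F ab bb mul0r sub0r mulrN mulKf// mxE.
  have na0 := cross0E n a; have na1 := cross1E n a; rewrite na in na0 na1.
  have nb0 := cross0E n b; have nb1 := cross1E n b; rewrite nb !mxE in nb0 nb1.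
  rewrite !dotE in bb ab.
  split; last first.
    apply: contrapT => H; case/eqP: e0; rewrite dotE.
    have Z k : a 0 k = 0.
      have [//|vk] := eqVneq (v k) 0; last by case: H; exists k.
      by move=> /(congr1 (@complex.Re R)).
    by rewrite !Z; ring.
  split; apply: complex_ext; rewrite /=; lra.
exact: K (conformal_factor_gt0 w0 conf Dx) (conformal_dot11 conf Dx) (conformal_dot01 conf Dx)
  (conformal_normal w0 conf Dx).
Qed.

(* Stereographic projection of the Gauss map from the pole [s e_3], [s = 1] or
   [s = -1], conjugated in the second case. *)
Definition stereo (s : R[i]) x : R[i] :=
  ((N x 0 0)%:C + s * 'i * (N x 0 1)%:C) / (1 - s * (N x 0 2)%:C).

Definition stereo_weight (s : R[i]) x : R[i] :=
  - ((v x 0 + s * 'i * v x 1) / ((E x)%:C * (1 - s * (N x 0 2)%:C) ^+ 2)).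

Section pole.
Variables (s : R[i]) (U : set pt).
Hypotheses (s1 : s * s = 1) (oU : open U) (UD : U `<=` D).
Hypothesis away : forall x, U x -> 1 - s * (N x 0 2)%:C != 0.

Let sN k : csmooth U (fun x => (N x 0 k)%:C).
Proof.
apply: csmooth_real; have sn := smooth_on_sub UD (smooth_on_normal oD sf w0).
exact: (smooth_on_rV _ oU).1 sn k.
Qed.

Let snum : csmooth U (fun x => (N x 0 0)%:C + s * 'i * (N x 0 1)%:C).
Proof. exact: csmoothD oU (sN 0) (csmoothM oU (csmooth_cst U (s * 'i)) (sN 1)). Qed.

Let sden : csmooth U (fun x => 1 - s * (N x 0 2)%:C).
Proof.
exact: csmoothB oU (csmooth_cst U 1) (csmoothM oU (csmooth_cst U s) (sN 2)).
Qed.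

Let E0 x : U x -> (E x)%:C != 0.
Proof.
move=> Ux; have e0 := conformal_factor_gt0 w0 conf (UD Ux).
by rewrite (fmorph_eq0 (real_complex R)) gt_eqF.
Qed.

Lemma csmooth_stereo : csmooth U (stereo s).
Proof. exact: csmoothM oU snum (csmoothV oU away sden). Qed.

Lemma csmooth_stereo_weight : csmooth U (stereo_weight s).
Proof.
have sfU := smooth_on_sub UD sf.
have sv k : csmooth U (fun x => v x k).
  by split; [exact: (smooth_on_rV _ oU).1 (smooth_on_pd 0 sfU) k|
             exact: (smooth_on_rV _ oU).1 (smooth_on_pd 1 sfU) k].
have sE : csmooth U (fun x => (E x)%:C).
  by apply: csmooth_real; exact: smooth_on_dot oU (smooth_on_pd 0 sfU) (smooth_on_pd 0 sfU).
apply: (csmoothN oU); apply: (csmoothM oU).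
  exact: csmoothD oU (sv 0) (csmoothM oU (csmooth_cst U (s * 'i)) (sv 1)).
apply: (csmoothV oU) (csmoothM oU sE (csmoothX 2 oU sden)) => x Ux.
by rewrite mulf_neq0 ?expf_neq0 ?E0 ?away.
Qed.

(* The conjugation relation [N x v = -i v] for the isotropic vector [v] makes the
   derivative of the stereographic Gauss map [q] times a nowhere vanishing weight. *)
Lemma ddz_stereo x : U x -> ddz (stereo s) x = q x * stereo_weight s x.
Proof.
move=> Ux; have Dx := UD Ux.
rewrite (ddzM oU Ux snum (csmoothV oU away sden)).
rewrite (ddzV oU Ux away sden) (ddzD Ux (sN 0) (csmoothM oU (csmooth_cst U (s * 'i)) (sN 1))).
rewrite (ddzZ _ oU Ux (sN 1)) (ddzB oU Ux (csmooth_cst U 1) (csmoothM oU (csmooth_cst U s) (sN 2))).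
rewrite ddz_cst (ddzZ _ oU Ux (sN 2)) !ddz_normal//.
rewrite /stereo_weight.
have [[c0 c1 _] _] := normal_cross_isotropic Dx.
have a0 := away Ux; have e0 := E0 Ux.
exact: stereo_derivative_algebra s1 a0 e0 c0 c1.
Qed.

Lemma stereo_weight_neq0 x : U x -> stereo_weight s x != 0.
Proof.
move=> Ux; have Dx := UD Ux.
have [[c0 c1 c2] [k vk]] := normal_cross_isotropic Dx.
have a0 := away Ux; have e0 := E0 Ux.
rewrite oppr_eq0 mulf_neq0 ?invr_eq0 ?mulf_neq0 ?expf_neq0//.
apply/eqP => vz.
have [z0 z1 z2] := isotropic_eq0 s1 a0 c0 c2 vz.
by case: (ord3P k) vk => ->; rewrite ?z0 ?z1 ?z2 eqxx.
Qed.

End pole.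
End gauss_map.

(** * Entropy differentials in an isothermal parametrization *)

Section local_entropy.
Context {R : realType}.
Local Notation pt := 'rV[R]_2.
Local Notation E3 := 'rV[R]_3.
Variables (D : set pt) (f : pt -> E3).
Hypotheses (oD : open D) (sf : smooth_on D f).
Hypothesis w0 : forall x, D x -> cross (pd 0 f x) (pd 1 f x) != 0.
Local Notation N := (normal_map f).
Local Notation h := (second_fundamental f).
Local Notation g := (first_fundamental f).
Hypothesis conf : forall x, D x -> g x 0 0 = g x 1 1 /\ g x 0 1 = 0.
Hypothesis minimal : forall x, D x -> h x 0 0 + h x 1 1 = 0.
Implicit Types (x : pt).
Local Notation q := (hopf_function f).

Definition sphere_map x : riemann_sphere R :=
  if N x 0 2 == 1 then None else Some ((N x 0 0 +i* N x 0 1) / (1 - N x 0 2)%:C).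

Lemma open_neq0 (U : set pt) (u : pt -> R[i]) : open U -> csmooth U u ->
  open (U `&` [set x | u x != 0]).
Proof.
move=> oU [sr si]; rewrite openE => x [Ux ux].
pose c y := csq (u y) : R^o.
have cc : {for x, continuous c}.
  have s := smooth_onD oU (smooth_onM oU sr sr) (smooth_onM oU si si).
  exact: smooth_on_continuous s Ux.
have cx : 0 < c x by rewrite lt_def csq_ge0 csq_eq0 ux.
have H1 : \near x, 0 < c x by exact: (cvgr_gt _ cc _ cx).
have H2 : \near x, U x by exact: open_nbhs_nbhs.
apply: filterS2 H1 H2 => y cy Uy; split=> //=.
by rewrite -csq_eq0 gt_eqF.
Qed.

(** The equation [|N|^2 = 1] in factored form; it makes the projection from one pole the inverse of
    the conjugated projection from the other. *)
Lemma normal_stereo_algebra x (s : R[i]) : D x -> s * s = 1 ->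
  ((N x 0 0)%:C + s * 'i * (N x 0 1)%:C) * ((N x 0 0)%:C - s * 'i * (N x 0 1)%:C) =
  (1 - s * (N x 0 2)%:C) * (1 + s * (N x 0 2)%:C).
Proof.
move=> Dx s1; have n1 := dot_normal_normal w0 Dx; rewrite dotE in n1.
have K (a b c : R) : a * a + b * b + c * c = 1 ->
  (a%:C + s * 'i * b%:C) * (a%:C - s * 'i * b%:C) = (1 - s * c%:C) * (1 + s * c%:C).
  move=> abc.
  have -> : (a%:C + s * 'i * b%:C) * (a%:C - s * 'i * b%:C)
     = a%:C * a%:C - (s * s) * ('i * 'i) * (b%:C * b%:C) by ring.
  have -> : (1 - s * c%:C) * (1 + s * c%:C) = 1 - (s * s) * (c%:C * c%:C) by ring.
  have ii : 'i * 'i = -1 :> R[i] by rewrite -expr2 sqr_i.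
  rewrite s1 ii; have -> : a%:C * a%:C = (1 - b * b - c * c)%:C.
    by rewrite -abc -rmorphM; congr (_%:C); ring.
  by rewrite !rmorphB/= !rmorphM/= rmorph1; ring.
exact: K.
Qed.

Lemma stereo1E x : stereo f 1 x = (N x 0 0 +i* N x 0 1) / (1 - N x 0 2)%:C.
Proof.
rewrite /stereo !mul1r rmorphB rmorph1; congr (_ / _).
by apply: complex_ext; rewrite /=; ring.
Qed.

Lemma sphere_map_neq1 x : N x 0 2 != 1 -> sphere_map x = Some (stereo f 1 x).
Proof. by move=> n1; rewrite /sphere_map (negbTE n1) stereo1E. Qed.

Lemma pole1_neq0 x : (1 - 1 * (N x 0 2)%:C != 0 :> R[i]) = (N x 0 2 != 1).
Proof.
by rewrite mul1r -(rmorph1 (real_complex R)) -rmorphB (fmorph_eq0 (real_complex R)) subr_eq0 eq_sym.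
Qed.

Lemma stereo_inv x : D x -> N x 0 2 != 1 -> 1 - (-1) * (N x 0 2)%:C != 0 ->
  stereo f 1 x = (stereo f (-1) x)^-1 /\ stereo f (-1) x != 0.
Proof.
move=> Dx n1; have := normal_stereo_algebra Dx (mul1r 1).
rewrite /stereo !mul1r -[N x 0 2 != 1]pole1_neq0 mul1r in n1 *.
move: (N x 0 0)%:C (N x 0 1)%:C (N x 0 2)%:C n1 => a b c c1 e c2.
have c2' : 1 + c != 0 by move: c2; rewrite mulN1r opprK.
have e' : (a + -1 * 'i * b) * (a + 'i * b) = (1 - c) * (1 + c) by rewrite -e; ring.
have n0 : (1 - c) * (1 + c) != 0 by rewrite mulf_neq0.
have := n0; rewrite -e' mulf_eq0 negb_or => /andP[a1 a2].
have -> : 1 - -1 * c = 1 + c by ring.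
split; last by rewrite mulf_neq0// invr_eq0.
rewrite invf_div; apply/eqP; rewrite eqr_div// [_ * (a + _)]mulrC e'.
by rewrite mulrC.
Qed.

Lemma sphere_inv_map x : D x -> 1 - (-1) * (N x 0 2)%:C != 0 ->
  finite_part (sphere_inv (sphere_map x)) = stereo f (-1) x.
Proof.
move=> Dx c2; have [n1|n1] := eqVneq (N x 0 2) 1; last first.
  have [e e0] := stereo_inv Dx n1 c2.
  by rewrite sphere_map_neq1//= e invr_eq0 (negbTE e0) /= invrK.
rewrite /sphere_map n1 eqxx /= /stereo.
have nn := dot_normal_normal w0 Dx; rewrite dotE n1 in nn.
have K (a b : R) : a * a + b * b + 1 * 1 = 1 -> a = 0 /\ b = 0.
  rewrite mulr1 -[X in _ = X]add0r => /addIr/eqP; rewrite -!expr2 paddr_eq0 ?sqr_ge0// !sqrf_eq0.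
  by move=> /andP[/eqP -> /eqP ->].
by have [-> ->] := K _ _ nn; rewrite rmorph0 mulr0 addr0 mul0r.
Qed.

(** [schwarzian] passes to [1/G] only at the poles of [G], whereas the expansion at [p] needs one
    formula on a whole neighbourhood. For [s = -1] the points where [G] is finite are covered by
    [schwarzian_finV], on the set [V] where [q] does not vanish. *)
Lemma schwarzian_sphere_map s U x : s = 1 \/ s = -1 -> open U -> U `<=` D ->
  (forall x, U x -> 1 - s * (N x 0 2)%:C != 0) -> U x -> q x != 0 ->
  schwarzian sphere_map x = schwarzian_of_derivative (fun y => q y * stereo_weight f s y) x.
Proof.
move=> s1 oU UD away Ux qx.
have ss : s * s = 1 by case: s1 => ->; rewrite ?mulr1// mulrNN mulr1.
have dS := ddz_stereo oD sf w0 conf minimal ss oU UD away.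
have hq := hopf_function_holomorphic oD sf w0 conf minimal.
have [sq _] := (holomorphicP _ _).1 hq.
case: s1 => sE; subst s.
  have n1 y : U y -> N y 0 2 != 1 by move=> Uy; rewrite -pole1_neq0 away.
  rewrite /schwarzian (sphere_map_neq1 (n1 x Ux)).
  apply: (etrans _ (schwarzian_finE oU Ux dS)).
  by apply: (schwarzian_fin_eq oU Ux) => y Uy; rewrite (sphere_map_neq1 (n1 y Uy)).
have [n1|n1] := eqVneq (N x 0 2) 1.
  rewrite /schwarzian {1}/sphere_map n1 eqxx.
  apply: (etrans _ (schwarzian_finE oU Ux dS)).
  by apply: (schwarzian_fin_eq oU Ux) => y Uy; rewrite sphere_inv_map//; [exact: UD|exact: away].
have sst := csmooth_stereo oD sf w0 oU UD away.
have swt := csmooth_stereo_weight oD sf w0 conf oU UD away.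
have sN2 : csmooth U (fun x => 1 - 1 * (N x 0 2)%:C).
  apply: (csmoothB oU (csmooth_cst U 1) (csmoothM oU (csmooth_cst U 1) _)).
  apply: csmooth_real; have sn := smooth_on_sub UD (smooth_on_normal oD sf w0).
  exact: (smooth_on_rV _ oU).1 sn 2.
have sqU := csmooth_sub UD sq.
pose V := (U `&` [set x | 1 - 1 * (N x 0 2)%:C != 0]) `&` (U `&` [set x | q x != 0]).
have oV : open V by apply: openI; exact: open_neq0.
have VU : V `<=` U by move=> y [[]].
have Vn y : V y -> N y 0 2 != 1 by move=> [[_ /=]]; rewrite pole1_neq0.
have Vx : V x by split; split=> //=; rewrite pole1_neq0.
rewrite /schwarzian (sphere_map_neq1 n1).
have inv y : V y -> stereo f 1 y = (stereo f (-1) y)^-1 /\ stereo f (-1) y != 0.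
  by move=> Vy; apply: stereo_inv (Vn y Vy) (away y (VU y Vy)); exact: UD (VU y Vy).
have k0 y : V y -> q y * stereo_weight f (-1) y != 0.
  move=> Vy; have [_ [_ qy]] := Vy.
  by rewrite mulf_neq0// (stereo_weight_neq0 w0 conf ss UD away (VU y Vy)).
apply: etrans _ (schwarzian_finV oV Vx (csmooth_sub VU sst)
  (csmooth_sub VU (csmoothM oU sqU swt)) (fun y Vy => (inv y Vy).2) k0 (fun y Vy => dS y (VU y Vy))).
by apply: (schwarzian_fin_eq oV Vx) => y Vy; rewrite (sphere_map_neq1 (Vn y Vy)) /= (inv y Vy).1.
Qed.

Definition flat_local x := Num.sqrt (- (\det (h x) / \det (g x))) *: g x.

Lemma connection_coef_flat U x : open U -> U `<=` D -> U x -> (forall y, U y -> q y != 0) ->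
  connection_coef flat_local x = ddz q x / (2 * q x).
Proof.
move=> oU UD Ux q0.
have hq := holomorphic_sub UD (hopf_function_holomorphic oD sf w0 conf minimal).
have e := ddz_sqrt_csq oU Ux hq q0.
have r0 : Num.sqrt (csq (q x)) != 0.
  by rewrite gt_eqF// sqrtr_gt0 lt_def csq_ge0 csq_eq0 q0.
apply: etrans _ e; apply: etrans _ (connection_coef_conformal r0).
by apply: (connection_coef_eq oU Ux) => y Uy; have e' := flat_metric_local oD sf w0 conf minimal (UD _ Uy); exact: e'.
Qed.

Lemma isothermal_entropy_ratio p (m : nat) (a : R[i]) :
  let P := nabla_schwarzian (connection_coef flat_local) sphere_map in
  D p -> (0 < m)%N -> (forall k, (k < m)%N -> iter k (@ddz R) q p = 0) ->
  iter m (@ddz R) q p != 0 ->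
  (forall x, D x -> q x != 0 -> P 3 x = a * (P 0 x * P 1 x)) ->
  a * (m%:R * (3 * m%:R + 4)) = - (24 * (m%:R + 2) ^+ 2).
Proof.
move=> P Dp m0 ql qm PE.
have hq := hopf_function_holomorphic oD sf w0 conf minimal.
(* The centre of projection is chosen away from [N p]: the usual pole unless [N p] is that pole. *)
have [s [s1 sp]] : exists s : R[i], (s = 1 \/ s = -1) /\ 1 - s * (N p 0 2)%:C != 0.
  have [n1|n1] := eqVneq (N p 0 2) 1; last by exists 1; split; [left|rewrite pole1_neq0].
  by exists (-1); split; [right|rewrite n1 mulN1r opprK -(rmorph1 (real_complex R)) -rmorphD
    (fmorph_eq0 (real_complex R)) gt_eqF].
have sden : csmooth D (fun x => 1 - s * (N x 0 2)%:C).
  apply: (csmoothB oD (csmooth_cst D 1) (csmoothM oD (csmooth_cst D s) _)).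
  apply: csmooth_real; exact: (smooth_on_rV _ oD).1 (smooth_on_normal oD sf w0) 2.
pose U0 := D `&` [set x | 1 - s * (N x 0 2)%:C != 0].
have oU0 : open U0 by exact: open_neq0.
have U0p : U0 p by [].
have tay := holomorphic_taylor oD Dp hq ql.
set l := iter m _ _ p / _ in tay.
have l0 : l != 0 by rewrite mulf_neq0// invr_eq0 pnatr_eq0 -lt0n fact_gt0.
(* The zero of finite order is isolated because [q / z^m] has the nonzero limit [l]. *)
have q0near : \forall x \near p^', q x != 0.
  have [tr ti] := tay.
  have c : (csq (q x / zcoord p x ^+ m) : R^o) @[x --> p^'] --> (csq l : R^o).
    exact: (cvgD (cvgM tr tr) (cvgM ti ti)).
  have cl : 0 < csq l by rewrite lt_def csq_ge0 csq_eq0 l0.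
  have H : \forall x \near p^', 0 < csq (q x / zcoord p x ^+ m) by exact: (cvgr_gt _ c _ cl).
  apply: filterS H => y; apply: contraTneq => ->.
  by rewrite mul0r /csq /= mulr0 addr0 ltxx.
have q0near' : \forall x \near nbhs p, x != p -> q x != 0 by exact: q0near.
pose U := U0 `&` (fun x => x != p -> q x != 0)^°.
have oU : open U by apply: openI => //; exact: open_interior.
have UD : U `<=` D by move=> x [[]].
have Up : U p by split=> //.
have away x : U x -> 1 - s * (N x 0 2)%:C != 0 by move=> [[_]].
have qU x : (U `&` [set x | x != p]) x -> q x != 0.
  by move=> [[_ /interior_subset H] /= xp]; exact: H.
have ss : s * s = 1 by case: s1 => ->; rewrite ?mulr1// mulrNN mulr1.
have oU' : open (U `&` [set x | x != p]) by exact: open_D'.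
have sUD' : (U `&` [set x | x != p]) `<=` D by move=> x [/UD].
apply: (entropy_ratio oU Up (holomorphic_sub UD hq)
  (csmooth_stereo_weight oD sf w0 conf oU UD away) ql qm qU
  (fun x Ux => stereo_weight_neq0 w0 conf ss UD away Ux)
  (fun x Ux => connection_coef_flat oU' sUD' Ux qU) _ m0).
- by move=> x Ux; exact: schwarzian_sphere_map s1 oU UD away Ux.1 (qU x Ux).
- by move=> x Ux; apply: PE (qU x Ux); exact: sUD'.
Qed.

End local_entropy.

(** * Existence of isothermal coordinates *)

Section slices.
Context {R : realType}.
Local Notation pt := 'rV[R]_2.
Implicit Types (D U : set pt) (x p : pt) (u : pt -> R^o) (s t b : R).

Definition mkpt t b : pt := \row_j (if j == 0 then t else b).

Lemma mkptE x : mkpt (x 0 0) (x 0 1) = x.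
Proof. by apply: rV2E; rewrite !mxE. Qed.

Lemma mkpt0 t b : mkpt t b 0 0 = t. Proof. by rewrite mxE. Qed.
Lemma mkpt1 t b : mkpt t b 0 1 = b. Proof. by rewrite mxE. Qed.

Let shift0 (h : R) t b : h *: delta_mx 0 0 + mkpt t b = mkpt (h *: 1 + t) b.
Proof. by apply: rV2E; rewrite !mxE /= ?mulr0 ?add0r// /GRing.scale/=. Qed.

Let shift1 (h : R) t b : h *: delta_mx 0 1 + mkpt t b = mkpt t (h *: 1 + b).
Proof. by apply: rV2E; rewrite !mxE /= ?mulr0 ?add0r// /GRing.scale/=. Qed.

Let quot0 u t b : (fun h : R => h^-1 *: (u (h *: delta_mx 0 0 + mkpt t b) - u (mkpt t b)))
  = (fun h : R => h^-1 *: (u (mkpt (h *: 1 + t) b) - u (mkpt t b))).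
Proof. by apply/funext => h; rewrite shift0. Qed.

Let quot1 u t b : (fun h : R => h^-1 *: (u (h *: delta_mx 0 1 + mkpt t b) - u (mkpt t b)))
  = (fun h : R => h^-1 *: (u (mkpt t (h *: 1 + b)) - u (mkpt t b))).
Proof. by apply/funext => h; rewrite shift1. Qed.

Lemma is_derive_slice0 u t b (l : R) :
  is_derive t 1 (fun t => u (mkpt t b) : R^o) l <-> is_derive (mkpt t b) (delta_mx 0 0) u l.
Proof.
split=> -[d <-]; apply: DeriveDef.
- by move: d; rewrite /derivable quot0.
- by rewrite /derive quot0.
- by move: d; rewrite /derivable quot0.
- by rewrite /derive quot0.
Qed.

Lemma is_derive_slice1 u t b (l : R) :
  is_derive b 1 (fun b => u (mkpt t b) : R^o) l <-> is_derive (mkpt t b) (delta_mx 0 1) u l.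
Proof.
split=> -[d <-]; apply: DeriveDef.
- by move: d; rewrite /derivable quot1.
- by rewrite /derive quot1.
- by move: d; rewrite /derivable quot1.
- by rewrite /derive quot1.
Qed.

Lemma smooth_slice D u i x : smooth_on D u -> D x -> is_derive x (delta_mx 0 i) u (pd i u x).
Proof. by move=> su Dx; apply: DeriveDef => //; exact: smooth_on_derivable su Dx. Qed.

Lemma smooth_slice0 D u t b : smooth_on D u -> D (mkpt t b) ->
  is_derive t 1 (fun t => u (mkpt t b) : R^o) (pd 0 u (mkpt t b)).
Proof. by move=> su Dx; apply/is_derive_slice0; exact: smooth_slice su Dx. Qed.

Lemma smooth_slice1 D u t b : smooth_on D u -> D (mkpt t b) ->
  is_derive b 1 (fun b => u (mkpt t b) : R^o) (pd 1 u (mkpt t b)).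
Proof. by move=> su Dx; apply/is_derive_slice1; exact: smooth_slice su Dx. Qed.

Lemma is_derive_continuous (g : R -> R^o) t l : is_derive t 1 g l -> {for t, continuous g}.
Proof.
by move=> [d _]; apply: differentiable_continuous; exact/derivable1_diffP.
Qed.

Lemma is_derive_of_derive1 (g : R -> R^o) t l : derivable g t 1 -> derive1 g t = l -> is_derive t 1 g l.
Proof. by move=> dg gl; apply: DeriveDef dg _; rewrite -derive1E. Qed.

Lemma near_cvg T (F : set_system T) {FF : Filter F} (g h : T -> R^o) (l : R^o) :
  (\forall t \near F, g t = h t) -> g t @[t --> F] --> l -> h t @[t --> F] --> l.
Proof. by move=> gh; apply: cvg_trans; exact: near_eq_cvg. Qed.

(** Apart from continuity of [u] itself this is the definition of smoothness; the continuity comes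
    from the mean value theorem and the continuity of the [a j]. *)
Lemma smooth_of_partials D u (a : 'I_2 -> pt -> R^o) : open D ->
  (forall i x, D x -> is_derive x (delta_mx 0 i) u (a i x)) ->
  (forall i, smooth_on D (a i)) -> smooth_on D u.
Proof.
move=> oD du sa.
have cu x : D x -> {for x, continuous u}.
  move=> Dx; have [e /= e0 eD] := (nbhs_ballP _ _).1 (open_nbhs_nbhs (conj oD Dx)).
  have [|xi bxi Exi] := @in_box_choice R pt (fun y => ball x e y) u id x.
    by move=> y By z i b; have [] := du i z (eD _ (ball_in_box (ballxx _ e0) By b)).
  have idx : y @[y --> x] --> x by exact: cvg_id.
  have Bn : \forall y \near x, ball x e y by exact: nbhsx_ballx.
  have xi_cvg j : (pd j u (xi j y) * (y 0 j - x 0 j) : R^o) @[y --> x] --> (a j x * 0 : R^o).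
    have c1 : xi j y @[y --> x] --> x by exact: (in_box_cvg idx (bxi j)).
    have c2 : (a j (xi j y) : R^o) @[y --> x] --> (a j x : R^o).
      exact: (cvg_comp _ _ c1 (smooth_on_continuous (sa j) Dx)).
    have c3 : (pd j u (xi j y) : R^o) @[y --> x] --> (a j x : R^o).
      apply: (near_cvg (F := nbhs x) _ c2); apply: filterS Bn => y By.
      by have [_ <-] := du j _ (eD _ (ball_in_box (ballxx _ e0) By (bxi j y))).
    have c4 : (coordf j y - coordf j x : R^o) @[y --> x] --> (0 : R^o).
      have c5 : (coordf j y : R^o) @[y --> x] --> (coordf j x : R^o) by exact: coordf_continuous.
      have := cvgB c5 (@cvg_cst _ (coordf j x) _ (nbhs x) _); rewrite subrr; exact.
    exact: (cvgM c3 c4).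
  have c3 : (\sum_j pd j u (xi j y) * (y 0 j - x 0 j) : R^o) @[y --> x] --> (a 0 x * 0 + a 1 x * 0 : R^o).
    by under eq_fun do rewrite sum_ord2; exact: (cvgD (xi_cvg 0) (xi_cvg 1)).
  have c4 : (\sum_j pd j u (xi j y) * (y 0 j - x 0 j) + u x : R^o) @[y --> x]
      --> (a 0 x * 0 + a 1 x * 0 + u x : R^o).
    exact: (cvgD c3 (@cvg_cst _ (u x) _ (nbhs x) _)).
  rewrite !mulr0 !add0r in c4; apply: (near_cvg (F := nbhs x) _ c4).
  by apply: filterS Bn => y By; rewrite /= -Exi// subrK.
case=> [|k]; split=> // i; split=> [x Dx|]; first by have [] := du i x Dx.
by apply: class_C_eq oD _ (sa i k) => x Dx; have [_ <-] := du i x Dx.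
Qed.

End slices.

(** * The Poincare lemma on a square *)

Section poincare.
Context {R : realType}.
Local Notation pt := 'rV[R]_2.
Local Notation mu := (@lebesgue_measure R).
Variables (D : set pt) (p : pt) (a : 'I_2 -> pt -> R^o).
Hypothesis sa : forall i, smooth_on D (a i).
Hypothesis closed_form : forall x, D x -> pd 0 (a 1) x = pd 1 (a 0) x.

Variables (r M : R).
Hypothesis r0 : 0 < r.
Let c (j : 'I_2) := p 0 j - r.
Let d (j : 'I_2) := p 0 j + r.
Hypothesis boxD : forall x : pt, (forall j, c j <= x 0 j <= d j) -> D x.
Hypothesis boxM : forall x : pt, (forall j, c j <= x 0 j <= d j) -> `|pd 0 (a 1) x| <= M.

Let boxmk t b : c 0 <= t <= d 0 -> c 1 <= b <= d 1 -> D (mkpt t b).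
Proof. by move=> h0 h1; apply: boxD => j; case: (ord2P j) => ->; rewrite ?mkpt0 ?mkpt1. Qed.

(** The integral of the form along a two-sided path from the lower left corner: along the bottom
    side, then vertically up to [x]. *)
Definition primitive (x : pt) : R^o :=
  (\int[mu]_(t in `[c 0, x 0 0]) a 0 (mkpt t (c 1)))%R +
  (\int[mu]_(t in `[c 1, x 0 1]) a 1 (mkpt (x 0 0) t))%R.

Let cd j : c j < d j.
Proof. by rewrite /c /d ltrD2l (lt_trans _ r0)// oppr_lt0. Qed.

Let integrable_slice0 i b t : c 1 <= b <= d 1 -> t <= d 0 ->
  mu.-integrable `[c 0, t] (EFin \o (fun t => a i (mkpt t b))).
Proof.
move=> hb ht; apply: continuous_compact_integrable; first exact: segment_compact.
apply: continuous_in_subspaceT => s; rewrite inE/= in_itv/= => /andP[s1 s2].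
have Ds : D (mkpt s b) by apply: boxmk => //; rewrite s1 (le_trans s2).
exact: is_derive_continuous (smooth_slice0 (sa i) Ds).
Qed.

Let integrable_slice1 i t b : c 0 <= t <= d 0 -> b <= d 1 ->
  mu.-integrable `[c 1, b] (EFin \o (fun b => a i (mkpt t b))).
Proof.
move=> ht hb; apply: continuous_compact_integrable; first exact: segment_compact.
apply: continuous_in_subspaceT => s; rewrite inE/= in_itv/= => /andP[s1 s2].
have Ds : D (mkpt t s) by apply: boxmk => //; rewrite s1 (le_trans s2).
exact: is_derive_continuous (smooth_slice1 (sa i) Ds).
Qed.

Lemma primitive_pd1 (x : pt) : (forall j, c j < x 0 j < d j) ->
  is_derive x (delta_mx 0 1) primitive (a 1 x).
Proof.
move=> hx; have /andP[a0 b0] := hx 0; have /andP[a1 b1] := hx 1.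
rewrite -[x]mkptE; apply/is_derive_slice1; rewrite /primitive.
have Dx : D (mkpt (x 0 0) (x 0 1)) by apply: boxmk; rewrite !ltW.
have i1 : mu.-integrable `[c 1, d 1] (EFin \o (fun b => a 1 (mkpt (x 0 0) b))).
  by apply: integrable_slice1; rewrite ?lexx ?ltW.
have [dF eF] := continuous_FTC1_closed b1 i1 a1 (is_derive_continuous (smooth_slice1 (sa 1) Dx)).
have isF : is_derive (x 0 1) 1 (fun y => (\int[mu]_(t in `[c 1, y]) a 1 (mkpt (x 0 0) t))%R : R^o)
   (a 1 (mkpt (x 0 0) (x 0 1))).
  exact: is_derive_of_derive1 dF eF.
have isC : is_derive (x 0 1) 1 (fun _ => (\int[mu]_(t in `[c 0, x 0 0]) a 0 (mkpt t (c 1)))%R : R^o) 0.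
  exact: is_derive_cst.
have := is_deriveD isC isF; rewrite add0r.
by congr (is_derive _ _ _ _); apply/funext => y /=; rewrite !mkpt0 mkpt1.
Qed.

(** Differentiating the vertical integral under the integral sign, with [M] as dominating constant,
    gives the integral of [pd 0 (a 1)]. By closedness this is the integral of [pd 1 (a 0)], that is
    [a 0] at [x] minus its value on the bottom side, which the horizontal integral contributes. *)
Lemma primitive_pd0 (x : pt) : (forall j, c j < x 0 j < d j) ->
  is_derive x (delta_mx 0 0) primitive (a 0 x).
Proof.
move=> hx; have /andP[a0 b0] := hx 0; have /andP[a1 b1] := hx 1.
rewrite -[x]mkptE; apply/is_derive_slice0; rewrite /primitive.
have Dx : D (mkpt (x 0 0) (x 0 1)) by apply: boxmk; rewrite !ltW.
have Dc : D (mkpt (x 0 0) (c 1)) by apply: boxmk; rewrite ?lexx !ltW ?cd.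
have i0 : mu.-integrable `[c 0, d 0] (EFin \o (fun t => a 0 (mkpt t (c 1)))).
  by apply: integrable_slice0; rewrite ?lexx ?ltW ?cd.
have [dF eF] := continuous_FTC1_closed b0 i0 a0 (is_derive_continuous (smooth_slice0 (sa 0) Dc)).
have isF : is_derive (x 0 0) 1 (fun y => (\int[mu]_(t in `[c 0, y]) a 0 (mkpt t (c 1)))%R : R^o)
   (a 0 (mkpt (x 0 0) (c 1))).
  exact: is_derive_of_derive1 dF eF.
have Ix : `]c 0, d 0[%classic (x 0 0) by rewrite /= in_itv/= a0 b0.
pose B : set (measurableTypeR R) := `[c 1, x 0 1]%classic.
pose f t b := a 1 (mkpt t b).
have mB : measurable B by exact: measurable_itv.
have itvI t : `]c 0, d 0[%classic t -> c 0 <= t <= d 0.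
  by rewrite /= in_itv/= => /andP[h1 h2]; rewrite !ltW.
have itvB b : B b -> c 1 <= b <= d 1.
  by rewrite /B /= in_itv/= => /andP[-> h]; rewrite (le_trans h) ?ltW.
have intf t : `]c 0, d 0[%classic t -> mu.-integrable B (EFin \o f t).
  by move=> It; apply: integrable_slice1; [exact: itvI|rewrite ltW].
have isf t b : `]c 0, d 0[%classic t -> B b -> is_derive t 1 (fun t => f t b : R^o) (pd 0 (a 1) (mkpt t b)).
  by move=> It Bb; apply: smooth_slice0 (sa 1) _; apply: boxmk; [exact: itvI|exact: itvB].
have derf t b : `]c 0, d 0[%classic t -> B b -> derivable (fun t => f t b : R^o) t 1.
  by move=> It Bb; have [] := isf t b It Bb.
have d1f t b : `]c 0, d 0[%classic t -> B b -> partial1of2 f t b = pd 0 (a 1) (mkpt t b).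
  by move=> It Bb; rewrite partial1of2E; have [_ ->] := isf t b It Bb.
have M0 : 0 <= M.
  apply: le_trans (normr_ge0 _) (boxM (x := x) _) => j.
  by have /andP[h1 h2] := hx j; rewrite !ltW.
have intG : mu.-integrable B (EFin \o (fun _ : R => M)).
  apply: continuous_compact_integrable; first exact: segment_compact.
  by apply: continuous_subspaceT => ?; exact: cvg_cst.
have Gub t b : `]c 0, d 0[%classic t -> B b -> `|partial1of2 f t b| <= M.
  move=> It Bb; rewrite d1f//; apply: boxM => j.
  by case: (ord2P j) => ->; rewrite ?mkpt0 ?mkpt1; [exact: itvI|exact: itvB].
have dI := @derivable_under_integral R _ _ mu f B mB _ _ _ Ix intf derf _ (fun=> M0) intG Gub.
have eI := @differentiation_under_integral R _ _ mu f B mB _ _ _ Ix intf derf _ (fun=> M0) intG Gub.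
have ftc2 : (\int[mu]_(y in B) (partial1of2 f)^~ y (x 0 0))%R = a 0 x - a 0 (mkpt (x 0 0) (c 1)).
  have e1 : {in B, (fun y => partial1of2 f (x 0 0) y) =1 (fun y => pd 1 (a 0) (mkpt (x 0 0) y))}.
    move=> y /set_mem By; rewrite d1f// closed_form//.
    by apply: boxmk; [exact: itvI|exact: itvB].
  rewrite (eq_Rintegral _ e1) /Rintegral.
  pose F y := a 0 (mkpt (x 0 0) y).
  have isD y : c 1 <= y <= x 0 1 -> is_derive y 1 (F : R -> R^o) (pd 1 (a 0) (mkpt (x 0 0) y)).
    move=> hy; apply: smooth_slice1 (sa 0) _; apply: boxmk; first exact: itvI.
    by case/andP: hy => -> h; rewrite (le_trans h) ?ltW.
  have isD2 y : c 1 <= y <= x 0 1 ->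
      is_derive y 1 (fun y => pd 1 (a 0) (mkpt (x 0 0) y) : R^o) (pd 1 (pd 1 (a 0)) (mkpt (x 0 0) y)).
    move=> hy; apply: smooth_slice1 (smooth_on_pd 1 (sa 0)) _; apply: boxmk; first exact: itvI.
    by case/andP: hy => -> h; rewrite (le_trans h) ?ltW.
  rewrite (@continuous_FTC2 _ (fun y => pd 1 (a 0) (mkpt (x 0 0) y)) F (c 1) (x 0 1) a1).
  - by rewrite /F /= mkptE.
  - apply: continuous_in_subspaceT => s; rewrite inE/= in_itv/= => hs.
    exact: is_derive_continuous (isD2 s hs).
  - split.
    + by move=> y; rewrite in_itv/= => /andP[h1 h2]; have [] := isD y _; rewrite ?(ltW h1) ?(ltW h2).
    + by apply: cvg_at_right_filter; apply: is_derive_continuous (isD _ _); rewrite lexx ltW.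
    + by apply: cvg_at_left_filter; apply: is_derive_continuous (isD _ _); rewrite lexx ltW.
  - move=> y; rewrite in_itv/= => /andP[h1 h2]; rewrite derive1E.
    have hy : c 1 <= y <= x 0 1 by rewrite !ltW.
    by have [_ ->] := isD y hy.
have isI : is_derive (x 0 0) 1 (fun t => (\int[mu]_(y in B) f t y)%R : R^o)
    (a 0 x - a 0 (mkpt (x 0 0) (c 1))).
  by apply: is_derive_of_derive1 dI _; rewrite eI.
have addE (s t : R) : s + (t - s) = t by rewrite addrC subrK.
have := is_deriveD isF isI; rewrite [X in is_derive _ _ _ X]addE mkptE.
by congr (is_derive _ _ _ _); apply/funext => y /=; rewrite !mkpt0 mkpt1.
Qed.

End poincare.

Lemma poincare_lemma {R : realType} (D : set 'rV[R]_2) (p : 'rV[R]_2) (a : 'I_2 -> 'rV[R]_2 -> R^o) :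
  open D -> D p -> (forall i, smooth_on D (a i)) ->
  (forall x, D x -> pd 0 (a 1) x = pd 1 (a 0) x) ->
  exists U (u : 'rV[R]_2 -> R^o), [/\ open U, U p, U `<=` D, smooth_on U u &
    forall i x, U x -> pd i u x = a i x].
Proof.
move=> oD Dp sa cl.
have c : {for p, continuous (pd 0 (a 1))} by exact: smooth_on_continuous (smooth_on_pd 0 (sa 1)) Dp.
have cn : (`|pd 0 (a 1) y| : R^o) @[y --> p] --> (`|pd 0 (a 1) p| : R^o) by exact: (cvg_norm c).
have H1 : \forall y \near p, `|pd 0 (a 1) y| < `|pd 0 (a 1) p| + 1.
  have lt1 : `|pd 0 (a 1) p| < `|pd 0 (a 1) p| + 1 by rewrite ltrDl.
  exact: (cvgr_lt _ cn _ lt1).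
have H2 : \near p, D p by exact: open_nbhs_nbhs.
have [e /= e0 He] := (nbhs_ballP _ _).1 (filterI H1 H2).
have r0 : 0 < e / 2 by rewrite divr_gt0.
have inball (x : 'rV[R]_2) : (forall j, p 0 j - e / 2 <= x 0 j <= p 0 j + e / 2) -> ball p e x.
  move=> hx; apply/ball_rVE => // j; have /andP[h1 h2] := hx j.
  by apply: (@le_lt_trans _ _ (e / 2)); [rewrite ler_norml; lra|lra].
have boxD (x : 'rV[R]_2) : (forall j, p 0 j - e / 2 <= x 0 j <= p 0 j + e / 2) -> D x.
  by move=> hx; have [] := He x (inball x hx).
have boxM (x : 'rV[R]_2) : (forall j, p 0 j - e / 2 <= x 0 j <= p 0 j + e / 2) ->
    `|pd 0 (a 1) x| <= `|pd 0 (a 1) p| + 1.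
  by move=> hx; have [/ltW h] := He x (inball x hx).
pose U := ball p (e / 2).
have inbox (x : 'rV[R]_2) : U x -> forall j, p 0 j - e / 2 < x 0 j < p 0 j + e / 2.
  by move=> /ball_rVE H j; have := H r0 j; rewrite ltr_norml => /andP[h1 h2]; apply/andP; split; lra.
have UD : U `<=` D.
  by move=> x /inbox hx; apply: boxD => j; have /andP[h1 h2] := hx j; rewrite !ltW.
have oU : open U by exact: ball_open.
have dU i (x : 'rV[R]_2) : U x -> is_derive x (delta_mx 0 i) (primitive p a (e / 2)) (a i x).
  move=> Ux; case: (ord2P i) => ->.
  - exact: (primitive_pd0 sa cl r0 boxD boxM (inbox x Ux)).
  - exact: (primitive_pd1 sa boxD (inbox x Ux)).
exists U, (primitive p a (e / 2)); split=> //.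
- exact: ballxx.
- apply: (smooth_of_partials oU dU) => i; exact: smooth_on_sub UD (sa i).
- by move=> i x Ux; have [_ <-] := dU i x Ux.
Qed.

(** * Vector algebra of a coordinate function and its conjugate *)

Section conjugate_coordinate.
Context {R : realType}.
Local Notation E3 := 'rV[R]_3.
Implicit Types (a b u v w n : E3) (k : 'I_3).

(** On the plane orthogonal to [w], the functionals [u_k] and [(w x u)_k] are, up to the length of
    [w] and a sign, pairings with the tangential part of the [k]-th basis vector and with its
    quarter turn. Their combination is therefore a multiple of the metric. *)
Lemma cross_orthogonal_coord w u v k : dot u w = 0 -> dot v w = 0 ->
  dot w w * (u 0 k * v 0 k) + cross w u 0 k * cross w v 0 k
  = (dot w w - w 0 k ^+ 2) * dot u v.
Proof.
move=> uw vw.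
have -> : dot w w * (u 0 k * v 0 k) + cross w u 0 k * cross w v 0 k
  = (dot w w - w 0 k ^+ 2) * dot u v
    - dot u w * dot v w + dot u w * (w 0 k * v 0 k) + dot v w * (w 0 k * u 0 k).
  by rewrite !dotE; case: (ord3P k) => ->; rewrite !crossE; ring.
by rewrite uw vw !mul0r subr0 !addr0.
Qed.

Lemma crossZlE (c : R) u v k : cross (c *: u) v 0 k = c * cross u v 0 k.
Proof. by rewrite !mxE; ring. Qed.

Lemma unit_cross_orthogonal_coord (c : R) w u v k : c ^+ 2 * dot w w = 1 ->
  dot u w = 0 -> dot v w = 0 ->
  u 0 k * v 0 k + cross (c *: w) u 0 k * cross (c *: w) v 0 k
  = (1 - (c * w 0 k) ^+ 2) * dot u v.
Proof.
move=> cw uw vw; rewrite !crossZlE.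
have E := cross_orthogonal_coord k uw vw.
have -> : (1 - (c * w 0 k) ^+ 2) * dot u v = c ^+ 2 * ((dot w w - w 0 k ^+ 2) * dot u v).
  by rewrite mulrA mulrBr cw exprMn.
rewrite -E; transitivity (c ^+ 2 * dot w w * (u 0 k * v 0 k) + c ^+ 2 * (cross w u 0 k * cross w v 0 k)).
  by rewrite cw; ring.
by ring.
Qed.

Lemma conjugate_det (c : R) a b k :
  a 0 k * - cross (c *: cross a b) b 0 k - - cross (c *: cross a b) a 0 k * b 0 k
  = c * (dot (cross a b) (cross a b) - cross a b 0 k ^+ 2).
Proof.
rewrite !crossZlE !dotE; case: (ord3P k) => ->; rewrite !crossE; ring.
Qed.

(** The difference of the two sides is tested on the frame [a], [b], [a x b]: the tangential
    components vanish because [n0] and [n1] are tangent, and the normal one is the mean curvature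
    numerator. *)
Lemma cross_weingarten a b n0 n1 : cross a b != 0 ->
  dot n0 (cross a b) = 0 -> dot n1 (cross a b) = 0 ->
  dot n0 a * dot b b - dot n0 b * dot a b + dot a a * dot n1 b - dot a b * dot n1 a = 0 ->
  cross n0 b = cross n1 a.
Proof.
move=> w0 h0 h1 tr; apply/eqP; rewrite -subr_eq0; apply/eqP.
have D v : dot (cross n0 b - cross n1 a) v = dot (cross n0 b) v - dot (cross n1 a) v.
  by rewrite -scaleN1r dotDl dotZl; ring.
apply: (orthogonal_frame_eq0 w0); rewrite D.
- have -> : dot (cross n0 b) a - dot (cross n1 a) a = - dot n0 (cross a b).
    by rewrite !dotE !crossE; ring.
  by rewrite h0 oppr0.
- have -> : dot (cross n0 b) b - dot (cross n1 a) b = - dot n1 (cross a b).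
    by rewrite !dotE !crossE; ring.
  by rewrite h1 oppr0.
- by rewrite -tr !dotE !crossE; ring.
Qed.

(** Some axis is not parallel to the normal, so the corresponding coordinate function has nonzero
    differential on the surface. *)
Lemma exists_transverse_coord w : w != 0 -> exists k, 0 < dot w w - w 0 k ^+ 2.
Proof.
move=> w0; have [w00|w00] := eqVneq (w 0 0) 0.
  exists 0; rewrite w00 expr0n subr0 lt_def dotvv_ge0 dotvv_eq0 w0//.
exists 1; rewrite dotE -!expr2.
have -> : w 0 0 ^+ 2 + w 0 1 ^+ 2 + w 0 2 ^+ 2 - w 0 1 ^+ 2 = w 0 0 ^+ 2 + w 0 2 ^+ 2 by ring.
by rewrite ltr_wpDr ?sqr_ge0// exprn_even_gt0.
Qed.

Lemma sub_coord_sqr_ge0 w k : 0 <= dot w w - w 0 k ^+ 2.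
Proof.
rewrite dotE -!expr2; case: (ord3P k) => ->.
- have -> : w 0 0 ^+ 2 + w 0 1 ^+ 2 + w 0 2 ^+ 2 - w 0 0 ^+ 2 = w 0 1 ^+ 2 + w 0 2 ^+ 2 by ring.
  by rewrite addr_ge0 ?sqr_ge0.
- have -> : w 0 0 ^+ 2 + w 0 1 ^+ 2 + w 0 2 ^+ 2 - w 0 1 ^+ 2 = w 0 0 ^+ 2 + w 0 2 ^+ 2 by ring.
  by rewrite addr_ge0 ?sqr_ge0.
- have -> : w 0 0 ^+ 2 + w 0 1 ^+ 2 + w 0 2 ^+ 2 - w 0 2 ^+ 2 = w 0 0 ^+ 2 + w 0 1 ^+ 2 by ring.
  by rewrite addr_ge0 ?sqr_ge0.
Qed.

End conjugate_coordinate.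

Section isothermal_coordinates.
Context {R : realType}.
Local Notation pt := 'rV[R]_2.
Local Notation E3 := 'rV[R]_3.
Variables (D : set pt) (f : pt -> E3).
Hypotheses (oD : open D) (sf : smooth_on D f).
Hypothesis w0 : forall x, D x -> cross (pd 0 f x) (pd 1 f x) != 0.
Local Notation N := (normal_map f).
Local Notation h := (second_fundamental f).
Local Notation g := (first_fundamental f).
Hypothesis mean0 : forall x, D x ->
  h x 0 0 * g x 1 1 - h x 0 1 * g x 0 1 + g x 0 0 * h x 1 1 - g x 0 1 * h x 1 0 = 0.
Implicit Types (x : pt) (k : 'I_3).

(** Hides the square root behind a scalar [c], known only by [c > 0] and [c^2 |w|^2 = 1], so that
    the later identities are polynomial. *)
Lemma normal_scale x : D x -> exists c : R, [/\ 0 < c,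
  c ^+ 2 * dot (cross (pd 0 f x) (pd 1 f x)) (cross (pd 0 f x) (pd 1 f x)) = 1 &
  N x = c *: cross (pd 0 f x) (pd 1 f x)].
Proof.
move=> Dx; have K (w : E3) : w != 0 -> exists c : R, [/\ 0 < c, c ^+ 2 * dot w w = 1 &
   (Num.sqrt (dot w w))^-1 *: w = c *: w].
  move=> n0; have ww : 0 < dot w w by rewrite lt_def dotvv_ge0 dotvv_eq0 n0.
  exists (Num.sqrt (dot w w))^-1; split=> //; first by rewrite invr_gt0 sqrtr_gt0.
  by rewrite exprVn sqr_sqrtr ?ltW// mulVf// lt0r_neq0.
exact: K (w0 Dx).
Qed.

(** The conjugate differential of the coordinate function [f_k], closed because [f_k] is harmonic on
    a minimal surface. The sign is the one that makes the Jacobian of the new coordinates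
    nonnegative. *)
Definition conjugate_form k (i : 'I_2) x : R^o := - cross (N x) (pd i f x) 0 k.

Lemma conjugate_form_smooth k i : smooth_on D (conjugate_form k i).
Proof.
have sN := (smooth_on_rV _ oD).1 (smooth_on_normal oD sf w0).
have sp := (smooth_on_rV _ oD).1 (smooth_on_pd i sf).
have s a b := smooth_onN oD (smooth_onB oD (smooth_onM oD (sN a) (sp b)) (smooth_onM oD (sN b) (sp a))).
rewrite /conjugate_form; case: (ord3P k) => ->.
- by apply: smooth_on_eq oD _ (s 1 2) => x _; rewrite crossE.
- by apply: smooth_on_eq oD _ (s 2 0) => x _; rewrite crossE.
- by apply: smooth_on_eq oD _ (s 0 1) => x _; rewrite crossE.
Qed.

Lemma pd_cross (u v : pt -> E3) k i x : D x -> smooth_on D u -> smooth_on D v ->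
  pd i (fun x => cross (u x) (v x) 0 k : R^o) x
  = cross (pd i u x) (v x) 0 k + cross (u x) (pd i v x) 0 k.
Proof.
move=> Dx su sv; have cu := (smooth_on_rV _ oD).1 su; have cv := (smooth_on_rV _ oD).1 sv.
have H a b : pd i (fun x => u x 0 a * v x 0 b - u x 0 b * v x 0 a : R^o) x
   = pd i u x 0 a * v x 0 b + u x 0 a * pd i v x 0 b - (pd i u x 0 b * v x 0 a + u x 0 b * pd i v x 0 a).
  have e := pdB i Dx (smooth_onM oD (cu a) (cv b)) (smooth_onM oD (cu b) (cv a)).
  have e1 := pdM i Dx (cu a) (cv b); have e2 := pdM i Dx (cu b) (cv a).
  have pu j := pd_rV i j Dx su; have pv j := pd_rV i j Dx sv.
  have K (t m1 m2 : R) (u1 v1 u' v' : E3) (p q : 'I_3 -> R) : t = m1 - m2 ->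
     m1 = p a * v1 0 b + u1 0 a * q b -> m2 = p b * v1 0 a + u1 0 b * q a ->
     (forall j, u' 0 j = p j) -> (forall j, v' 0 j = q j) ->
     t = u' 0 a * v1 0 b + u1 0 a * v' 0 b - (u' 0 b * v1 0 a + u1 0 b * v' 0 a).
    by move=> -> -> -> pE qE; rewrite !pE !qE.
  exact: K e e1 e2 pu pv.
have K (u1 v1 u' v' : E3) a b : u' 0 a * v1 0 b + u1 0 a * v' 0 b - (u' 0 b * v1 0 a + u1 0 b * v' 0 a)
  = (u' 0 a * v1 0 b - u' 0 b * v1 0 a) + (u1 0 a * v' 0 b - u1 0 b * v' 0 a) by ring.
case: (ord3P k) => ->; rewrite !crossE -K -H; apply: (pd_eq_on i oD Dx) => y _.
- exact: cross0E.
- exact: cross1E.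
- exact: cross2E.
Qed.

Lemma conjugate_form_closed k x : D x ->
  pd 0 (conjugate_form k 1) x = pd 1 (conjugate_form k 0) x.
Proof.
move=> Dx; have sN := smooth_on_normal oD sf w0.
have sC i : smooth_on D (fun x => cross (N x) (pd i f x) 0 k : R^o).
  by apply: smooth_on_eq oD _ (smooth_onN oD (conjugate_form_smooth k i)) => y _; rewrite opprK.
have e i j : pd j (conjugate_form k i) x = - (cross (pd j N x) (pd i f x) 0 k + cross (N x) (pd j (pd i f) x) 0 k).
  apply: etrans (pdN j Dx (sC i)) _; congr (- _).
  exact: (pd_cross k j Dx sN (smooth_on_pd i sf)).
have [c [c0 _ Nc]] := normal_scale Dx.
have nn i := dot_pd_normal_normal oD sf w0 i Dx.
have nw i : dot (pd i N x) (cross (pd 0 f x) (pd 1 f x)) = 0.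
  have K (m w n : E3) : dot m n = 0 -> n = c *: w -> dot m w = 0.
    by move=> mn nE; rewrite nE dotZr in mn; move/eqP: mn; rewrite mulf_eq0 (gt_eqF c0) => /eqP.
  exact: K (nn i) Nc.
have tr : dot (pd 0 N x) (pd 0 f x) * dot (pd 1 f x) (pd 1 f x) - dot (pd 0 N x) (pd 1 f x) * dot (pd 0 f x) (pd 1 f x)
  + dot (pd 0 f x) (pd 0 f x) * dot (pd 1 N x) (pd 1 f x) - dot (pd 0 f x) (pd 1 f x) * dot (pd 1 N x) (pd 0 f x) = 0.
  have m := mean0 Dx.
  have eh i j := second_fundamental_entry f x i j; have eg i j := first_fundamental_entry f x i j.
  have K (h00 h01 h10 h11 g00 g01 g11 a b c1 d1 a' b' c' : R) :
    h00 * g11 - h01 * g01 + g00 * h11 - g01 * h10 = 0 ->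
    h00 = - a -> h01 = - b -> h10 = - c1 -> h11 = - d1 -> g00 = a' -> g01 = b' -> g11 = c' ->
    a * c' - b * b' + a' * d1 - b' * c1 = 0.
    move=> e1 h0 h1 h2 h3 g0 g1 g2; rewrite h0 h1 h2 h3 g0 g1 g2 in e1.
    by apply/eqP; rewrite -oppr_eq0; apply/eqP; rewrite -e1; ring.
  exact: K m (eh 0 0) (eh 0 1) (eh 1 0) (eh 1 1) (eg 0 0) (eg 0 1) (eg 1 1).
have cw := cross_weingarten (w0 Dx) (nw 0) (nw 1) tr.
have f01 := pd_sym_rV 0 1 oD Dx sf.
have K (s t : R) (u v n a b : E3) : s = - (u 0 k + cross n a 0 k) -> t = - (v 0 k + cross n b 0 k) ->
  u = v -> a = b -> s = t.
  by move=> -> -> -> ->.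
exact: K (e 1 0) (e 0 1) cw f01.
Qed.

(* The coordinate function [f_k] and its conjugate [u], with [du = -(N x df)_k],
   are isothermal coordinates wherever [N_k^2 <> 1]. *)
Lemma isothermal_coordinates p : D p -> exists (U V : set pt) (psi phi : pt -> pt),
  [/\ open U, open V, U p, U `<=` D &
  [/\ forall x, U x -> V (psi x) /\ phi (psi x) = x,
      forall y, V y -> U (phi y) /\ psi (phi y) = y,
      smooth_on U psi /\ smooth_on V phi,
      (forall x, U x -> 0 < \det (partials psi x)) /\ (forall y, V y -> 0 < \det (partials phi y)) &
      forall y, V y -> first_fundamental (fun y => f (phi y)) y 0 0 = first_fundamental (fun y => f (phi y)) y 1 1
        /\ first_fundamental (fun y => f (phi y)) y 0 1 = 0]].
Proof.
move=> Dp; have [k kp] := exists_transverse_coord (w0 Dp).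
have [U1 [u [oU1 U1p U1D su du]]] := poincare_lemma oD Dp (conjugate_form_smooth k)
  (fun x Dx => conjugate_form_closed k Dx).
pose psi x := mkpt (f x 0 k) (u x).
have sfk := (smooth_on_rV _ oU1).1 (smooth_on_sub U1D sf) k.
have spsi : smooth_on U1 psi.
  apply/(smooth_on_rV _ oU1) => j; case: (ord2P j) => ->.
  - by apply: smooth_on_eq oU1 _ sfk => x _; rewrite mkpt0.
  - by apply: smooth_on_eq oU1 _ su => x _; rewrite mkpt1.
have P0 x i : U1 x -> partials psi x i 0 = pd i f x 0 k.
  move=> Ux; rewrite mxE (pd_rV i 0 Ux spsi).
  apply: etrans _ (esym (pd_rV i k (U1D _ Ux) sf)).
  by apply: (pd_eq_on i oU1 Ux) => y _; rewrite mkpt0.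
have P1 x i : U1 x -> partials psi x i 1 = conjugate_form k i x.
  move=> Ux; rewrite mxE (pd_rV i 1 Ux spsi).
  apply: etrans _ (du i x Ux).
  by apply: (pd_eq_on i oU1 Ux) => y _; rewrite mkpt1.
have detE x : U1 x -> exists2 c : R, 0 < c & \det (partials psi x) =
    c * (dot (cross (pd 0 f x) (pd 1 f x)) (cross (pd 0 f x) (pd 1 f x)) - cross (pd 0 f x) (pd 1 f x) 0 k ^+ 2).
  move=> Ux; have [c [c0 _ Nc]] := normal_scale (U1D _ Ux); exists c => //.
  have K (P : 'M[R]_2) (a b n : E3) : P 0 0 = a 0 k -> P 1 0 = b 0 k -> P 0 1 = - cross n a 0 k ->
     P 1 1 = - cross n b 0 k -> n = c *: cross a b ->
     \det P = c * (dot (cross a b) (cross a b) - cross a b 0 k ^+ 2).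
    by move=> e0 e1 e2 e3 e4; rewrite det_mx22 e0 e1 e2 e3 e4 conjugate_det.
  exact: K (P0 x 0 Ux) (P0 x 1 Ux) (P1 x 0 Ux) (P1 x 1 Ux) Nc.
have detp : \det (partials psi p) != 0.
  by have [c c0 ->] := detE p U1p; rewrite mulf_neq0// gt_eqF.
have [U [V [phi [oU oV Up UU1 [psiK phiK det0 sphi]]]]] := inverse_function oU1 U1p spsi detp.
(* The formula [detE] gives a nonnegative determinant, and the inverse function theorem excludes
   0. *)
have detpos x : U x -> 0 < \det (partials psi x).
  move=> Ux; have d0 := det0 x Ux; have [c c0 dE] := detE x (UU1 x Ux).
  have K (t s : R) : t != 0 -> 0 <= s -> t = c * s -> 0 < t.
    by move=> t0 s0 e; rewrite lt_def t0 e mulr_ge0// ltW.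
  exact: K d0 (sub_coord_sqr_ge0 _ k) dE.
have JP y : V y -> partials phi y *m partials psi (phi y) = 1%:M.
  move=> Vy; have [Uy _] := phiK y Vy.
  rewrite -(partials_comp oV oU Vy Uy (smooth_on_sub UU1 spsi) sphi).
  rewrite (partials_eq (g := fun y => y) oV Vy); last by move=> z Vz; have [] := phiK z Vz.
  apply/matrixP => i j; rewrite !mxE.
  have sid : smooth_on setT (fun y : pt => y).
    by apply/(smooth_on_rV _ openT) => l; exact: (@smooth_on_coordf R setT l).
  by rewrite (pd_rV i j (I : setT y) sid); exact: pd_coordf.
have detphi y : V y -> 0 < \det (partials phi y).
  move=> Vy; have [Uy _] := phiK y Vy; have := congr1 determinant (JP y Vy).
  rewrite det_mulmx det1 => e; have dp := detpos _ Uy.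
  by rewrite -(pmulr_lgt0 _ dp) e ltr01.
exists U, V, psi, phi; split=> //; first exact: subset_trans UU1 U1D.
split=> //; first by split=> //; exact: smooth_on_sub UU1 spsi.
move=> y Vy; have [Uy _] := phiK y Vy; have Dy := U1D _ (UU1 _ Uy).
have gE := first_fundamental_comp oV oD Vy Dy sf sphi.
have [c [c0 cw Nc]] := normal_scale Dy.
(* The Jacobian [P] of [psi] satisfies [P P^T = l g], and the Jacobian [J] of [phi] inverts it.
   Hence [l J g J^T] is the identity, and [J g J^T] is the metric in the new coordinates. *)
have PPT : partials psi (phi y) *m (partials psi (phi y))^T
   = (1 - (c * cross (pd 0 f (phi y)) (pd 1 f (phi y)) 0 k) ^+ 2) *: g (phi y).
  have K (P G : 'M[R]_2) (a b n : E3) : P 0 0 = a 0 k -> P 1 0 = b 0 k -> P 0 1 = - cross n a 0 k ->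
     P 1 1 = - cross n b 0 k -> n = c *: cross a b -> c ^+ 2 * dot (cross a b) (cross a b) = 1 ->
     G 0 0 = dot a a -> G 0 1 = dot a b -> G 1 0 = dot b a -> G 1 1 = dot b b ->
     P *m P^T = (1 - (c * cross a b 0 k) ^+ 2) *: G.
    move=> e0 e1 e2 e3 e4 ec g0 g1 g2 g3.
    have aw := dot_crossl a b; have bw := dot_crossr a b.
    have PE i j : (P *m P^T) i j = P i 0 * P j 0 + P i 1 * P j 1 by rewrite mxE sum_ord2 !mxE.
    apply/matrixP => i j; rewrite PE [RHS]mxE.
    by case: (ord2P i) (ord2P j) => -> [] ->;
      rewrite ?e0 ?e1 ?e2 ?e3 ?g0 ?g1 ?g2 ?g3 mulrNN e4 unit_cross_orthogonal_coord.
  have eg i j := first_fundamental_entry f (phi y) i j.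
  have Ux := UU1 _ Uy.
  exact: K (P0 _ 0 Ux) (P0 _ 1 Ux) (P1 _ 0 Ux) (P1 _ 1 Ux) Nc cw (eg 0 0) (eg 0 1) (eg 1 0) (eg 1 1).
have K (J P G H : 'M[R]_2) (l : R) : H = J *m G *m J^T -> P *m P^T = l *: G -> J *m P = 1%:M ->
   H 0 0 = H 1 1 /\ H 0 1 = 0.
  move=> HE PG JP1.
  have lH : l *: H = 1%:M.
    by rewrite HE scalemxAl scalemxAr -PG mulmxA JP1 mul1mx -trmx_mul JP1 trmx1.
  have E i j : l * H i j = (i == j)%:R.
    by have := congr1 (fun A : 'M[R]_2 => A i j) lH; rewrite !mxE.
  have l0 : l != 0 by apply/eqP => l0; have := E 0 0; rewrite l0 mul0r => /esym/eqP; rewrite oner_eq0.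
  by split; apply: (mulfI l0); rewrite !E ?mulr0.
exact: K gE PPT (JP y Vy).
Qed.

End isothermal_coordinates.

(** * Minimality and curvature under reparametrization *)

Section vector_reparametrization.
Context {R : realType}.
Local Notation pt := 'rV[R]_2.
Implicit Types (D E : set pt).

Lemma smooth_on_comp_rV n D E (f : pt -> 'rV[R]_n.+1) (tau : pt -> pt) : open D -> open E ->
  (forall x, D x -> E (tau x)) -> smooth_on E f -> smooth_on D tau ->
  smooth_on D (fun x => f (tau x)).
Proof.
move=> oD oE DE sf st; apply/(smooth_on_rV _ oD) => j.
exact: smooth_on_comp oD oE DE ((smooth_on_rV _ oE).1 sf j) st.
Qed.

Lemma partials_comp_pt D E (sigma tau : pt -> pt) x : open D -> open E ->
  D x -> E (tau x) -> smooth_on E sigma -> smooth_on D tau ->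
  \det (partials (fun y => sigma (tau y)) x) = \det (partials tau x) * \det (partials sigma (tau x)).
Proof.
by move=> oD oE Dx Ex ss st; rewrite (partials_comp oD oE Dx Ex ss st) det_mulmx.
Qed.

(** The second condition is the numerator of the mean curvature. It is polynomial in the two forms
    and available in any coordinates, before isothermal ones are known to exist. *)
Definition regular_minimal (f : pt -> 'rV[R]_3) x :=
  cross (pd 0 f x) (pd 1 f x) != 0 /\
  second_fundamental f x 0 0 * first_fundamental f x 1 1
  - second_fundamental f x 0 1 * first_fundamental f x 0 1
  + first_fundamental f x 0 0 * second_fundamental f x 1 1
  - first_fundamental f x 0 1 * second_fundamental f x 1 0 = 0.

Lemma first_fundamental_sym (f : pt -> 'rV[R]_3) x :
  first_fundamental f x 1 0 = first_fundamental f x 0 1.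
Proof.
exact: etrans (first_fundamental_entry f x 1 0)
  (etrans (dotC _ _) (esym (first_fundamental_entry f x 0 1))).
Qed.

Lemma regular_minimal_mean (f : pt -> 'rV[R]_3) x : row_free (partials f x) ->
  2^-1 * \tr (invmx (first_fundamental f x) *m second_fundamental f x) = 0 ->
  regular_minimal f x.
Proof.
move=> rf tr0; have cr := row_free_cross rf.
have c0 : cross (pd 0 f x) (pd 1 f x) != 0 by move: cr; rewrite !row_partials.
split=> //.
have d0 : \det (first_fundamental f x) != 0.
  by rewrite first_fundamentalE det_mulmx_tr dotvv_eq0.
have K (H G : 'M[R]_2) : \det G != 0 -> G 1 0 = G 0 1 -> 2^-1 * \tr (invmx G *m H) = 0 ->
    H 0 0 * G 1 1 - H 0 1 * G 0 1 + G 0 0 * H 1 1 - G 0 1 * H 1 0 = 0.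
  clear; move=> d0 sy /eqP; rewrite mulf_eq0 invr_eq0 pnatr_eq0 /= => /eqP t0.
  set B := invmx G *m H in t0.
  have HE : H = G *m B by rewrite mulKVmx// unitmxE unitfE.
  have e i j : H i j = G i 0 * B 0 j + G i 1 * B 1 j by rewrite HE mxE sum_ord2.
  have t0' : B 0 0 + B 1 1 = 0 by rewrite -t0 /mxtrace sum_ord2.
  have -> : H 0 0 * G 1 1 - H 0 1 * G 0 1 + G 0 0 * H 1 1 - G 0 1 * H 1 0
     = (G 0 0 * G 1 1 - G 0 1 * G 0 1) * (B 0 0 + B 1 1) by rewrite !e sy; ring.
  by rewrite t0' mulr0.
exact: K d0 (first_fundamental_sym f x) tr0.
Qed.

Lemma regular_minimal_comp D E (f : pt -> 'rV[R]_3) tau x : open D -> open E -> D x ->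
  (forall y, D y -> E (tau y)) -> smooth_on E f -> smooth_on D tau ->
  (forall x, E x -> regular_minimal f x) ->
  (forall y, D y -> 0 < \det (partials tau y)) ->
  regular_minimal (fun y => f (tau y)) x.
Proof.
move=> oD oE Dx DE sf st rm J0; have Ex := DE x Dx.
have w0 y (Ey : E y) := (rm y Ey).1.
have gE := first_fundamental_comp oD oE Dx Ex sf st.
have hE := second_fundamental_comp oD oE Dx DE sf st w0 J0.
split.
  have K (J : 'M[R]_2) (P Q : 'M[R]_(2, 3)) (a b a' b' : 'rV[R]_3) : Q = J *m P -> 0 < \det J ->
      row 0 P = a -> row 1 P = b -> row 0 Q = a' -> row 1 Q = b' ->
      cross a b != 0 -> cross a' b' != 0.
    move=> -> j0 <- <- <- <- c0; rewrite cross_mulmx scaler_eq0 negb_or c0 andbT.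
    by rewrite gt_eqF.
  exact: K (partials_comp oD oE Dx Ex sf st) (J0 x Dx) (row_partials _ _ 0) (row_partials _ _ 1)
    (row_partials _ _ 0) (row_partials _ _ 1) (w0 _ Ex).
have K (J G H G' H' : 'M[R]_2) : G' = J *m G *m J^T -> H' = J *m H *m J^T -> G 1 0 = G 0 1 ->
   H 0 0 * G 1 1 - H 0 1 * G 0 1 + G 0 0 * H 1 1 - G 0 1 * H 1 0 = 0 ->
   H' 0 0 * G' 1 1 - H' 0 1 * G' 0 1 + G' 0 0 * H' 1 1 - G' 0 1 * H' 1 0 = 0.
  clear; move=> -> -> sy e0.
  have e (B : 'M[R]_2) i j : (J *m B *m J^T) i j =
     (J i 0 * B 0 0 + J i 1 * B 1 0) * J j 0 + (J i 0 * B 0 1 + J i 1 * B 1 1) * J j 1.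
    by rewrite mxE sum_ord2 !mxE !sum_ord2.
  rewrite !e sy.
  (* The mean curvature numerator scales by the square of the Jacobian determinant. *)
  transitivity ((J 0 0 * J 1 1 - J 0 1 * J 1 0) ^+ 2 *
    (H 0 0 * G 1 1 - H 0 1 * G 0 1 + G 0 0 * H 1 1 - G 0 1 * H 1 0)); last by rewrite e0 mulr0.
  by ring.
exact: K gE hE (first_fundamental_sym f _) (rm _ Ex).2.
Qed.

Lemma gauss_curvature_comp D E (f : pt -> 'rV[R]_3) tau x : open D -> open E -> D x ->
  (forall y, D y -> E (tau y)) -> smooth_on E f -> smooth_on D tau ->
  (forall x, E x -> cross (pd 0 f x) (pd 1 f x) != 0) ->
  (forall y, D y -> 0 < \det (partials tau y)) ->
  \det (second_fundamental (fun y => f (tau y)) x) / \det (first_fundamental (fun y => f (tau y)) x)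
  = \det (second_fundamental f (tau x)) / \det (first_fundamental f (tau x)).
Proof.
move=> oD oE Dx DE sf st w0 J0; have Ex := DE x Dx.
rewrite (first_fundamental_comp oD oE Dx Ex sf st) (second_fundamental_comp oD oE Dx DE sf st w0 J0).
rewrite !det_mulmx det_tr; have j0 : \det (partials tau x) != 0 by rewrite gt_eqF// J0.
have K (j a b : R) : j != 0 -> j * a * j / (j * b * j) = a / b.
  move=> n0; have -> : j * a * j = j * j * a by ring.
  have -> : j * b * j = j * j * b by ring.
  by rewrite -mulf_div mulfV ?mul1r// mulf_neq0.
exact: K.
Qed.

Lemma near_second_fundamental_eq D (f1 f2 : pt -> 'rV[R]_3) x : open D -> D x ->
  (forall y, D y -> f1 y = f2 y) ->
  first_fundamental f1 x = first_fundamental f2 x /\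
  second_fundamental f1 x = second_fundamental f2 x.
Proof.
move=> oD Dx ff; have pE y i : D y -> pd i f1 y = pd i f2 y by move=> Dy; exact: pd_eq_on oD Dy ff.
have nE y : D y -> normal_map f1 y = normal_map f2 y.
  have K (a b a' b' : 'rV[R]_3) : a = a' -> b = b' ->
    (Num.sqrt (dot (cross a b) (cross a b)))^-1 *: cross a b =
    (Num.sqrt (dot (cross a' b') (cross a' b')))^-1 *: cross a' b' by move=> -> ->.
  by move=> Dy; exact: K (pE y 0 Dy) (pE y 1 Dy).
have nEx i := pd_eq_on i oD Dx nE.
split; apply/matrixP => i j.
  exact: etrans (first_fundamental_entry f1 x i j)
    (etrans (congr2 (@dot R) (pE x i Dx) (pE x j Dx)) (esym (first_fundamental_entry f2 x i j))).
apply: etrans (second_fundamental_entry f1 x i j) (etrans _ (esym (second_fundamental_entry f2 x i j))).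
have K (u v u' v' : 'rV[R]_3) : u = u' -> v = v' -> - dot u v = - dot u' v' by move=> -> ->.
exact: K (nEx i) (pE x j Dx).
Qed.

Lemma regular_minimal_eq D (f1 f2 : pt -> 'rV[R]_3) x : open D -> D x ->
  (forall y, D y -> f1 y = f2 y) -> regular_minimal f1 x -> regular_minimal f2 x.
Proof.
move=> oD Dx ff; have [gE hE] := near_second_fundamental_eq oD Dx ff.
have p0 := pd_eq_on 0 oD Dx ff; have p1 := pd_eq_on 1 oD Dx ff.
by rewrite /regular_minimal gE hE p0 p1.
Qed.

End vector_reparametrization.

(** * Charts of a minimal surface *)

Section charts.
Context {R : realType} {M : topologicalType}.
Variables (A : set (chart R M)) (X : M -> 'rV[R]_3).
Hypotheses (hA : oriented_surface A) (hX : minimal_immersion A X).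
Implicit Types (c d e : chart R M) (p : M) (x : 'rV[R]_2).
Local Notation pt := 'rV[R]_2.

Lemma overlap_open c d : open (overlap c d).
Proof.
by apply: openI_preimage; [exact: ch_im_open|exact: ch_dom_open|exact: ch_inv_continuous].
Qed.

Lemma transition_im c d x : overlap c d x -> ch_im d (transition c d x).
Proof. by case=> _; exact: ch_map_im. Qed.

Lemma local_rep_transition c d x : overlap c d x ->
  local_rep X c x = local_rep X d (transition c d x).
Proof. by case=> _ dx; rewrite /local_rep /transition ch_mapK. Qed.

Lemma overlap_chart c d p : ch_dom c p -> ch_dom d p -> overlap c d (c p).
Proof. by move=> cp dp; split; [exact: ch_map_im|rewrite /preimage /= ch_mapK]. Qed.

Lemma atlas_oriented c : A c -> oriented_chart A c.
Proof.
have [_ _ _ [_ tr]] := hA.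
by move=> Ac d Ad; split; exact: tr.
Qed.

Lemma atlas_cover p : exists2 d, A d & ch_dom d p.
Proof. by have [_ _ _ [cov _]] := hA; exact: cov. Qed.

Lemma atlas_regular d : A d -> smooth_on (ch_im d) (local_rep X d) /\
  forall x, ch_im d x -> regular_minimal (local_rep X d) x.
Proof.
move=> Ad; have [s H] := hX Ad; split=> // x dx; have [rf mc] := H x dx.
exact: regular_minimal_mean rf mc.
Qed.

(** Smoothness and minimality are assumed only in the charts of [A]; any other oriented chart is
    locally a reparametrization of one of them. *)
Lemma chart_regular c : oriented_chart A c -> smooth_on (ch_im c) (local_rep X c) /\
  forall x, ch_im c x -> regular_minimal (local_rep X c) x.
Proof.
move=> oc.
have H x : ch_im c x -> exists2 d, A d & overlap c d x.
  by move=> cx; have [d Ad dp] := atlas_cover (ch_inv c x); exists d.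
split=> [|x cx].
  apply: smooth_on_local => x cx; have [d Ad ov] := H x cx.
  have [[st _] _] := oc d Ad; have [sf _] := atlas_regular Ad.
  exists (overlap c d); split=> //.
  apply: (smooth_on_eq (@overlap_open c d) _ (smooth_on_comp_rV (@overlap_open c d)
    (@ch_im_open R M d) (@transition_im c d) sf st)) => y ovy.
  by rewrite (local_rep_transition ovy).
have [d Ad ov] := H x cx.
have [[st J0] _] := oc d Ad; have [sf rm] := atlas_regular Ad.
apply: (regular_minimal_eq (@overlap_open c d) ov _ (regular_minimal_comp (@overlap_open c d)
    (@ch_im_open R M d) ov (@transition_im c d) sf st rm J0)) => y ovy.
by rewrite -local_rep_transition.
Qed.

Lemma gauss_curvature_atlas c d p : oriented_chart A c -> A d -> ch_dom c p -> ch_dom d p ->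
  gauss_curvature X c (c p) = gauss_curvature X d (d p).
Proof.
move=> oc Ad cp dp; have ov := overlap_chart cp dp.
have [[st J0] _] := oc d Ad; have [sf rm] := atlas_regular Ad.
have w0 y (Ey : ch_im d y) := (rm y Ey).1.
have e := gauss_curvature_comp (@overlap_open c d) (@ch_im_open R M d) ov (@transition_im c d) sf st w0 J0.
have tE : transition c d (c p) = d p by rewrite /transition ch_mapK.
have [gE hE] := near_second_fundamental_eq (@overlap_open c d) ov (@local_rep_transition c d).
rewrite tE in e; apply: etrans e.
by rewrite -gE -hE.
Qed.

(** By definition oriented charts are compatible with those of [A], so two of them are compared
    through a chart of [A] around [p]. *)
Lemma umbilicE c p : oriented_chart A c -> ch_dom c p ->
  umbilic A X p <-> gauss_curvature X c (c p) = 0.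
Proof.
move=> oc cp; split=> [[d od [dp K0]]|K0]; last by exists c.
have [e Ae ep] := atlas_cover p.
by rewrite (gauss_curvature_atlas oc Ae cp ep) -(gauss_curvature_atlas od Ae dp ep).
Qed.

End charts.

(** * Holomorphic charts and the order of the Hopf differential *)

Section holomorphic_charts.
Context {R : realType} {M : topologicalType}.
Variables (A : set (chart R M)) (X : M -> 'rV[R]_3).
Hypotheses (hA : oriented_surface A) (hX : minimal_immersion A X).
Implicit Types (c d e : chart R M) (p : M) (x : 'rV[R]_2).
Local Notation pt := 'rV[R]_2.

Lemma holomorphic_chart_exists p : exists2 c, holomorphic_chart A X c & ch_dom c p.
Proof.
have [d Ad dp] := atlas_cover hA p; have [sf rm] := atlas_regular hX Ad.
have oD := @ch_im_open R M d.
have [U [V [psi [phi [oU oV Up UD [psiK phiK [spsi sphi] [dpsi dphi] conf]]]]]] :=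
  isothermal_coordinates oD sf (fun x dx => (rm x dx).1) (fun x dx => (rm x dx).2) (ch_map_im dp).
pose dom := ch_dom d `&` ch_map d @^-1` U.
have odom : open dom.
  by apply: openI_preimage => //; [exact: ch_dom_open|exact: ch_map_continuous].
have dphiU y : V y -> ch_im d (phi y) by move=> Vy; apply: UD; have [] := phiK y Vy.
have H3 q : dom q -> V (psi (d q)) by move=> [_ Uq]; have [] := psiK _ Uq.
have H4 y : V y -> dom (ch_inv d (phi y)).
  move=> Vy; split; first exact: ch_inv_dom (dphiU y Vy).
  by rewrite /preimage /= ch_invK; [have [] := phiK y Vy|exact: dphiU].
have H5 q : dom q -> ch_inv d (phi (psi (d q))) = q.
  by move=> [dq Uq]; have [_ ->] := psiK _ Uq; exact: ch_mapK.
have H6 y : V y -> psi (d (ch_inv d (phi y))) = y.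
  by move=> Vy; rewrite ch_invK; [have [] := phiK y Vy|exact: dphiU].
have H7 q : dom q -> {for q, continuous (fun q => psi (d q))}.
  move=> [dq Uq]; apply: continuous_comp; first exact: ch_map_continuous dq.
  exact: smooth_on_continuous spsi Uq.
have H8 y : V y -> {for y, continuous (fun y => ch_inv d (phi y))}.
  move=> Vy; apply: continuous_comp; first exact: smooth_on_continuous sphi Vy.
  exact: ch_inv_continuous (dphiU y Vy).
(* The atlas chart [d] followed by the isothermal coordinates. Membership in the maximal atlas then
   needs the transitions with the charts of [A] in both directions, each a composite of orientation
   preserving maps. *)
pose c := @Chart R M dom V (fun q => psi (d q)) (fun y => ch_inv d (phi y)) odom oV H3 H4 H5 H6 H7 H8.
exists c; last by split=> //; exact: Up.
split; last exact: conf.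
move=> e Ae; have [[sde Jde] _] := atlas_oriented hA Ad Ae.
have [_ [sed Jed]] := atlas_oriented hA Ad Ae.
have oce := @overlap_open R M c e; have ode := @overlap_open R M d e.
have oec := @overlap_open R M e c; have oed := @overlap_open R M e d.
have m1 y : overlap c e y -> overlap d e (phi y).
  by move=> [Vy ey]; split; [exact: dphiU|exact: ey].
have sphi' : smooth_on (overlap c e) phi by apply: smooth_on_sub sphi => y [].
have m2 y : overlap e c y -> overlap e d y by move=> [ey [dy _]].
have m3 y : overlap e c y -> U (transition e d y) by move=> [ey [_ Uy]].
have sed' : smooth_on (overlap e c) (transition e d) by exact: smooth_on_sub m2 sed.
split; split.
- exact: smooth_on_comp_rV oce ode m1 sde sphi'.
- move=> y ovy.
  have E := partials_comp_pt oce ode ovy (m1 y ovy) sde sphi'.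
  have K (s t u : R) : s = t * u -> 0 < t -> 0 < u -> 0 < s by move=> ->; exact: mulr_gt0.
  exact: K E (dphi y ovy.1) (Jde _ (m1 y ovy)).
- exact: smooth_on_comp_rV oec oU m3 spsi sed'.
- move=> y ovy.
  have E := partials_comp_pt oec oU ovy (m3 y ovy) spsi sed'.
  have K (s t u : R) : s = t * u -> 0 < t -> 0 < u -> 0 < s by move=> ->; exact: mulr_gt0.
  exact: K E (Jed y (m2 y ovy)) (dpsi _ (m3 y ovy)).
Qed.

Section in_holomorphic_chart.
Variable c : chart R M.
Hypothesis hc : holomorphic_chart A X c.
Local Notation f := (local_rep X c).
Local Notation D := (ch_im c).
Local Notation q := (hopf_function f).

Let oc : oriented_chart A c := hc.1.
Let oD : open D := @ch_im_open R M c.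

Lemma holomorphic_chart_smooth : smooth_on D f.
Proof. by have [] := chart_regular hA hX oc. Qed.

Lemma holomorphic_chart_immersion x : D x -> cross (pd 0 f x) (pd 1 f x) != 0.
Proof. by move=> Dx; have [_ H] := chart_regular hA hX oc; have [] := H x Dx. Qed.

Lemma holomorphic_chart_conformal x : D x ->
  first_fundamental f x 0 0 = first_fundamental f x 1 1 /\ first_fundamental f x 0 1 = 0.
Proof. exact: hc.2. Qed.

Lemma holomorphic_chart_minimal x : D x ->
  second_fundamental f x 0 0 + second_fundamental f x 1 1 = 0.
Proof.
move=> Dx; have [_ H] := chart_regular hA hX oc; have [_ m] := H x Dx.
have [c0 c1] := holomorphic_chart_conformal Dx.
have E0 := conformal_factor_gt0 holomorphic_chart_immersion holomorphic_chart_conformal Dx.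
have gE := first_fundamental_entry f x 0 0.
have K (h00 h01 h10 h11 g00 g01 g11 e : R) : h00 * g11 - h01 * g01 + g00 * h11 - g01 * h10 = 0 ->
   g00 = g11 -> g01 = 0 -> g00 = e -> 0 < e -> h00 + h11 = 0.
  move=> e1 e2 e3 e4 e0; apply: (mulIf (lt0r_neq0 e0)).
  by rewrite mul0r -e1 -e2 e3 e4; ring.
exact: K m c0 c1 gE E0.
Qed.

Let sf := holomorphic_chart_smooth.
Let w0 := holomorphic_chart_immersion.
Let conf := holomorphic_chart_conformal.
Let minimal := holomorphic_chart_minimal.

Lemma hopf_function_coefficient : hopf_coefficient X c q.
Proof.
split; first exact: hopf_function_holomorphic oD sf w0 conf minimal.
by move=> x Dx v; exact: (hopf_function_form oD sf w0 minimal v Dx).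
Qed.

Lemma hopf_coefficientE a x : hopf_coefficient X c a -> D x -> a x = q x.
Proof.
move=> [_ H] Dx; exact: (hopf_function_unique oD sf w0 minimal Dx (H x Dx)).
Qed.

Lemma umbilic_hopf p : ch_dom c p -> umbilic A X p <-> q (c p) = 0.
Proof.
move=> cp; have Dp := ch_map_im cp.
apply: (iff_trans (umbilicE hA hX oc cp)).
have sy := second_fundamental_sym oD sf w0 0 1 Dp; have tr := minimal Dp.
have [c0 c1] := conf Dp; have gs := first_fundamental_sym f (c p).
have E0 := conformal_factor_gt0 w0 conf Dp; have gE := first_fundamental_entry f (c p) 0 0.
have K (H G : 'M[R]_2) (e : R) : 0 < e -> G 0 0 = e -> G 0 0 = G 1 1 -> G 0 1 = 0 -> G 1 0 = G 0 1 ->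
   H 0 1 = H 1 0 -> H 0 0 + H 1 1 = 0 ->
   (\det H / \det G = 0 <-> (H 0 0 +i* - H 0 1 : R[i]) = 0).
  clear; move=> e0 G0 G1 G01 G10 e1 /eqP; rewrite addrC addr_eq0 => /eqP e2.
  rewrite !det_mx22 -G1 G10 G01 G0 -e1 e2 mulr0 subr0.
  have -> : (H 0 0 * - H 0 0 - H 0 1 * H 0 1) / (e * e) = - (csq (H 0 0 +i* - H 0 1) / (e * e)).
    have -> : H 0 0 * - H 0 0 - H 0 1 * H 0 1 = - csq (H 0 0 +i* - H 0 1) by rewrite /csq /=; ring.
    by rewrite mulNr.
  have ee : e * e != 0 by rewrite mulf_neq0// gt_eqF.
  split=> [/eqP|->]; last by rewrite /csq /= !mul0r addr0 mul0r oppr0.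
  by rewrite oppr_eq0 mulf_eq0 invr_eq0 (negbTE ee) orbF csq_eq0 => /eqP.
exact: K E0 gE c0 c1 gs sy tr.
Qed.

Lemma iter_ddz_eq U (u v : pt -> R[i]) k x : open U -> U x -> (forall y, U y -> u y = v y) ->
  iter k (@ddz R) u x = iter k (@ddz R) v x.
Proof.
move=> oU; elim: k x => [|k IH] x Ux uv /=; first exact: uv.
by apply: (ddz_eq oU Ux) => y Uy; exact: IH.
Qed.

Lemma hopf_order_hopf_function p n : ch_dom c p ->
  (forall k, (k < n)%N -> iter k (@ddz R) q (c p) = 0) -> iter n (@ddz R) q (c p) != 0 ->
  hopf_order A X p n.
Proof. by move=> cp lo hi; exists c, q; split=> //; exact: hopf_function_coefficient. Qed.

Lemma holomorphic_chart_ratio p m (a : R[i]) : ch_dom c p -> (0 < m)%N ->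
  (forall k, (k < m)%N -> iter k (@ddz R) q (c p) = 0) -> iter m (@ddz R) q (c p) != 0 ->
  holds_off_umbilics A X (fun c x => entropy X c 5 x = a * (entropy X c 2 x * entropy X c 3 x)) ->
  a * (m%:R * (3 * m%:R + 4)) = - (24 * (m%:R + 2) ^+ 2).
Proof.
move=> cp m0 lo hi H; have Dp := ch_map_im cp.
apply: (isothermal_entropy_ratio oD sf w0 conf minimal Dp m0 lo hi) => x Dx qx.
apply: (H c hc x Dx) => /umbilic_hopf; rewrite ch_invK// => H0.
by move: qx; rewrite H0 ?eqxx//; exact: ch_inv_dom.
Qed.

End in_holomorphic_chart.

Lemma hopf_orderE p n : hopf_order A X p n -> exists c, [/\ holomorphic_chart A X c, ch_dom c p,
  (forall k, (k < n)%N -> iter k (@ddz R) (hopf_function (local_rep X c)) (c p) = 0) &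
  iter n (@ddz R) (hopf_function (local_rep X c)) (c p) != 0].
Proof.
move=> [c [q [hc cp hq lo hi]]]; exists c.
have E k : iter k (@ddz R) q (c p) = iter k (@ddz R) (hopf_function (local_rep X c)) (c p).
  apply: (iter_ddz_eq k (@ch_im_open R M c) (ch_map_im cp)) => y Dy.
  exact: hopf_coefficientE hc _ _ hq Dy.
by split=> //; [move=> k kn; rewrite -E lo|rewrite -E].
Qed.

Lemma finite_order c p : non_flat A X -> holomorphic_chart A X c -> ch_dom c p ->
  exists k, iter k (@ddz R) (hopf_function (local_rep X c)) (c p) != 0.
Proof.
move=> [p1 np1] hc cp; apply: contrapT => nk.
have flat k : iter k (@ddz R) (hopf_function (local_rep X c)) (c p) = 0.
  by apply/eqP/negPn/negP => H; apply: nk; exists k.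
(* The interior of the umbilic set, open by construction and free of any choice of chart. By [flatS]
   it contains every point at which the Hopf function is flat in some holomorphic chart. *)
pose S := [set p : M | \forall p' \near p, umbilic A X p'].
have flatS c' p' : holomorphic_chart A X c' -> ch_dom c' p' ->
    (forall k, iter k (@ddz R) (hopf_function (local_rep X c')) (c' p') = 0) -> S p'.
  move=> hc' cp' fl; have oD := @ch_im_open R M c'.
  have hq := (hopf_function_coefficient hc').1.
  have nf := holomorphic_flat oD (ch_map_im cp') hq fl.
  have cont := ch_map_continuous cp'.
  have n1 : \forall z \near p', hopf_function (local_rep X c') (c' z) = 0 by exact: cont nf.
  have n2 : \forall z \near p', ch_dom c' z by exact: open_nbhs_nbhs (conj (@ch_dom_open R M c') cp').
  by apply: filterS2 n1 n2 => z z0 cz; apply/(umbilic_hopf hc' cz).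
have Sp : S p by exact: flatS hc cp flat.
have oS : open S by rewrite openE => z /nbhs_interior; apply: filterS => y; exact: id.
(* At a limit point [z] of [S], a nonzero derivative of the Hopf function would remain nonzero on a
   neighbourhood, which meets [S]; but near points of [S] the function is identically 0. *)
have cS : closed S.
  move=> z clz; have [c' hc' cz] := holomorphic_chart_exists z.
  apply: (flatS c' z hc' cz) => k; apply/eqP/negPn/negP => nz.
  have oD := @ch_im_open R M c'.
  have [sq _] := (holomorphicP _ _).1 (hopf_function_coefficient hc').1.
  have oN := open_neq0 oD (csmooth_iter_ddz k oD sq).
  have nb : nbhs z (ch_dom c' `&` ch_map c' @^-1` (ch_im c' `&`
      [set x | iter k (@ddz R) (hopf_function (local_rep X c')) x != 0])).
    apply: filterI; first exact: open_nbhs_nbhs (conj (@ch_dom_open R M c') cz).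
    apply: (ch_map_continuous cz); apply: open_nbhs_nbhs; split=> //; split=> //; exact: ch_map_im.
  have [y [Sy [cy [Dy /= /negP]]]] := clz _ nb; apply.
  have oS' : open (ch_im c' `&` ch_inv c' @^-1` S).
    by apply: openI_preimage => //; exact: ch_inv_continuous.
  have yS' : (ch_im c' `&` ch_inv c' @^-1` S) (c' y) by split=> //; rewrite /preimage /= ch_mapK.
  rewrite (iter_ddz_eq (v := fun _ => 0) k oS' yS').
    have Z : ddz (fun _ : pt => 0 : R[i]) = (fun _ => 0) by apply/funext => w; exact: ddz_cst.
    by elim: k {nz nb oN} => [|k IH]; [rewrite /= eqxx|rewrite iterSr Z].
  move=> x [Dx Sx]; have dx := ch_inv_dom Dx.
  have /(umbilic_hopf hc' dx) := nbhs_singleton Sx.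
  by rewrite ch_invK.
have [_ _ cM _] := hA.
have ST : S = setT.
  by apply: cM; [exists p|exists S => //; rewrite setTI|exists S => //; rewrite setTI].
apply: np1; have Sp1 : S p1 by rewrite ST.
exact: nbhs_singleton Sp1.
Qed.

End holomorphic_charts.

(** * Weighted homogeneous relations of degree five *)

Section weighted_homogeneous_degree5.

Lemma poly_eq0_off0 (K : numFieldType) (P : {poly K}) :
  (forall x, x != 0 -> P.[x] = 0) -> P = 0.
Proof.
move=> H; apply/eqP/negPn/negP => P0.
pose rs : seq K := [seq i.+1%:R | i <- iota 0 (size P)].
have urs : uniq rs.
  rewrite map_inj_uniq ?iota_uniq// => i j /eqP.
  by rewrite eqr_nat eqSS => /eqP.
have ars : all (root P) rs.
  by apply/allP => x /mapP[i _ ->]; rewrite /root H// pnatr_eq0.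
by have := max_poly_roots P0 ars urs; rewrite size_map size_iota ltnn.
Qed.

(** For fixed [v], homogeneity is an identity between polynomials in [lambda] on an infinite set.
    Its coefficient of degree 5 retains the monomials of weight 5, and [2 i + 3 j + 4 k = 5] has the
    single solution (1, 1, 0). *)
Lemma weighted_homogeneous5 (K : numFieldType) (psi : mpoly.mpoly 3 K) :
  (forall (lambda : K) (v : 'I_3 -> K), lambda != 0 ->
    mpoly.meval (fun i => lambda ^+ (i + 2) * v i) psi = lambda ^+ 5 * mpoly.meval v psi) ->
  exists a : K, forall v : 'I_3 -> K, mpoly.meval v psi = a * (v 0 * v 1).
Proof.
move=> H.
pose wt (m : mpoly.multinom 3) := (\sum_(i < 3) (i + 2) * mpoly.fun_of_multinom m i)%N.
exists (\sum_(m <- mpoly.msupp psi | wt m == 5) mpoly.mcoeff m psi) => v.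
pose mono (m : mpoly.multinom 3) := \prod_i v i ^+ mpoly.fun_of_multinom m i.
pose Q : {poly K} := \sum_(m <- mpoly.msupp psi) (mpoly.mcoeff m psi * mono m) *: 'X^(wt m).
have QE : Q = mpoly.meval v psi *: 'X^5.
  apply/eqP; rewrite -subr_eq0; apply/eqP; apply: poly_eq0_off0 => x x0.
  rewrite hornerD hornerN hornerZ hornerXn mulrC -H// mpoly.mevalE horner_sum.
  apply/eqP; rewrite subr_eq0; apply/eqP; apply: eq_bigr => m _.
  rewrite hornerZ hornerXn -mulrA; congr (_ * _).
  under [RHS]eq_bigr => i _ do rewrite exprMn -exprM.
  by rewrite big_split /= mulrC -prodrXr.
have c5 : Q`_5 = mpoly.meval v psi by rewrite QE coefZ coefXn eqxx mulr1.
rewrite -c5 coef_sum mulr_suml [RHS]big_mkcond; apply: eq_bigr => m _.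
rewrite coefZ coefXn eq_sym; case: eqP => [w5|_]; last by rewrite mulr0.
rewrite mulr1; congr (_ * _).
have S3 (F : 'I_3 -> nat) : (\sum_(i < 3) F i = F 0%R + F 1%R + F 2%R)%N.
  by rewrite !big_ord_recl big_ord0 addn0 addnA; congr ((_ + F _) + F _)%N; apply: val_inj.
have P3 (F : 'I_3 -> K) : \prod_(i < 3) F i = F 0 * F 1 * F 2.
  by rewrite !big_ord_recl big_ord0 mulr1 mulrA; congr (_ * F _ * F _); apply: val_inj.
rewrite /mono P3; rewrite /wt S3 /= in w5.
have [-> -> ->] : [/\ mpoly.fun_of_multinom m 0 = 1%N, mpoly.fun_of_multinom m 1 = 1%N &
   mpoly.fun_of_multinom m 2 = 0%N].
  have K3 (i j k : nat) : (2 * i + 3 * j + 4 * k = 5)%N -> [/\ i = 1%N, j = 1%N & k = 0%N].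
    by move=> e; split; lia.
  exact: K3 w5.
by rewrite expr0 !expr1 mulr1.
Qed.

End weighted_homogeneous_degree5.

(** * From the degree relation to the common order *)

Lemma degree_relation5 {R : realType} {M : topologicalType} (A : set (chart R M)) (X : M -> 'rV[R]_3) :
  degree_relation A X 5 -> exists a : R[i], holds_off_umbilics A X (fun c x =>
    entropy X c 5 x = a * (entropy X c 2 x * entropy X c 3 x)).
Proof.
case=> [H|[psi [_ hom] H]].
  by exists 0 => c hc x cx nu; rewrite mul0r; exact: H c hc x cx nu.
have [a aE] := weighted_homogeneous5 hom.
exists a => c hc x cx nu; apply: etrans (H c hc x cx nu) _.
exact: (aE (fun i : 'I_3 => entropy X c (i + 2) x)).
Qed.

(** Eliminating [a] by cross multiplication leaves 24 times [m - n] times a factor that is positive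
    for natural numbers. *)
Lemma order_from_ratio (K : numFieldType) (a : K) (m n : nat) : (0 < m)%N -> (0 < n)%N ->
  a * (m%:R * (3 * m%:R + 4)) = - (24 * (m%:R + 2) ^+ 2) ->
  a * (n%:R * (3 * n%:R + 4)) = - (24 * (n%:R + 2) ^+ 2) -> m = n.
Proof.
move=> m0 n0 em en.
have E : (m%:R - n%:R) * (8 * m%:R * n%:R + 12 * (m%:R + n%:R) + 16) = 0 :> K.
  have h : a * (m%:R * (3 * m%:R + 4)) * (n%:R * (3 * n%:R + 4))
    = a * (n%:R * (3 * n%:R + 4)) * (m%:R * (3 * m%:R + 4)) by ring.
  rewrite em en in h.
  have h24 : (24 : K) != 0 by rewrite pnatr_eq0.
  apply: (mulfI h24); rewrite mulr0.
  transitivity (- (24 * (m%:R + 2) ^+ 2) * (n%:R * (3 * n%:R + 4))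
     - -  (24 * (n%:R + 2) ^+ 2) * (m%:R * (3 * m%:R + 4)) : K); last by rewrite h subrr.
  by ring.
move/eqP: E; rewrite mulf_eq0 subr_eq0 eqr_nat => /orP[/eqP//|].
by rewrite gt_eqF// ltr_wpDl// addr_ge0 ?mulr_ge0 ?addr_ge0.
Qed.

Theorem proposition4p10 (R : realType) (M : topologicalType)
    (A : set (chart R M)) (X : M -> 'rV[R]_3) (n : nat) (p0 : M) :
  oriented_surface A ->
  minimal_immersion A X ->
  has_degree A X 5 ->
  umbilic A X p0 ->
  (1 <= n)%N ->
  hopf_order A X p0 n ->
  (forall p, umbilic A X p -> hopf_order A X p n) /\
  holds_off_umbilics A X (fun c x =>
    entropy X c 5 x
    + 24 * (((n + 2) ^ 2)%:R / ((3 * n + 4) * n)%:R)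
      * entropy X c 3 x * entropy X c 2 x = 0)%R.
Proof.
move=> hA hX [nf _ /degree_relation5[a aE] _] _ n1 /(hopf_orderE hA hX)[c [hc cp lo hi]].
have en := holomorphic_chart_ratio hA hX hc cp n1 lo hi aE.
split=> [p up|d hd x dx nu].
  have [e he ep] := holomorphic_chart_exists hA hX p.
  have ex := finite_order hA hX nf he ep.
  (* The order at [p] is the least index of a nonvanishing derivative; it is positive because the
     Hopf function vanishes at an umbilic point. *)
  pose m := ex_minn ex.
  have [mi ml] : iter m (@ddz R) (hopf_function (local_rep X e)) (e p) != 0 /\
     forall k, (k < m)%N -> iter k (@ddz R) (hopf_function (local_rep X e)) (e p) = 0.
    rewrite /m; case: ex_minnP => k ki kl; split=> // j jk.
    by apply/eqP/negPn/negP => /kl; rewrite leqNgt jk.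
  have m0 : (0 < m)%N.
    rewrite lt0n; apply/eqP => m0; move: mi; rewrite m0 /=.
    by have -> := (umbilic_hopf hA hX he ep).1 up; rewrite eqxx.
  have em := holomorphic_chart_ratio hA hX he ep m0 ml mi aE.
  rewrite -(order_from_ratio m0 n1 em en).
  exact: (hopf_order_hopf_function hA hX he ep ml mi).
rewrite (aE d hd x dx nu).
have n0 : n%:R * (3 * n%:R + 4) != 0 :> R[i].
  by rewrite -natrM -natrD -natrM pnatr_eq0 muln_eq0 addn_eq0 negb_or -lt0n n1 andbF.
(* The ratio at [p0] alone determines the global constant [a]. *)
have -> : a = - (24 * (n%:R + 2) ^+ 2) / (n%:R * (3 * n%:R + 4)) by rewrite -en mulfK.
rewrite natrX natrD natrM natrD natrM.
have K (s b u v : R[i]) : b = s -> - (24 * b) / (n%:R * (3 * n%:R + 4)) * (u * v)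
  + 24 * (s / ((3 * n%:R + 4) * n%:R)) * v * u = 0.
  by move=> ->; rewrite [(_ + _) * n%:R]mulrC; ring.
exact: K.
Qed.
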